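(* Let $T\in\mathbb R^{3\times3\times5}$ be a Gaussian tensor and let $M_0,\dots,M_3\in\mathbb R^{3\times3}$ be independent Gaussian matrices. Define the random cubic surface $S=\{[z_0:\dots:z_3]\in\mathbb P^3:\det(z_0M_0+\dots+z_3M_3)=0\}$. Then $$\Pr\{\mathrm{rank}(T)=5\}=\Pr\{\text{all 27 lines on } S \text{ are real}\}.$$
   Context: A Gaussian tensor (resp. matrix) has i.i.d. standard Gaussian entries. Tensor rank is the minimal number of rank-one tensors $a\otimes b\otimes c$ summing to $T$. With probability one $S$ is a smooth real cubic surface, which contains 27 complex lines, of which 3, 7, 15 or 27 are real. *)

(* Defs.v *)
From mathcomp Require Import all_boot all_algebra.
From mathcomp Require Import all_classical all_reals all_analysis.
From mathcomp Require Import complex.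
Set Implicit Arguments. Unset Strict Implicit. Unset Printing Implicit Defensive.
Import GRing.Theory Num.Theory.
Local Open Scope ring_scope.

(* Standard Gaussian probability of an event on R^n, via iterated     *)
(* integrals against the standard normal distribution N(0,1) (this is  *)
(* the product measure N(0,1)^{(x) n} evaluated on measurable events,  *)
(* by Fubini--Tonelli).                                               *)
Fixpoint gauss_tuple_prob {R : realType} (n : nat) : set (n.-tuple R) -> \bar R :=
  match n with
  | 0 => fun A => ((\1_A [tuple] : R)%:E)
  | m.+1 => fun A =>
      (\int[normal_prob 0 1]_x
         gauss_tuple_prob (n := m) [set t | A (cons_tuple x t)])%E
  end.

Definition gauss_prob {R : realType} (I : finType) (A : set {ffun I -> R}) : \bar R :=
  gauss_tuple_prob [set t : #|I|.-tuple R | A [ffun i => tnth t (enum_rank i)]].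

Definition tensor_rank_le {R : realType} (n1 n2 n3 : nat)
    (T : 'I_n1 -> 'I_n2 -> 'I_n3 -> R) (r : nat) : Prop :=
  exists (a : 'I_r -> 'I_n1 -> R) (b : 'I_r -> 'I_n2 -> R) (c : 'I_r -> 'I_n3 -> R),
    forall i j l, T i j l = \sum_(k < r) a k i * b k j * c k l.

(* The tensor rank: the least such r (every tensor has a decomposition,
   e.g. with n1*n2*n3 terms; the fallback 0 is never used). *)
Definition tensor_rank {R : realType} (n1 n2 n3 : nat)
    (T : 'I_n1 -> 'I_n2 -> 'I_n3 -> R) : nat :=
  match pselect (exists r, `[< tensor_rank_le T r >]) with
  | left h => ex_minn h
  | right _ => 0%N
  end.

Local Open Scope complex_scope.

Definition cplx_mx {R : realType} (m n : nat) (A : 'M[R]_(m, n)) : 'M[R[i]]_(m, n) :=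
  map_mx (fun x => x%:C) A.

Definition cubic_form {R : realType} (M : 'I_4 -> 'M[R]_3) (z : 'rV[R[i]]_4) : R[i] :=
  \det (\sum_(k < 4) z ord0 k *: cplx_mx (M k)).

Definition line_on_surface {R : realType} (M : 'I_4 -> 'M[R]_3)
    (p q : 'rV[R[i]]_4) : Prop :=
  \rank (col_mx p q) = 2%N /\ forall s t : R[i], cubic_form M (s *: p + t *: q) = 0.

Definition real_line {R : realType} (p q : 'rV[R[i]]_4) : Prop :=
  exists a b : 'rV[R]_4, (col_mx p q == col_mx (cplx_mx a) (cplx_mx b))%MS.

Definition all_lines_real {R : realType} (M : 'I_4 -> 'M[R]_3) : Prop :=
  forall p q : 'rV[R[i]]_4, line_on_surface M p q -> real_line p q.

(* Main.v *)
(* Let V be the orthogonal complement in R^9 of the four matrices M_k.  Both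
   sides equal the probability that a Haar-random 5-dimensional subspace of R^9
   is spanned by five real matrices of rank one: the span of the slices of T and
   the space V are almost surely 5-dimensional, with rotation invariant laws.
   For T this is the meaning of rank 5.
   For M, the complexification of V contains six matrices a_p^T b_p of rank one
   and the a_p, b_p are points at which the surface is blown down.  If the lines
   are real then so are the points, and any five of the six matrices span V.
   Conversely, five real rank-one matrices spanning V put the surface in the form
   x1 x2 x3 + y1 y2 y3 = 0, with two real linear relations between the six forms;
   on a line of the surface either some x_i and y_j vanish, or each x_i is a
   multiple of some y_j, and in both cases the relations force the line to be
   real. *)
Require Import Defs.
From HB Require Import structures.
From mathcomp Require Import all_boot all_order all_algebra.
From mathcomp Require Import all_classical all_reals all_analysis.
From mathcomp Require Import measurable_realfun complex separable perm ring lra zify.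
Import Order.TTheory GRing.Theory Num.Theory.
Import numFieldNormedType.Exports.
Set Implicit Arguments. Unset Strict Implicit. Unset Printing Implicit Defensive.
Local Open Scope ring_scope.
Local Open Scope classical_set_scope.

(** * Gaussian measure and orthogonal invariance *)

Section gaussian_measure.
Variable R : realType.
Local Notation rT := (measurableTypeR R).
Local Notation gam := (normal_prob (0:R) 1 : probability rT R).

(** The event about lines is not visibly measurable, while [gauss_prob] is an iterated integral
    defined on every set. Hence [gen]: an event that agrees with a measurable one outside finitely
    many values of each coordinate in turn has the same [gauss_tuple_prob], so of the events
    compared only [covered5] is shown measurable. No Haar measure is constructed: the Gram-Schmidt
    factor of a 9 by 9 Gaussian matrix takes its place, and Fubini for an independent rotation of a
    random subspace identifies both sides with the constant [kappa]. Genericity always has the same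
    source: a function that is polynomial in each variable and nonzero at one, possibly complex,
    point. For smoothness it is a Macaulay determinant at the Fermat cubic; for the six rank-one
    matrices, two of the four matrices are diagonalized and a sextic in one unknown remains, tested
    at [3 X^6 + 1]. The 27 lines are never enumerated: one direction uses only the lines attached to
    the six points, the other treats an arbitrary line of the surface. *)

Definition consT n (p : rT * n.-tuple rT) : n.+1.-tuple rT := cons_tuple p.1 p.2.
Lemma measurable_consT n : measurable_fun setT (@consT n).
Proof. exact: (@measurable_cons _ _ _ _ fst _ snd). Qed.
HB.instance Definition _ n := isMeasurableFun.Build _ _ _ _ (@consT n) (@measurable_consT n).
Fixpoint gaussn n : probability (n.-tuple rT) R :=
  match n with
  | 0 => \d_([tuple])
  | m.+1 => distribution (gam \x gaussn m)%E (@consT m)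
  end.

Lemma gauss_tuple_probE n (A : set (n.-tuple rT)) : measurable A ->
  gauss_tuple_prob A = gaussn n A.
Proof.
elim: n A => [|n IH] A mA /=; first by rewrite diracE.
rewrite /distribution /pushforward /= /product_measure1 /=.
have mA' : measurable (@consT n @^-1` A) by rewrite -[X in measurable X]setTI; exact: measurable_consT.
apply: eq_integral => x _.
rewrite IH.
  by congr (gaussn n _); apply/seteqP; split => y; rewrite /xsection /= inE.
by have := measurable_xsection x mA'; congr measurable; apply/seteqP; split => y; rewrite /xsection /= inE.
Qed.

Lemma integral_gaussnS n (f : n.+1.-tuple rT -> \bar R) : measurable_fun [set: n.+1.-tuple rT] f ->
  (forall t, 0 <= f t)%E ->
  (\int[gaussn n.+1]_t f t = \int[gam]_x \int[gaussn n]_t f (cons_tuple x t))%E.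
Proof.
move=> mf f0; rewrite /= /distribution ge0_integral_pushforward//.
rewrite preimage_setT (fubini_tonelli1 (f \o @consT n))//.
- by apply: measurableT_comp => //; exact: measurable_consT.
- by move=> x; exact: f0.
Qed.

(* "For generic t": all but finitely many values of each coordinate in turn.
   It implies almost surely, but is meaningful for non-measurable predicates. *)
Fixpoint gen n : (n.-tuple R -> Prop) -> Prop :=
  match n with
  | 0 => fun P => P [tuple]
  | m.+1 => fun P => exists s : seq R, forall x, x \notin s -> gen (fun t : m.-tuple R => P (cons_tuple x t))
  end.

Lemma gen_imply n (P Q : n.-tuple R -> Prop) : (forall t, P t -> Q t) -> gen P -> gen Q.
Proof.
elim: n P Q => [|n IH] P Q PQ /=; first exact: PQ.
by move=> [s Hs]; exists s => x /Hs; apply: IH => t; apply: PQ.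
Qed.

Lemma gen_and n (P Q : n.-tuple R -> Prop) : gen P -> gen Q -> gen (fun t => P t /\ Q t).
Proof.
elim: n P Q => [|n IH] P Q /=; first by [].
move=> [s Hs] [s' Hs']; exists (s ++ s') => x; rewrite mem_cat negb_or => /andP[/Hs ? /Hs' ?].
exact: IH.
Qed.

Lemma gam_set1 (x : R) : gam [set x] = 0%E.
Proof. exact: integral_set1. Qed.

Lemma finite_measurable (A : set rT) : finite_set A -> measurable A.
Proof.
move=> fA; apply: countable_measurable; last exact: finite_set_countable.
by move=> t; exact: (@measurable_set1 R t).
Qed.

Lemma gam_seq (s : seq R) : gam [set` s] = 0%E.
Proof.
elim: s => [|x s IH]; first by rewrite set_nil measure0.
have ms : measurable ([set` s] : set rT).
  by apply: finite_measurable; exact: finite_seq.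
have -> : [set` x :: s] = [set x] `|` [set` s] :> set rT.
  by apply/seteqP; split => y /=; rewrite inE => /predU1P.
apply/eqP; rewrite eq_le measure_ge0 andbT.
apply: (le_trans (measureU2 _ _ ms)) => //.
rewrite -[X in (_ <= X)%E]adde0; apply: leeD; rewrite le_eqVlt; apply/orP; left; apply/eqP; [exact: gam_set1|exact: IH].
Qed.

Lemma gauss_tuple_prob_ge0 n (A : set (n.-tuple rT)) : (0 <= gauss_tuple_prob A)%E.
Proof.
elim: n A => [|n IH] A /=; first by rewrite lee_fin.
by apply: integral_ge0 => x _; exact: IH.
Qed.

(** Only [A] is measurable. By induction the inner integrals for [B] agree with those for [A] off a
    finite set, which makes them measurable too, and a finite set is null for the normal law. *)
Lemma gauss_tuple_prob_gen n (A B : set (n.-tuple rT)) : measurable A ->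
  gen (fun t => A t <-> B t) -> gauss_tuple_prob A = gauss_tuple_prob B.
Proof.
elim: n A B => [|n IH] A B mA /=.
  move=> AB; congr (_%:E); rewrite !indicE; congr (nat_of_bool _)%:R.
  by apply/idP/idP; rewrite !inE => /AB.
move=> [s Hs].
have mA' x : measurable [set t : n.-tuple rT | A (cons_tuple x t)].
  have mA' : measurable (@consT n @^-1` A) by rewrite -[X in measurable X]setTI; exact: measurable_consT.
  by have := measurable_xsection x mA'; congr measurable; apply/seteqP; split => y; rewrite /xsection /= inE.
have ms : measurable ([set` s] : set rT).
  by apply: finite_measurable; exact: finite_seq.
set f := fun x : rT => gauss_tuple_prob [set t : n.-tuple rT | A (cons_tuple x t)].
set g := fun x : rT => gauss_tuple_prob [set t : n.-tuple rT | B (cons_tuple x t)].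
have fg x : x \notin s -> f x = g x by move=> xs; apply: IH; [exact: mA'|exact: Hs].
have mf : measurable_fun [set: rT] f.
  have mAc : measurable (@consT n @^-1` A) by rewrite -[X in measurable X]setTI; exact: measurable_consT.
  have := @measurable_fun_xsection _ _ _ _ _ (gaussn n) _ mAc; congr measurable_fun.
  apply/funext => x; rewrite /f gauss_tuple_probE//; congr (gaussn n _).
  by apply/seteqP; split => y; rewrite /xsection /= inE.
have g0 x : (0 <= g x)%E by exact: gauss_tuple_prob_ge0.
have mg : measurable_fun [set: rT] g.
  rewrite -(setUv [set` s]); apply/measurable_funU => //; first exact: measurableC.
  split.
    move=> _ Y mY; apply: finite_measurable.
    by apply: sub_finite_set (finite_seq s) => x [].
  apply: (eq_measurable_fun f); last exact: measurable_funTS.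
  by move=> x; rewrite inE /= => /negP xs; apply: fg.
apply: ge0_ae_eq_integral => //.
- by move=> x _; exact: gauss_tuple_prob_ge0.
- by move=> x _; exact: gauss_tuple_prob_ge0.
exists [set` s]; split => //; first exact: gam_seq.
by move=> x /= H; apply/negPn/negP => xs; apply: H => _; exact: fg.
Qed.

End gaussian_measure.

(** * Factorization of orthogonal matrices *)

Section orthogonal_matrices.
Variable R : realType.

Definition orthmx n (Q : 'M[R]_n) := Q *m Q^T = 1%:M.

Lemma orthmx_tr n (Q : 'M[R]_n) : orthmx Q -> orthmx Q^T.
Proof. by rewrite /orthmx trmxK => /mulmx1C. Qed.

Lemma orthmxM n (P Q : 'M[R]_n) : orthmx P -> orthmx Q -> orthmx (P *m Q).
Proof. by rewrite /orthmx trmx_mul => hP hQ; rewrite mulmxA -(mulmxA P) hQ mulmx1. Qed.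

Lemma orthmx1 n : orthmx (1%:M : 'M[R]_n).
Proof. by rewrite /orthmx trmx1 mulmx1. Qed.

Lemma row_mulmxT_ge0 n (u : 'rV[R]_n) : 0 <= (u *m u^T) 0 0.
Proof. by rewrite mxE; apply: sumr_ge0 => i _; rewrite mxE -expr2 sqr_ge0. Qed.

Lemma row_mulmxT_eq0 n (u : 'rV[R]_n) : (u *m u^T) 0 0 = 0 -> u = 0.
Proof.
rewrite mxE => /eqP; rewrite psumr_eq0 => [/allP H|i _]; last by rewrite mxE -expr2 sqr_ge0.
apply/rowP => i; rewrite mxE; have := H i (mem_index_enum i).
by rewrite mxE -expr2 sqrf_eq0 => /eqP.
Qed.

Lemma row_mulmxE n (u v : 'rV[R]_n) : u *m v^T = ((u *m v^T) 0 0)%:M.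
Proof. exact: mx11_scalar. Qed.

(* Householder reflection exchanging two vectors of the same length *)
Lemma orthmx_row n (e u : 'rV[R]_n) : (u *m u^T) 0 0 = (e *m e^T) 0 0 ->
  exists2 H : 'M[R]_n, orthmx H & e *m H = u.
Proof.
move=> ue; have [->|ne] := eqVneq e u; first by exists 1%:M; [exact: orthmx1|rewrite mulmx1].
have [w wE] : exists w : 'rV[R]_n, w = u - e by exists (u - e).
pose d := (w *m w^T) 0 0.
have d0 : d != 0.
  by apply: contra ne => /eqP /row_mulmxT_eq0 /eqP; rewrite wE subr_eq0 eq_sym.
have wwT : w *m w^T = d%:M by exact: row_mulmxE.
pose k := 2 / d; pose H := 1%:M - k *: (w^T *m w).
have HT : H^T = H by rewrite /H linearB /= linearZ /= trmx_mul trmxK trmx1.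
have dE : d = 2 * ((e *m e^T) 0 0 - (e *m w^T) 0 0 - (e *m e^T) 0 0).
  have eu : (e *m u^T) 0 0 = (u *m e^T) 0 0.
    by rewrite -[in LHS](trmxK e) -trmx_mul mxE.
  have subE (A B : 'M[R]_1) : (A - B) 0 0 = A 0 0 - B 0 0 by rewrite 2!mxE.
  rewrite /d wE linearB /= mulmxBl !mulmxBr !subE ue eu; ring.
exists H.
  rewrite /orthmx HT /H mulmxBl mul1mx mulmxBr mulmx1 -scalemxAl -scalemxAr.
  rewrite mulmxA -(mulmxA w^T) wwT mul_mx_scalar -scalemxAl !scalerA.
  have kkd : k * (k * d) = k + k by rewrite /k; field.
  by rewrite kkd scalerDl opprB addrK subrK.
rewrite /H mulmxBr mulmx1 -scalemxAr mulmxA (row_mulmxE e w) mul_scalar_mx scalerA.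
have -> : k * (e *m w^T) 0 0 = -1.
  rewrite /k; have -> : (e *m w^T) 0 0 = - d / 2 by rewrite dE; field.
  by field.
by rewrite scaleN1r opprK wE addrC subrK.
Qed.

Definition givens n (c s : R) : 'M[R]_(1 + (1 + n)) :=
  block_mx c%:M (row_mx s%:M 0) (col_mx (- s)%:M 0) (block_mx c%:M 0 0 1%:M).

Lemma orthmx_block n (H : 'M[R]_n) : orthmx H -> orthmx (block_mx 1%:M 0 0 H : 'M[R]_(1 + n)).
Proof.
move=> h; rewrite /orthmx tr_block_mx !trmx0 trmx1 mulmx_block !(mulmx0, mul0mx) mulmx1 h.
by rewrite !addr0 !add0r -scalar_mx_block.
Qed.

Lemma orthmx_givens n c s : c ^+ 2 + s ^+ 2 = 1 -> orthmx (givens n c s).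
Proof.
move=> cs; rewrite /orthmx /givens tr_block_mx tr_row_mx tr_col_mx tr_block_mx.
rewrite !trmx0 !tr_scalar_mx mulmx_block mul_row_col mul_row_block mul_mx_row.
rewrite mul_col_mx mul_col_row mul_block_col mulmx_block.
rewrite !(mulmx0, mul0mx) -!scalar_mxM !addr0 !add0r mulr1 add_col_mx.
rewrite add_row_mx add_block_mx !addr0 !add0r -!raddfD /=.
have -> : c * c + s * s = 1 by rewrite -cs; ring.
have -> : - s * - s + c * c = 1 by rewrite -cs; ring.
have -> : c * - s + s * c = 0 by ring.
have -> : - s * c + c * s = 0 by ring.
by rewrite !raddf0 row_mx0 col_mx0 -!scalar_mx_block.
Qed.

(** The first row of [Q] is [(c, w)]. If [H2] turns the first axis into the direction of [w], the
    product of the Givens rotation and the block of [H2] has the same first row as [Q], so [Q] times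
    its inverse fixes the first axis and is a block [H1]. *)
Lemma orthmx_decomp n (Q : 'M[R]_(1 + (1 + n))) : orthmx Q ->
  exists H1 H2 : 'M[R]_(1 + n), exists c s, [/\ orthmx H1, orthmx H2, c ^+ 2 + s ^+ 2 = 1 &
    Q = block_mx 1%:M 0 0 H1 *m givens n c s *m block_mx 1%:M 0 0 H2].
Proof.
move=> hQ; pose e : 'rV[R]_(1 + (1 + n)) := row_mx 1%:M 0.
pose e' : 'rV[R]_(1 + n) := row_mx 1%:M 0.
pose c := lsubmx (e *m Q) 0 0; pose w := rsubmx (e *m Q).
have eQ : e *m Q = row_mx c%:M w by rewrite -[LHS]hsubmxK -mx11_scalar.
have e'1 : (e' *m e'^T) 0 0 = 1.
  by rewrite /e' tr_row_mx mul_row_col trmx1 trmx0 mulmx1 mulmx0 addr0 mxE.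
have e1 : (e *m e^T) 0 0 = 1.
  by rewrite /e tr_row_mx mul_row_col trmx1 trmx0 mulmx1 mulmx0 addr0 mxE.
pose s2 := (w *m w^T) 0 0.
have cs2 : c ^+ 2 + s2 = 1.
  have : ((e *m Q) *m (e *m Q)^T) 0 0 = 1.
    by rewrite trmx_mul mulmxA -(mulmxA e) hQ mulmx1.
  rewrite eQ tr_row_mx mul_row_col tr_scalar_mx -scalar_mxM mxE => <-.
  by rewrite mxE eqxx mulr1n -expr2.
pose s := Num.sqrt s2.
have ss : s ^+ 2 = s2 by rewrite sqr_sqrtr ?row_mulmxT_ge0.
have [H2 hH2 eH2] : exists2 H2 : 'M[R]_(1 + n), orthmx H2 & s *: (e' *m H2) = w.
  have [s0|s0] := eqVneq s 0.
    exists 1%:M; first exact: orthmx1.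
    by rewrite s0 scale0r; apply/esym/row_mulmxT_eq0; rewrite -/s2 -ss s0 expr0n.
  have [|H2 h2 e2] := @orthmx_row _ e' (s^-1 *: w).
    rewrite e'1 linearZ /= -scalemxAl -scalemxAr scalerA mxE -/s2 -ss; by field.
  by exists H2 => //; rewrite e2 scalerA divff // scale1r.
pose B2 : 'M[R]_(1 + (1 + n)) := block_mx 1%:M 0 0 H2.
have hG : orthmx (givens n c s *m B2).
  by apply: orthmxM; [apply: orthmx_givens; rewrite ss|exact: orthmx_block].
have eG : e *m (givens n c s *m B2) = e *m Q.
  rewrite mulmxA eQ /e /givens mul_row_block !(mul1mx, mul0mx) !addr0.
  rewrite mul_row_block mulmx1 !mulmx0 addr0 add0r; congr row_mx.
  by rewrite -eH2 /e' scalemxAl scale_row_mx scaler0 scalemx1.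
pose Q' := Q *m (givens n c s *m B2)^T.
have hQ' : orthmx Q' by apply: orthmxM => //; exact: orthmx_tr.
have eQ' : e *m Q' = e by rewrite /Q' mulmxA -eG -mulmxA hG mulmx1.
have eQT : e *m Q'^T = e by rewrite -{1}eQ' -mulmxA hQ' mulmx1.
(* [e] is fixed by [Q'] and by its transpose, which determines the first row and the first
   column. *)
have Q'E : Q' = block_mx 1%:M 0 0 (drsubmx Q').
  rewrite -[LHS]submxK; move: eQ' eQT; rewrite -{1 2}(submxK Q') tr_block_mx /e.
  rewrite !mul_row_block !mul1mx !mul0mx !addr0 => /eq_row_mx[-> ->] /eq_row_mx[_].
  by move=> /(congr1 trmx); rewrite trmxK trmx0 => ->.
exists (drsubmx Q'), H2, c, s; split => //; last 1 first.
  rewrite -mulmxA -/B2 -Q'E /Q' -mulmxA.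
  by have /orthmx_tr := hG; rewrite /orthmx trmxK => ->; rewrite mulmx1.
- have := hQ'; rewrite /orthmx {1 2}Q'E tr_block_mx mulmx_block !trmx0 !(mulmx0,mul0mx) !add0r.
  by rewrite (scalar_mx_block 1 _ 1) => /eq_block_mx[].
- by rewrite ss.
Qed.

End orthogonal_matrices.

(** * Rotation invariance of the planar Gaussian measure *)

Section gaussian_rotation.
Variable R : realType.
Local Notation rT := (measurableTypeR R).
Local Notation gam := (normal_prob (0:R) 1 : probability rT R).
Local Notation mu := (@lebesgue_measure R).
Local Notation phi := (normal_pdf (0:R) 1).

Import HBNNSimple.

(** Monotone convergence reduces the claim to simple functions and then to indicators, where it is
    the definition of [normal_prob]. *)
Lemma ge0_integral_normal (f : rT -> \bar R) : measurable_fun [set: rT] f ->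
  (forall x, 0 <= f x)%E ->
  (\int[gam]_x f x = \int[mu]_x (f x * (phi x)%:E))%E.
Proof.
move=> mf f0.
have mphi : measurable_fun [set: rT] (fun x : rT => (phi x)%:E).
  by apply/measurable_EFinP; exact: measurable_normal_pdf.
pose f_ := nnsfun_approx (@measurableT _ rT) mf.
transitivity (limn (fun n => \int[gam]_x (f_ n x)%:E))%E.
  rewrite -monotone_convergence//.
  - apply: eq_integral => y _; apply/esym/cvg_lim => //.
    by apply: cvg_nnsfun_approx.
  - by move=> n; exact/measurable_EFinP/measurable_funP.
  - by move=> n y _; rewrite lee_fin.
  - by move=> y _ m n mn; rewrite lee_fin; exact/lefP/nd_nnsfun_approx.
rewrite [X in limn X](_ : _ =
    (fun n => \int[mu]_x ((f_ n x)%:E * (phi x)%:E))%E).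
  rewrite -monotone_convergence//.
  - apply: eq_integral => x _ /=; apply/cvg_lim => //.
    apply: cvgeZr; first by rewrite fin_numE.
    by apply: cvg_nnsfun_approx.
  - by move=> n; apply: emeasurable_funM => //; exact/measurable_EFinP/measurable_funP.
  - by move=> n x _ /=; rewrite mule_ge0 ?lee_fin ?normal_pdf_ge0.
  - move=> x _ m n mn; apply: lee_wpmul2r; first by rewrite lee_fin normal_pdf_ge0.
    by rewrite lee_fin; exact/lefP/nd_nnsfun_approx.
apply/funext => n.
transitivity (\sum_(k \in range (f_ n))
    \int[gam]_x (k * \1_(f_ n @^-1` [set k]) x)%:E)%E.
  under eq_integral do rewrite fimfunE -fsumEFin//.
  rewrite ge0_integral_fsum//.
  - by move=> y; exact/measurable_EFinP/measurable_funM.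
  - by move=> y x _; rewrite nnfun_muleindic_ge0.
transitivity (\sum_(k \in range (f_ n))
    \int[mu]_x ((k * \1_(f_ n @^-1` [set k]) x)%:E * (phi x)%:E))%E.
  apply: eq_fsbigr => r _.
  rewrite integralZl_indic_nnsfun// integral_indic//= setIT.
  have [r0|r0] := leP 0 r; last first.
    rewrite preimage_nnfun0// measure0 mule0 integral0_eq// => x _.
    by rewrite indic0 mulr0 mul0e.
  rewrite /normal_prob integral_mkcond /=.
  rewrite -ge0_integralZl//=; last 2 first.
  - apply/(measurable_restrictT _ _).1 => //; exact: measurable_funTS.
  - by move=> x _; rewrite /patch; case: ifP => // _; rewrite lee_fin normal_pdf_ge0.
  apply: eq_integral => x _; rewrite /patch indicE; case: ifP => // _.
    by rewrite mulr1.
  by rewrite mulr0 mul0e mule0.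
rewrite -ge0_integral_fsum//.
- apply: eq_integral => x _; rewrite -ge0_mule_fsuml ?fsumEFin -?fimfunE//.
  by move=> k; exact: nnfun_muleindic_ge0.
- by move=> r; apply: emeasurable_funM => //; exact/measurable_EFinP/measurable_funM.
- by move=> r x _; rewrite mule_ge0 ?lee_fin ?normal_pdf_ge0// -lee_fin nnfun_muleindic_ge0.
Qed.

(** The pushforward by a translation gives half-open intervals their length, so it is the Lebesgue
    measure by uniqueness. *)
Lemma ge0_integral_shift (a : R) (f : rT -> \bar R) : measurable_fun [set: rT] f ->
  (forall x, 0 <= f x)%E -> (\int[mu]_x f (x + a)%R = \int[mu]_x f x)%E.
Proof.
move=> mf f0; pose tau : rT -> rT := fun x => x + a.
have mtau : measurable_fun [set: rT] tau by apply: measurable_funD.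
transitivity (\int[pushforward mu tau]_x f x)%E.
  by rewrite ge0_integral_pushforward.
apply: eq_measure_integral => A mA _ /=; apply/esym.
pose tm : {mfun rT >-> rT} := HB.pack tau (isMeasurableFun.Build _ _ _ _ tau mtau).
apply: (@lebesgue_measure_unique R (pushforward mu tm)) => // X [[b c] _ <-] /=.
rewrite /pushforward (_ : tm @^-1` _ = `](b - a), (c - a)]%classic).
  rewrite !lebesgue_measure_itv/= !lte_fin ltrD2r; case: ifP => // _.
  by rewrite -!EFinB; congr (_%:E); ring.
apply/seteqP; split => y /=; rewrite !in_itv /= /tau => /andP[? ?]; apply/andP; split; lra.
Qed.

Definition plane_integral (G : rT * rT -> \bar R) : \bar R := (\int[mu]_x \int[mu]_y G (x, y))%E.

Lemma measurable_lin2 (a b : R) : measurable_fun [set: rT * rT] (fun p : rT * rT => (a * p.1 + b * p.2 : rT)).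
Proof. by apply: measurable_funD; apply: measurable_funM. Qed.

Lemma plane_integral_shearY t (G : rT * rT -> \bar R) : measurable_fun [set: rT * rT] G ->
  (forall p, 0 <= G p)%E ->
  plane_integral (fun p => G (p.1, p.2 + t * p.1)) = plane_integral G.
Proof.
move=> mG G0; apply: eq_integral => x _ /=.
apply: (@ge0_integral_shift (t * x) (fun y => G (x, y))) => //.
by apply: measurableT_comp => //; exact: measurable_fun_pair.
Qed.

Lemma plane_integral_shearX t (G : rT * rT -> \bar R) : measurable_fun [set: rT * rT] G ->
  (forall p, 0 <= G p)%E ->
  plane_integral (fun p => G (p.1 + t * p.2, p.2)) = plane_integral G.
Proof.
move=> mG G0; rewrite /plane_integral.
have mG' : measurable_fun [set: rT * rT] (fun p : rT * rT => G (p.1 + t * p.2, p.2)).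
  apply: measurableT_comp => //; apply: measurable_fun_pair => //.
  by have := measurable_lin2 1 t; under eq_fun do rewrite mul1r.
have G0' (p : rT * rT) : (0 <= G (p.1 + t * p.2, p.2)%R)%E by exact: G0.
refine (etrans (fubini_tonelli (m1 := mu) (m2 := mu) _ mG' G0') _).
refine (etrans _ (esym (fubini_tonelli (m1 := mu) (m2 := mu) G mG G0))).
apply: eq_integral => y _ /=.
apply: (@ge0_integral_shift (t * y) (fun x => G (x, y))) => //.
by apply: measurableT_comp => //; exact: measurable_fun_pair.
Qed.

Lemma measurable_shearX t : measurable_fun [set: rT * rT] (fun p : rT * rT => (p.1 + t * p.2 : rT, p.2)).
Proof.
apply: measurable_fun_pair => //.
by have := measurable_lin2 1 t; under eq_fun do rewrite mul1r.
Qed.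

Lemma measurable_shearY t : measurable_fun [set: rT * rT] (fun p : rT * rT => (p.1, p.2 + t * p.1 : rT)).
Proof.
apply: measurable_fun_pair => //.
by have := measurable_lin2 t 1; under eq_fun do rewrite mul1r addrC.
Qed.

(** A rotation with [s != 0] is a product of three shears with parameters [t], [s], [t]. A shear is
    a translation of one variable with the other held fixed, so no Jacobian enters. *)
Lemma plane_integral_rot c s (G : rT * rT -> \bar R) : s != 0 -> c ^+ 2 + s ^+ 2 = 1 ->
  measurable_fun [set: rT * rT] G -> (forall p, 0 <= G p)%E ->
  plane_integral (fun p => G (c * p.1 - s * p.2, s * p.1 + c * p.2)) = plane_integral G.
Proof.
move=> s0 cs mG G0; pose t := (c - 1) / s.
refine (etrans _ (plane_integral_shearX t mG G0)).
have mX := measurableT_comp mG (measurable_shearX t).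
have mXY := measurableT_comp mX (measurable_shearY s).
refine (etrans _ (plane_integral_shearY s mX (fun=> G0 _))).
refine (etrans _ (plane_integral_shearX t mXY (fun=> G0 _))).
congr plane_integral; apply/funext => -[x y] /=; congr (G (_, _)).
  have -> : c * x - s * y = c * x + (c ^+ 2 - 1) / s * y.
    rewrite -cs; by field.
  by rewrite /t; field.
by rewrite /t; field.
Qed.

Lemma normal_pdf_mul x y : phi x * phi y = normal_peak 1 ^+ 2 * expR (- ((x ^+ 2 + y ^+ 2) / 2)) :> R.
Proof.
rewrite /normal_pdf oner_eq0 /normal_fun mulrACA -expRD -expr2; congr (_ * expR _).
by rewrite !subr0; field.
Qed.

Definition gauss2 (F : rT * rT -> \bar R) : \bar R := (\int[gam]_x \int[gam]_y F (x, y))%E.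

Lemma gauss2E (F : rT * rT -> \bar R) : measurable_fun [set: rT * rT] F ->
  (forall p, 0 <= F p)%E ->
  gauss2 F = plane_integral (fun p => F p * (phi p.1 * phi p.2)%:E)%E.
Proof.
move=> mF F0; rewrite /gauss2 ge0_integral_normal.
- apply: eq_integral => x _; rewrite ge0_integral_normal//; last first.
    by apply: measurableT_comp => //; exact: measurable_fun_pair.
  rewrite -ge0_integralZr//.
  + by apply: eq_integral => y _ /=; rewrite -muleA -EFinM (mulrC (phi y)).
  + apply: emeasurable_funM.
      by apply: measurableT_comp => //; exact: measurable_fun_pair.
    by apply/measurable_EFinP; exact: measurable_normal_pdf.
  + by move=> y _; rewrite mule_ge0 ?lee_fin ?normal_pdf_ge0.
  + by rewrite lee_fin normal_pdf_ge0.
- exact: (measurable_fun_fubini_tonelli_F F).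
- by move=> x; apply: integral_ge0 => y _; exact: F0.
Qed.

Lemma gauss2_rot_neq0 c s (F : rT * rT -> \bar R) : s != 0 -> c ^+ 2 + s ^+ 2 = 1 ->
  measurable_fun [set: rT * rT] F -> (forall p, 0 <= F p)%E ->
  gauss2 (fun p => F (c * p.1 - s * p.2, s * p.1 + c * p.2)) = gauss2 F.
Proof.
move=> s0 cs mF F0.
have mr : measurable_fun [set: rT * rT]
    (fun p : rT * rT => (c * p.1 - s * p.2 : rT, s * p.1 + c * p.2 : rT)).
  apply: measurable_fun_pair; last exact: measurable_lin2.
  by have := measurable_lin2 c (- s); under eq_fun do rewrite mulNr.
have mFr := measurableT_comp mF mr.
rewrite (gauss2E mF F0) (gauss2E mFr); last by move=> p; exact: F0.
have mG : measurable_fun [set: rT * rT] (fun p : rT * rT => F p * (phi p.1 * phi p.2)%:E)%E.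
  apply: emeasurable_funM; first exact: mF.
  apply/measurable_EFinP; apply: measurable_funM.
    by apply: measurableT_comp; [exact: measurable_normal_pdf|exact: measurable_fst].
  by apply: measurableT_comp; [exact: measurable_normal_pdf|exact: measurable_snd].
have G0 p : (0 <= F p * (phi p.1 * phi p.2)%:E)%E.
  by rewrite mule_ge0 ?lee_fin ?mulr_ge0 ?normal_pdf_ge0.
rewrite -(plane_integral_rot s0 cs mG G0).
congr plane_integral; apply/funext => -[x y].
have -> : phi x * phi y = phi (c * x - s * y) * phi (s * x + c * y) => //.
rewrite (normal_pdf_mul x y) (normal_pdf_mul (c * x - s * y) (s * x + c * y)).
suff -> : x ^+ 2 + y ^+ 2 = (c * x - s * y) ^+ 2 + (s * x + c * y) ^+ 2 by [].
by rewrite -[LHS]mul1r -cs; ring.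
Qed.

Lemma gauss2_rot c s (F : rT * rT -> \bar R) : c ^+ 2 + s ^+ 2 = 1 ->
  measurable_fun [set: rT * rT] F -> (forall p, 0 <= F p)%E ->
  gauss2 (fun p => F (c * p.1 - s * p.2, s * p.1 + c * p.2)) = gauss2 F.
Proof.
move=> cs mF F0; have [s0|s0] := eqVneq s 0; last exact: gauss2_rot_neq0.
move: cs; rewrite s0 expr0n /= addr0 => /eqP; rewrite sqrf_eq1 => /orP[] /eqP ->.
  by congr gauss2; apply/funext => -[x y] /=; rewrite !mul0r !mul1r subr0 add0r.
(* For [c = -1] the map is the square of a quarter turn, to which the case [s != 0] applies
   twice. *)
have h1 : (0 : R) ^+ 2 + 1 ^+ 2 = 1 by rewrite expr0n /= add0r expr1n.
have mF' : measurable_fun [set: rT * rT] (fun p : rT * rT => F (0 * p.1 - 1 * p.2, 1 * p.1 + 0 * p.2)).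
  apply: measurableT_comp; first exact: mF.
  apply: measurable_fun_pair; last exact: measurable_lin2.
  by have := measurable_lin2 0 (- 1); under eq_fun do rewrite mulNr.
refine (etrans _ (gauss2_rot_neq0 (oner_neq0 _) h1 mF F0)).
refine (etrans _ (gauss2_rot_neq0 (oner_neq0 _) h1 mF' (fun=> F0 _))).
by congr gauss2; apply/funext => -[x y] /=; congr (F (_, _)); ring.
Qed.

End gaussian_rotation.

(** * Rotation invariance of the Gaussian measure in all dimensions *)

Section gaussian_orthogonal.
Variable R : realType.
Local Notation rT := (measurableTypeR R).
Local Notation gam := (normal_prob (0:R) 1 : probability rT R).

Definition rowt n (t : n.-tuple R) : 'rV[R]_n := \row_i tnth t i.
Definition trow n (v : 'rV[R]_n) : n.-tuple R := [tuple v 0 i | i < n].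
Definition act n (Q : 'M[R]_n) (t : n.-tuple rT) : n.-tuple rT := trow (rowt t *m Q).

Lemma rowtK n : cancel (@rowt n) (@trow n).
Proof. by move=> t; apply: eq_from_tnth => i; rewrite tnth_mktuple mxE. Qed.

Lemma trowK n : cancel (@trow n) (@rowt n).
Proof. by move=> v; apply/rowP => i; rewrite mxE tnth_mktuple. Qed.

Lemma rowt_cons n (x : R) (t : n.-tuple R) : rowt (cons_tuple x t) = row_mx x%:M (rowt t).
Proof.
apply/rowP => k; case: (@split_ordP 1 n k) => j ->.
  by rewrite [RHS](@row_mxEl _ 1 1 n) (ord1 j) !mxE eqxx mulr1n (tnth_nth 0).
by rewrite [RHS](@row_mxEr _ 1 1 n) !mxE !(tnth_nth 0).
Qed.

Lemma act_eqP n (Q : 'M[R]_n) (t t' : n.-tuple R) : rowt t *m Q = rowt t' -> act Q t = t'.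
Proof. by rewrite /act => ->; rewrite rowtK. Qed.

Lemma actM n (P Q : 'M[R]_n) t : act (P *m Q) t = act Q (act P t).
Proof. by apply: act_eqP; rewrite /act !trowK mulmxA. Qed.

Lemma act_block n (H : 'M[R]_n) x (t : n.-tuple R) :
  act (block_mx 1%:M 0 0 H : 'M[R]_(1 + n)) (cons_tuple x t) = cons_tuple x (act H t).
Proof.
apply: act_eqP; rewrite !rowt_cons mul_row_block mulmx1 !mulmx0 addr0 add0r.
by rewrite /act trowK.
Qed.

Lemma act_givens n c s x y (t : n.-tuple R) :
  act (givens n c s) (cons_tuple x (cons_tuple y t)) =
  cons_tuple (c * x - s * y) (cons_tuple (s * x + c * y) t).
Proof.
apply: act_eqP; rewrite !rowt_cons /givens mul_row_block mul_row_col mul_mx_row.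
rewrite mul_row_block !mulmx0 mulmx1 -!scalar_mxM addr0 !add0r add_row_mx add0r addr0.
rewrite -!raddfD /=; congr (row_mx _%:M (row_mx _%:M _)); ring.
Qed.

Lemma measurable_trow d (T : measurableType d) n (v : T -> 'rV[R]_n) :
  (forall j, measurable_fun [set: T] (fun w => v w 0 j : rT)) ->
  measurable_fun [set: T] (fun w => trow (v w) : n.-tuple rT).
Proof.
move=> mv; apply/measurable_fun_tnthP => i.
by have := mv i; congr measurable_fun; apply/funext => w /=; rewrite tnth_mktuple.
Qed.

Lemma measurable_act n (Q : 'M[R]_n) : measurable_fun [set: n.-tuple rT] (act Q).
Proof.
apply: measurable_trow => j.
under eq_fun do rewrite mxE.
apply: measurable_sum => i; apply: measurable_funM => //.
by under eq_fun do rewrite mxE; exact: measurable_tnth.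
Qed.

Lemma measurable_cons_section n (f : n.+1.-tuple rT -> \bar R) (x : rT) :
  measurable_fun [set: n.+1.-tuple rT] f ->
  measurable_fun [set: n.-tuple rT] (fun t : n.-tuple rT => f (cons_tuple x t)).
Proof. by move=> mf; apply: measurableT_comp => //; exact: measurable_cons. Qed.

(** Induction through [orthmx_decomp]: the block factors fix the first coordinate and fall under the
    induction hypothesis, the Givens factor is a planar rotation of the first two coordinates. *)
Theorem integral_gaussn_orth n (Q : 'M[R]_n) (f : n.-tuple rT -> \bar R) : orthmx Q ->
  measurable_fun [set: n.-tuple rT] f -> (forall t, 0 <= f t)%E ->
  (\int[gaussn R n]_t f (act Q t) = \int[gaussn R n]_t f t)%E.
Proof.
elim: n Q f => [|[|n] IH] Q f hQ mf f0.
- by apply: eq_integral => t _; rewrite (tuple0 t) (tuple0 (act _ _)).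
(* In dimension one [Q] is a sign. It is seen as a planar rotation with [s = 0], after adding a
   dummy second coordinate. *)
- have mfQ := measurableT_comp mf (measurable_act Q).
  have fQ0 t : (0 <= (f \o act Q) t)%E by exact: f0.
  rewrite (integral_gaussnS mf f0) (integral_gaussnS mfQ fQ0).
  pose g x := (\int[gaussn R 0]_t f (cons_tuple x t))%E.
  have mg : measurable_fun [set: rT] g.
    apply: (measurable_fun_fubini_tonelli_F (f \o @consT R 0)) => //.
    - by apply: measurableT_comp => //; exact: measurable_consT.
    - by move=> p; exact: f0.
  have g0 x : (0 <= g x)%E by apply: integral_ge0 => t _; exact: f0.
  have gE h : (forall x, 0 <= h x)%E -> (\int[gam]_x h x = gauss2 (fun p => h p.1))%E.
    move=> h0; apply: eq_integral => x _.
    transitivity (\int[gam]_y cst (h x) y)%E => //.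
    by rewrite integral_cst// [X in (_ * X)%E](@probability_setT _ _ _ gam) mule1.
  have q1 : Q 0 0 ^+ 2 + 0 ^+ 2 = 1.
    have := congr1 (fun M : 'M[R]_1 => M 0 0) hQ.
    by rewrite !mxE big_ord1 mxE eqxx mulr1n expr0n /= addr0.
  have gQ0 x : (0 <= \int[gaussn R 0]_t (f \o act Q) (cons_tuple x t))%E by apply: integral_ge0 => t _; exact: f0.
  transitivity (gauss2 (fun p => g p.1)); last by rewrite -(gE g).
  transitivity (gauss2 (fun p => \int[gaussn R 0]_t (f \o act Q) (cons_tuple p.1 t)))%E.
    by rewrite -(gE _ gQ0).
  rewrite -(gauss2_rot q1 (F := fun p => g p.1)).
  - congr gauss2; apply/funext => -[x y] /=; rewrite mul0r subr0 /g.
    apply: eq_integral => t _ /=; congr f; apply: act_eqP.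
    by apply/rowP => k; rewrite (ord1 k) mxE big_ord1 !mxE !(tnth_nth 0) /= mulrC.
  - exact: measurableT_comp.
  - by move=> p; exact: g0.
have [H1 [H2 [c [s [h1 h2 cs QE]]]]] := orthmx_decomp hQ.
have key H : orthmx H -> forall f : n.+2.-tuple rT -> \bar R,
    measurable_fun [set: n.+2.-tuple rT] f -> (forall t, 0 <= f t)%E ->
    (\int[gaussn R n.+2]_t f (act (block_mx 1%:M 0 0 H : 'M[R]_(1 + n.+1)) t)
     = \int[gaussn R n.+2]_t f t)%E.
  move=> hH {}f {}mf {}f0.
  have mfB := measurableT_comp mf (measurable_act (block_mx 1%:M 0 0 H : 'M[R]_(1 + n.+1))).
  rewrite (integral_gaussnS mf f0) (integral_gaussnS mfB); last by move=> t; exact: f0.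
  apply: eq_integral => x _ /=; under eq_integral do rewrite act_block.
  apply: (IH H (fun t => f (cons_tuple x t)) hH) => //.
  exact: measurable_cons_section.
transitivity (\int[gaussn R n.+2]_t (f \o act (block_mx 1%:M 0 0 H2 : 'M[R]_(1 + n.+1)))
  (act (givens n c s) t))%E.
  have mfB := measurableT_comp mf (measurable_act (block_mx 1%:M 0 0 H2 : 'M[R]_(1 + n.+1))).
  have mfG := measurableT_comp mfB (measurable_act (givens n c s)).
  rewrite -(key _ h1 _ mfG) => [|t]; last exact: f0.
  apply: eq_integral => t _ /=.
  by rewrite QE !actM.
have mfB := measurableT_comp mf (measurable_act (block_mx 1%:M 0 0 H2 : 'M[R]_(1 + n.+1))).
rewrite -(key _ h2 _ mf f0) => {key}.
suff keyG (g : n.+2.-tuple rT -> \bar R) : measurable_fun [set: n.+2.-tuple rT] g ->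
    (forall t, 0 <= g t)%E ->
    (\int[gaussn R n.+2]_t g (act (givens n c s) t) = \int[gaussn R n.+2]_t g t)%E.
  by apply: (keyG _ mfB) => t; exact: f0.
move=> mg g0.
have mgG := measurableT_comp mg (measurable_act (givens n c s)).
have gSS h : measurable_fun [set: n.+2.-tuple rT] h -> (forall t, 0 <= h t)%E ->
    (\int[gaussn R n.+2]_t h t = gauss2 (fun p => \int[gaussn R n]_t h (cons_tuple p.1 (cons_tuple p.2 t))))%E.
  move=> mh h0; rewrite (integral_gaussnS mh h0); apply: eq_integral => x _.
  by rewrite (integral_gaussnS (measurable_cons_section x mh)).
apply: etrans (gSS (g \o act (givens n c s)) mgG (fun t => g0 _)) _.
refine (etrans _ (esym (gSS g mg g0))).
pose F (p : rT * rT) := (\int[gaussn R n]_t g (cons_tuple p.1 (cons_tuple p.2 t)))%E.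
have mF : measurable_fun [set: rT * rT] F.
  apply: (measurable_fun_fubini_tonelli_F
    (fun q : (rT * rT) * n.-tuple rT => g (cons_tuple q.1.1 (cons_tuple q.1.2 q.2)))) => //.
  apply: measurableT_comp => //; apply: measurable_cons; first exact: measurableT_comp.
  by apply: measurable_cons; first exact: measurableT_comp.
have F0 p : (0 <= F p)%E by apply: integral_ge0 => t _; exact: g0.
refine (etrans _ (gauss2_rot cs mF F0)).
congr gauss2; apply/funext => -[x y] /=.
by apply: eq_integral => t _; rewrite act_givens.
Qed.

End gaussian_orthogonal.

(** * Gram-Schmidt orthonormalization *)

Section gram_schmidt.
Variable R : realType.
Local Notation rT := (measurableTypeR R).
Variable n : nat.

Definition cdot (u v : 'cV[R]_n) : R := (u^T *m v) 0 0.

Lemma cdotE u v : cdot u v = \sum_i u i 0 * v i 0.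
Proof. by rewrite /cdot mxE; apply: eq_bigr => i _; rewrite mxE. Qed.

Lemma cdotC u v : cdot u v = cdot v u.
Proof. by rewrite !cdotE; apply: eq_bigr => i _; rewrite mulrC. Qed.

Lemma cdotZr a u v : cdot u (a *: v) = a * cdot u v.
Proof. by rewrite /cdot -scalemxAr mxE. Qed.

Lemma cdotZl a u v : cdot (a *: u) v = a * cdot u v.
Proof. by rewrite cdotC cdotZr cdotC. Qed.

Lemma cdotBr u v w : cdot u (v - w) = cdot u v - cdot u w.
Proof.
have subE (A B : 'M[R]_1) : (A - B) 0 0 = A 0 0 - B 0 0 by rewrite 2!mxE.
by rewrite /cdot mulmxBr subE.
Qed.

Lemma cdot_sumr u k (c : 'I_k -> R) (v : 'I_k -> 'cV_n) :
  cdot u (\sum_i c i *: v i) = \sum_i c i * cdot u (v i).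
Proof.
rewrite /cdot mulmx_sumr summxE; apply: eq_bigr => i _.
by rewrite -scalemxAr mxE.
Qed.

Lemma cdot_orth (Q : 'M[R]_n) u v : orthmx Q -> cdot (Q *m u) (Q *m v) = cdot u v.
Proof.
move=> hQ; rewrite /cdot trmx_mul -mulmxA (mulmxA Q^T).
by have := orthmx_tr hQ; rewrite /orthmx trmxK => ->; rewrite mul1mx.
Qed.

Lemma cdot_gt0 u : u != 0 -> 0 < cdot u u.
Proof.
move=> u0; rewrite lt_neqAle; apply/andP; split; last first.
  by rewrite cdotE; apply: sumr_ge0 => i _; rewrite -expr2 sqr_ge0.
apply: contra u0 => /eqP e; apply/eqP; apply: trmx_inj; rewrite trmx0.
by apply: row_mulmxT_eq0; rewrite trmxK -/(cdot u u) -e.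
Qed.

(** The real power is total and measurable, so the process is a measurable function of every matrix,
    degenerate ones included; a zero vector is sent to zero. *)
Definition normalize (w : 'cV[R]_n) := (cdot w w `^ (- 2^-1)) *: w.

Definition residual (zk : 'cV[R]_n) (s : seq 'cV[R]_n) := zk - \sum_(o <- s) cdot zk o *: o.

Fixpoint gs_seq (z : nat -> 'cV[R]_n) k : seq 'cV[R]_n :=
  if k is k'.+1 then rcons (gs_seq z k') (normalize (residual (z k') (gs_seq z k'))) else [::].

Definition gs z k := normalize (residual (z k) (gs_seq z k)).

Lemma gs_seqE z k : gs_seq z k = mkseq (gs z) k.
Proof. by elim: k => //= k IH; rewrite mkseqS -IH. Qed.

Definition gs_res z k := z k - \sum_(j < k) cdot (z k) (gs z j) *: gs z j.

Lemma gsE z k : gs z k = normalize (gs_res z k).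
Proof.
rewrite /gs /residual /gs_res gs_seqE big_map.
by rewrite -[in X in iota 0 X](subn0 k) -/(index_iota 0 k) big_mkord.
Qed.

Lemma normalize_orth (Q : 'M[R]_n) w : orthmx Q -> normalize (Q *m w) = Q *m normalize w.
Proof. by move=> hQ; rewrite /normalize cdot_orth// scalemxAr. Qed.

Lemma gs_orth (Q : 'M[R]_n) z k : orthmx Q -> gs (fun j => Q *m z j) k = Q *m gs z k.
Proof.
move=> hQ; elim/ltn_ind: k => k IH.
rewrite !gsE -normalize_orth// /gs_res mulmxBr; congr normalize; congr (_ - _).
rewrite mulmx_sumr; apply: eq_bigr => j _.
by rewrite IH// cdot_orth// scalemxAr.
Qed.

Lemma normalizeK w : w = Num.sqrt (cdot w w) *: normalize w.
Proof.
have [->|w0] := eqVneq w 0; first by rewrite /normalize !scaler0.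
have d0 := cdot_gt0 w0.
rewrite /normalize scalerA powRN powR12_sqrt ?ltW// divff ?scale1r//.
by rewrite sqrtr_eq0 -ltNge.
Qed.

Lemma cdot_normalize w : w != 0 -> cdot (normalize w) (normalize w) = 1.
Proof.
move=> w0; have d0 := cdot_gt0 w0.
rewrite /normalize cdotZl cdotZr mulrA -expr2 powRN powR12_sqrt ?ltW// exprVn.
by rewrite sqr_sqrtr ?ltW// mulVf// gt_eqF.
Qed.

Lemma gs_orthonormal z m : (forall k, (k < m)%N -> gs_res z k != 0) ->
  forall i j, (i < m)%N -> (j < m)%N -> cdot (gs z i) (gs z j) = (i == j)%:R.
Proof.
move=> z0.
have lt k : (k < m)%N -> forall i, (i < k)%N -> cdot (gs z i) (gs z k) = 0.
  elim/ltn_ind: k => k IH km i ik.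
  rewrite (gsE z k) /normalize cdotZr.
  suff -> : cdot (gs z i) (gs_res z k) = 0 by rewrite mulr0.
  rewrite /gs_res cdotBr cdot_sumr.
  have gii : cdot (gs z i) (gs z i) = 1 by rewrite gsE cdot_normalize// z0// (ltn_trans ik).
  rewrite (bigD1 (Ordinal ik))//= big1 => [|j ji].
    by rewrite addr0 gii mulr1 cdotC subrr.
  have {}ji : i != j :> nat by rewrite eq_sym; exact: ji.
  have jk := ltn_ord j; case: (ltngtP i j) ji => // ij _.
    by rewrite (IH _ jk (ltn_trans jk km) _ ij) mulr0.
  by rewrite [X in _ * X]cdotC (IH _ ik (ltn_trans ik km) _ ij) mulr0.
move=> i j im jm; case: ltngtP => ij.
- by rewrite lt.
- by rewrite cdotC lt.
- by rewrite ij gsE cdot_normalize// z0.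
Qed.

Definition colseq (Z : 'M[R]_n) (k : nat) : 'cV[R]_n := if insub k is Some j then col j Z else 0.

Definition gs_mx (Z : 'M[R]_n) : 'M[R]_n := \matrix_(i, j) gs (colseq Z) j i 0.

Lemma colseqM (Q Z : 'M[R]_n) : colseq (Q *m Z) = fun k => Q *m colseq Z k.
Proof.
apply/funext => k; rewrite /colseq; case: insubP => [j _ _|_]; last by rewrite mulmx0.
by rewrite !colE mulmxA.
Qed.

(** The process uses only inner products and linear combinations. Applied to a Gaussian matrix,
    whose law is rotation invariant, it therefore produces a left invariant random orthogonal
    matrix. *)
Lemma gs_mxM (Q Z : 'M[R]_n) : orthmx Q -> gs_mx (Q *m Z) = Q *m gs_mx Z.
Proof.
move=> hQ; apply/matrixP => i j; rewrite [RHS]mxE [LHS]mxE colseqM gs_orth// [LHS]mxE.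
by apply: eq_bigr => k _; congr (_ * _); rewrite [RHS]mxE.
Qed.

(** QR factorization, the rows of [L] holding the coefficients of the columns of [Z]. The
    factorization itself is established first, for zero residuals as well; orthonormality is then
    deduced from the invertibility of [Z]. *)
Lemma gs_mxP (Z : 'M[R]_n) : Z \in unitmx ->
  orthmx (gs_mx Z) /\ exists2 L : 'M[R]_n, is_trig_mx L & Z = gs_mx Z *m L^T.
Proof.
move=> uZ; set z := colseq Z.
pose L : 'M[R]_n := \matrix_(k, j) if (j < k)%N then cdot (z k) (gs z j) else
  if j == k then Num.sqrt (cdot (gs_res z k) (gs_res z k)) else 0.
have zE (k l : 'I_n) : z k l 0 = Z l k by rewrite /z /colseq valK mxE.
have ZE : Z = gs_mx Z *m L^T.
  apply/matrixP => l k; rewrite -zE [RHS]mxE.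
  pose r := Num.sqrt (cdot (gs_res z k) (gs_res z k)).
  pose F (j : nat) := if (j < k)%N then cdot (z k) (gs z j) * gs z j l 0 else
    if j == k then r * gs z k l 0 else 0.
  transitivity (\sum_(0 <= j < n) F j); last first.
    rewrite big_mkord; apply: eq_bigr => j _.
    rewrite [gs_mx _ _ _]mxE [L^T _ _]mxE [L _ _]mxE /F [RHS]mulrC -/r.
    case: ifP => // _; rewrite -[j == k]val_eqE /=; case: ifP => [/eqP jk|]; last by rewrite mul0r.
    by rewrite [in RHS](val_inj jk).
  rewrite (big_cat_nat (n := k)) ?(ltnW (ltn_ord k))//= (big_ltn (ltn_ord k)).
  rewrite [X in _ + (_ + X)]big_nat_cond [X in _ + (_ + X)]big1 => [|j /andP[/andP[kj _] _]]; last first.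
    by rewrite /F ltnNge (ltnW kj) /= gtn_eqF.
  rewrite addr0 big_mkord /F ltnn eqxx.
  have -> : \sum_(j < k) (if (j < k)%N then cdot (z k) (gs z j) * gs z j l 0 else
    if j == k :> nat then r * gs z k l 0 else 0) = (\sum_(j < k) cdot (z k) (gs z j) *: gs z j) l 0.
    by rewrite summxE; apply: eq_bigr => j _; rewrite ltn_ord [RHS]mxE.
  have -> : r * gs z k l 0 = gs_res z k l 0.
    by rewrite [in RHS](normalizeK (gs_res z k)) -gsE [RHS]mxE.
  rewrite /gs_res; set S := \sum_(j < k) _.
  have addE (A B : 'cV[R]_n) : (A + B) l 0 = A l 0 + B l 0 by rewrite mxE.
  by rewrite -addE addrC subrK.
have tL : is_trig_mx L.
  apply/is_trig_mxP => i j ij; rewrite mxE ltnNge (ltnW ij)/=.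
  by rewrite (_ : (j == i) = false)//; apply/negbTE; rewrite neq_ltn ij orbT.
(* A zero residual would be a zero on the diagonal of the triangular matrix [L]. *)
have z0 k : (k < n)%N -> gs_res z k != 0.
  move=> kn; apply/eqP => e; move: uZ.
  rewrite ZE unitmx_mul unitmx_tr => /andP[_]; rewrite unitmxE det_trig//.
  rewrite (bigD1 (Ordinal kn))//= mxE ltnn eqxx /= e /cdot mulmx0 mxE sqrtr0 mul0r.
  by rewrite unitr0.
split; last by exists L.
apply: mulmx1C; apply/matrixP => i j; rewrite [RHS]mxE.
transitivity (cdot (gs z i) (gs z j)); last by rewrite (gs_orthonormal z0).
rewrite [LHS]mxE cdotE; apply: eq_bigr => l _.
by rewrite [_^T _ _]mxE; congr (_ * _); rewrite [LHS]mxE.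
Qed.

Lemma measurable_cdot d (T : measurableType d) (u v : T -> 'cV[R]_n) :
  (forall l, measurable_fun [set: T] (fun w => u w l 0 : rT)) ->
  (forall l, measurable_fun [set: T] (fun w => v w l 0 : rT)) ->
  measurable_fun [set: T] (fun w => cdot (u w) (v w) : rT).
Proof.
move=> mu mv; under eq_fun do rewrite cdotE.
by apply: measurable_sum => i; apply: measurable_funM; [exact: mu|exact: mv].
Qed.

Lemma measurable_gs d (T : measurableType d) (z : T -> nat -> 'cV[R]_n) :
  (forall k l, measurable_fun [set: T] (fun w => z w k l 0 : rT)) ->
  forall k l, measurable_fun [set: T] (fun w => gs (z w) k l 0 : rT).
Proof.
move=> mz k; elim/ltn_ind: k => k IH l.
have mres l' : measurable_fun [set: T] (fun w => gs_res (z w) k l' 0 : rT).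
  have -> : (fun w => gs_res (z w) k l' 0 : rT) =
      (fun w => z w k l' 0 - \sum_(j < k) cdot (z w k) (gs (z w) j) * gs (z w) j l' 0).
    apply/funext => w; rewrite /gs_res [LHS]mxE; congr (_ + _).
    by rewrite [LHS]mxE summxE; congr (- _); apply: eq_bigr => j _; rewrite [LHS]mxE.
  apply: measurable_funB; first exact: mz.
  apply: measurable_sum => j; apply: measurable_funM; last exact: IH.
  by apply: measurable_cdot => l''; [exact: mz|exact: IH].
have -> : (fun w => gs (z w) k l 0 : rT) =
    (fun w => cdot (gs_res (z w) k) (gs_res (z w) k) `^ (- 2^-1) * gs_res (z w) k l 0).
  by apply/funext => w; rewrite gsE [LHS]mxE.
apply: measurable_funM; last exact: mres.
apply: (measurableT_comp (measurable_powR _)).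
by apply: measurable_cdot => l'; exact: mres.
Qed.

Lemma measurable_gs_mx d (T : measurableType d) (Z : T -> 'M[R]_n) :
  (forall i j, measurable_fun [set: T] (fun w => Z w i j : rT)) ->
  forall i j, measurable_fun [set: T] (fun w => gs_mx (Z w) i j : rT).
Proof.
move=> mZ i j; under eq_fun do rewrite mxE.
apply: measurable_gs => k l; rewrite /colseq; case: insubP => [j' _ _|_].
  by under eq_fun do rewrite mxE; exact: mZ.
by under eq_fun do rewrite mxE; exact: measurable_cst.
Qed.

(** Gram-Schmidt on the rows of [row_ebase K], the first [\rank K] of which span the row space of
    [K]. Since [L] is triangular, these rows and the corresponding rows of the orthogonal factor
    have the same span. *)
Lemma rowspace_orth (K : 'M[R]_n) :
  exists2 Q : 'M[R]_n, orthmx Q & (K == (pid_mx (\rank K) : 'M[R]_n) *m Q)%MS.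
Proof.
have uW := row_ebase_unit K; set W := row_ebase K in uW.
have uWT : W^T \in unitmx by rewrite unitmx_tr.
have [hO [L tL WE]] := gs_mxP uWT; set O := gs_mx W^T in hO WE.
exists O^T; first exact: orthmx_tr.
have WE' : W = L *m O^T by rewrite -[W]trmxK WE trmx_mul trmxK.
have uO : O^T \in unitmx by have [] := mulmx1_unit (orthmx_tr hO).
have uL : L \in unitmx by move: uW; rewrite WE' unitmx_mul => /andP[].
have rn := rank_leq_row K.
have pL : (pid_mx (\rank K) : 'M[R]_n) *m L = (pid_mx (\rank K) *m L) *m (pid_mx (\rank K) : 'M[R]_n).
  apply/matrixP => i j; rewrite [RHS]mxE (bigD1 j)//= [X in _ = _ + X]big1 => [|k kj]; last first.
    by rewrite [pid_mx _ k j]mxE (_ : (k == j :> nat) = false) ?mulr0//; exact: negbTE.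
  rewrite addr0 [pid_mx _ j j]mxE eqxx /=.
  case: ltnP => jr; first by rewrite mulr1.
  rewrite mulr0 mxE big1// => k _; rewrite mxE.
  case: eqP => [ik|]; last by rewrite mul0r.
  case: ltnP => ir; last by rewrite mul0r.
  rewrite (is_trig_mxP tL) ?mulr0// -ik; exact: leq_trans ir jr.
have KE : (K :=: (pid_mx (\rank K) : 'M[R]_n) *m W)%MS.
  have full : row_full (col_ebase K) by rewrite row_full_unit col_ebase_unit.
  have E : col_ebase K *m pid_mx (\rank K) *m W = K := mulmx_ebase K.
  have := eqmxMfull (pid_mx (\rank K) *m W) full.
  by rewrite mulmxA E.
have pLe : ((pid_mx (\rank K) : 'M[R]_n) *m L == (pid_mx (\rank K) : 'M[R]_n))%MS.
  have sub : ((pid_mx (\rank K) : 'M[R]_n) *m L <= (pid_mx (\rank K) : 'M[R]_n))%MS by rewrite pL submxMl.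
  by rewrite -(mxrank_leqif_eq sub).2 mxrankMfree// row_free_unit.
apply/eqmxP; apply: (eqmx_trans KE); rewrite WE' mulmxA.
exact/eqmxMr/eqmxP.
Qed.

End gram_schmidt.

(** * Random five-dimensional subspaces *)

Section measurable_projection.
Variable R : realType.
Local Notation rT := (measurableTypeR R).

Definition sqdist p q (A B : 'M[R]_(p, q)) : R := \sum_i \sum_j (A i j - B i j) ^+ 2.

Lemma sqdist_ge0 p q (A B : 'M[R]_(p, q)) : 0 <= sqdist A B.
Proof. by apply: sumr_ge0 => i _; apply: sumr_ge0 => j _; exact: sqr_ge0. Qed.

Lemma sqdist_eq0 p q (A B : 'M[R]_(p, q)) : sqdist A B = 0 -> A = B.
Proof.
move=> /eqP; rewrite psumr_eq0 => [/allP H|i _]; last by apply: sumr_ge0 => j _; exact: sqr_ge0.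
apply/matrixP => i j; move: (H i (mem_index_enum i)).
rewrite /= psumr_eq0 => [/allP H'|k _]; last exact: sqr_ge0.
by move: (H' j (mem_index_enum j)); rewrite /= sqrf_eq0 subr_eq0 => /eqP.
Qed.

Lemma sqdistxx p q (A : 'M[R]_(p, q)) : sqdist A A = 0.
Proof. by rewrite /sqdist big1// => i _; rewrite big1// => j _; rewrite subrr expr0n. Qed.

Lemma continuous_sum_ord (T : topologicalType) k (F : 'I_k -> T -> R) :
  (forall i, continuous (F i)) -> continuous (fun x => \sum_i F i x).
Proof. by move=> cF; apply: continuous_big => //; exact: add_continuous. Qed.

(* The image of a continuous map on R^N is sigma-compact; approximating the
   parameter by rational points inside a box turns the projection into a
   countable combination of measurable sets. *)
Lemma measurable_image_preimage d (T : measurableType d) N p q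
    (G : 'rV[R]_N -> 'M[R]_(p, q)) (U : T -> 'M[R]_(p, q)) :
  (forall i j, continuous (fun c => G c i j)) ->
  (forall i j, measurable_fun [set: T] (fun w => U w i j : rT)) ->
  measurable [set w | exists c, G c = U w].
Proof.
move=> cG mU.
pose rv (x : 'rV[rat]_N) : 'rV[R]_N := \row_i ratr (x 0 i).
pose box (M : nat) (c : 'rV[R]_N) := forall i, `|c 0 i| <= M%:R.
pose E (M m k : nat) : set T := if unpickle k is Some x then
  (if `[< box M (rv x) >] then [set w | sqdist (G (rv x)) (U w) < m.+1%:R^-1] else set0) else set0.
have cf w : continuous (fun c => sqdist (G c) (U w)).
  apply: continuous_sum_ord => i; apply: continuous_sum_ord => j.
  move=> c; apply: (@continuous_comp _ _ _ (fun c => G c i j - U w i j) (fun x : R => x ^+ 2)).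
    by apply: continuousB; [exact: cG|exact: cst_continuous].
  exact: exprn_continuous.
rewrite (_ : [set w | _] = \bigcup_M \bigcap_m \bigcup_k E M m k).
  apply: bigcup_measurable => M _; apply: bigcapT_measurable => m.
  apply: bigcup_measurable => k _; rewrite /E.
  case: unpickle => [x|]; last exact: measurable0.
  case: asboolP => _; last exact: measurable0.
  have mh : measurable_fun [set: T] (fun w => sqdist (G (rv x)) (U w) : rT).
    apply: measurable_sum => i; apply: measurable_sum => j.
    by apply: measurable_funX; apply: measurable_funB; [exact: measurable_cst|exact: mU].
  have := mh measurableT _ (@measurable_itv R `]-oo, (m.+1%:R^-1)[%R); rewrite setTI; congr measurable.
apply/seteqP; split => w /=.
  move=> [c Gc].
  (* The margin 1 keeps in the box the rational points at distance less than [e1 <= 1] from [c]. *)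
  have [M HM] : exists M : nat, forall i, `|c 0 i| + 1 <= M%:R.
    exists (Num.Def.archi_bound (\sum_i `|c 0 i| + 1)) => i.
    apply/ltW; apply: le_lt_trans (archi_boundP _); last by rewrite addr_ge0// sumr_ge0.
    by rewrite lerD2r (bigD1 i)//= lerDl sumr_ge0.
  exists M => // m _.
  have : nbhs c [set c' | sqdist (G c') (U w) < m.+1%:R^-1].
    have := cf w c; rewrite /continuous_at Gc sqdistxx => /cvgrPdist_lt /(_ m.+1%:R^-1).
    rewrite invr_gt0 ltr0Sn => /(_ isT); apply: filterS => c' /=.
    by rewrite sub0r normrN ger0_norm// sqdist_ge0.
  move=> /nbhs_ballP[e /= e0 He].
  pose e1 := Num.min e 1.
  have e10 : 0 < e1 by rewrite lt_min e0 ltr01.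
  have Hx i : exists x : rat, `|c 0 i - ratr x| < e1.
    have lt : c 0 i - e1 < c 0 i + e1 by lra.
    have [x] := rat_in_itvoo lt.
    by rewrite in_itv /= => /andP[? ?]; exists x; rewrite ltr_norml; apply/andP; split; lra.
  have [x {}Hx] : exists x : 'rV[rat]_N, forall i, `|c 0 i - ratr (x 0 i)| < e1.
    by exists (\row_i sval (cid (Hx i))) => i; rewrite mxE; case: cid.
  exists (pickle x) => //; rewrite /E pickleK.
  case: asboolP => [_|]; last first.
    case=> i; rewrite mxE; apply: le_trans (HM i).
    have := Hx i; rewrite lt_min => /andP[_ h1].
    rewrite -[ratr _](subKr (c 0 i)); apply: le_trans (ler_normB _ _) _.
    by rewrite lerD2l ltW.
  apply: He; split => // i j; rewrite (ord1 i) mxE /ball /=.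
  by have := Hx j; rewrite lt_min => /andP[].
(* On the compact box the distance attains its minimum, and the rational points of the box force
   this minimum below every [m.+1%:R^-1]. *)
move=> [M _ HM].
pose K := [set c : 'rV[R]_N | forall i, `[- M%:R, M%:R]%classic (c ord0 i)].
have cK : compact K.
  apply: (@rV_compact _ _ (fun=> `[(- M%:R : R), M%:R]%classic)).
  by move=> _; exact: segment_compact.
have K0 : K !=set0 by exists 0 => i; rewrite mxE /= in_itv /= oppr_le0 ler0n.
have cfK : {within K, continuous (fun c => sqdist (G c) (U w))}.
  exact/continuous_subspaceT/cf.
have [c cK' minc] := EVT_min_rV K0 cK cfK.
exists c; apply: sqdist_eq0; apply/eqP; rewrite eq_le sqdist_ge0 andbT leNgt; apply/negP => c0.
have [m Hm] : exists m : nat, m.+1%:R^-1 < sqdist (G c) (U w).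
  exists (Num.Def.archi_bound (sqdist (G c) (U w))^-1).
  rewrite invf_plt ?posrE//; apply: lt_trans (archi_boundP _) _; first by rewrite invr_ge0 ltW.
  by rewrite ltr_nat.
have [k _] := HM m I; rewrite /E; case: unpickle => // x.
case: asboolP => // bx /= lt.
have : sqdist (G c) (U w) <= sqdist (G (rv x)) (U w).
  by apply: minc; rewrite inE => i; rewrite /= in_itv /= -ler_norml; exact: bx.
by move=> /le_lt_trans /(_ lt) /(lt_trans Hm); rewrite ltxx.
Qed.

End measurable_projection.

Definition rank1 (F : fieldType) (a b : 'rV[F]_3) : 'rV[F]_(3 * 3) := mxvec (a^T *m b).

(** * Averaging over random rotations *)

Section haar_average.
Variable R : realType.
Local Notation rT := (measurableTypeR R).

Lemma gaussn_gen_null n (A : set (n.-tuple rT)) : measurable A ->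
  gen (fun t => ~ A t) -> gaussn R n A = 0%E.
Proof.
move=> mA gA; rewrite -gauss_tuple_probE//.
rewrite (@gauss_tuple_prob_gen _ n A set0)//; last first.
  by apply: gen_imply gA => t nA; split.
by rewrite gauss_tuple_probE// measure0.
Qed.

Section coordinates.
Variables (I : finType) (p n : nat) (g : I -> 'I_p * 'I_n) (h : 'I_p * 'I_n -> I).
Hypotheses (gK : cancel g h) (hK : cancel h g).

(** One layout serves the slices of the tensor ([p = 5]), the four matrices ([p = 4]) and the square
    Gaussian matrix ([p = 9]). *)
Definition coord_mx (t : #|I|.-tuple R) : 'M[R]_(p, n) :=
  \matrix_(l, c) tnth t (enum_rank (h (l, c))).

(** On the flattened tuple, right multiplication by [Q] acts as the Kronecker product of an identity
    matrix with [Q], up to reindexing. *)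
Lemma coord_mx_orth (Q : 'M[R]_n) : orthmx Q ->
  exists2 Q' : 'M[R]_#|I|, orthmx Q' & forall t, coord_mx (act Q' t) = coord_mx t *m Q.
Proof.
move=> hQ; pose q (j i : I) := ((g j).1 == (g i).1)%:R * Q (g j).2 (g i).2.
have hb : bijective h by exists g.
exists (\matrix_(a, b) q (enum_val a) (enum_val b)).
  apply/matrixP => a b; rewrite !mxE.
  transitivity (\sum_i q (enum_val a) i * q (enum_val b) i).
    rewrite (reindex _ (onW_bij _ (enum_val_bij I))).
    by apply: eq_bigr => i _; rewrite !mxE.
  rewrite (reindex h (onW_bij _ hb)).
  transitivity (\sum_l \sum_c q (enum_val a) (h (l, c)) * q (enum_val b) (h (l, c))).
    by rewrite pair_bigA; apply: eq_bigr => -[].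
  rewrite /q; under eq_bigr do under eq_bigr do rewrite hK /=.
  set la := (g (enum_val a)).1; set ca := (g (enum_val a)).2.
  set lb := (g (enum_val b)).1; set cb := (g (enum_val b)).2.
  transitivity ((la == lb)%:R * (Q *m Q^T) ca cb).
    rewrite (bigD1 la)//= [X in _ + X]big1 => [|l ll]; last first.
      by rewrite big1// => c _; rewrite eq_sym (negbTE ll) !mul0r.
    rewrite addr0 mxE mulr_sumr; apply: eq_bigr => c _.
    by rewrite eqxx mul1r mxE (eq_sym lb) mulrCA.
  rewrite hQ mxE -natrM mulnb; congr (_%:R); congr (nat_of_bool _).
  apply/andP/eqP => [[/eqP e1 /eqP e2]|ab]; last by rewrite /la /ca /lb /cb ab.
  apply: enum_val_inj; apply: (can_inj gK).
  by rewrite [LHS]surjective_pairing [RHS]surjective_pairing -/la -/ca e1 e2.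
move=> t; apply/matrixP => l c; rewrite !mxE tnth_mktuple !mxE.
rewrite (reindex (@enum_rank I)); last exact: onW_bij (enum_rank_bij I).
rewrite (reindex h (onW_bij _ hb)).
transitivity (\sum_l' \sum_c' tnth t (enum_rank (h (l', c'))) * ((l' == l)%:R * Q c' c)).
  rewrite pair_bigA; apply: eq_bigr => -[l' c'] _ /=.
  by rewrite !mxE /q !enum_rankK !hK.
rewrite (bigD1 l)//= [X in _ + X]big1 => [|l' ll]; last first.
  by rewrite big1// => c' _; rewrite (negbTE ll) mul0r mulr0.
by rewrite addr0; apply: eq_bigr => c' _; rewrite eqxx mul1r mxE.
Qed.

Lemma measurable_coord_mx i j : measurable_fun [set: #|I|.-tuple rT] (fun t => coord_mx t i j : rT).
Proof. by under eq_fun do rewrite mxE; exact: measurable_tnth. Qed.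

End coordinates.

Lemma measurable_mulmx d (T : measurableType d) m n p (A : T -> 'M[R]_(m, n)) (B : T -> 'M[R]_(n, p)) :
  (forall i j, measurable_fun [set: T] (fun w => A w i j : rT)) ->
  (forall i j, measurable_fun [set: T] (fun w => B w i j : rT)) ->
  forall i j, measurable_fun [set: T] (fun w => (A w *m B w) i j : rT).
Proof.
move=> mA mB i j; under eq_fun do rewrite mxE.
by apply: measurable_sum => k; apply: measurable_funM; [exact: mA|exact: mB].
Qed.

Lemma measurable_trmx d (T : measurableType d) m n (A : T -> 'M[R]_(m, n)) :
  (forall i j, measurable_fun [set: T] (fun w => A w i j : rT)) ->
  forall i j, measurable_fun [set: T] (fun w => (A w)^T i j : rT).
Proof. by move=> mA i j; under eq_fun do rewrite mxE; exact: mA. Qed.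

Lemma measurable_det d (T : measurableType d) n (A : T -> 'M[R]_n) :
  (forall i j, measurable_fun [set: T] (fun w => A w i j : rT)) ->
  measurable_fun [set: T] (fun w => \det (A w) : rT).
Proof.
move=> mA; apply: measurable_sum => s; apply: measurable_funM; first exact: measurable_cst.
by apply: measurable_prod => i _; exact: mA.
Qed.

Lemma measurable_neq0 d (T : measurableType d) (f : T -> R) :
  measurable_fun [set: T] (f : T -> rT) -> measurable [set w | f w = 0].
Proof.
move=> mf; have := mf measurableT _ (@measurable_set1 R 0).
by rewrite setTI.
Qed.

(** An inclusion of row spaces is monotone in [U] and depends only on its row space; when [U] has
    rank 5 it is an equality by dimension. *)
Definition covered5 m (U : 'M[R]_(m, 3 * 3)) : Prop :=
  exists a b : 'I_5 -> 'rV[R]_3, (U <= \matrix_(k < 5) rank1 (a k) (b k))%MS.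

Lemma covered5S m1 m2 (U : 'M[R]_(m1, 3 * 3)) (V : 'M[R]_(m2, 3 * 3)) :
  (U <= V)%MS -> covered5 V -> covered5 U.
Proof. by move=> UV [a [b Vab]]; exists a, b; exact: submx_trans Vab. Qed.

Lemma covered5_eqmx m1 m2 (U : 'M[R]_(m1, 3 * 3)) (V : 'M[R]_(m2, 3 * 3)) :
  (U :=: V)%MS -> covered5 U <-> covered5 V.
Proof. by move=> UV; split; apply: covered5S; rewrite UV. Qed.

(** The condition says that [U] is a value of the polynomial map [G] in the coefficients of a
    combination and the coordinates of the [a k] and [b k]. *)
Lemma measurable_covered5 d (T : measurableType d) m (U : T -> 'M[R]_(m, 3 * 3)) :
  (forall i j, measurable_fun [set: T] (fun w => U w i j : rT)) ->
  measurable [set w | covered5 (U w)].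
Proof.
move=> mU.
pose J := (('I_m * 'I_5) + ('I_5 * 'I_3) + ('I_5 * 'I_3))%type.
pose x (c : 'rV[R]_#|{: J}|) (j : J) := c 0 (enum_rank j).
pose va c k : 'rV[R]_3 := \row_i x c (inl (inr (k, i))).
pose vb c k : 'rV[R]_3 := \row_i x c (inr (k, i)).
pose G c : 'M[R]_(m, 3 * 3) := (\matrix_(i, k) x c (inl (inl (i, k)))) *m \matrix_(k < 5) rank1 (va c k) (vb c k).
rewrite (_ : [set w | _] = [set w | exists c, G c = U w]).
  apply: measurable_image_preimage => // i j.
  case/mxvec_indexP: j => j1 j2.
  have -> : (fun c => G c i (mxvec_index j1 j2)) = (fun c => \sum_(k < 5) x c (inl (inl (i, k))) * (x c (inl (inr (k, j1))) * x c (inr (k, j2)))).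
    apply/funext => c; rewrite mxE; apply: eq_bigr => k _.
    by rewrite !mxE mxvecE mxE big_ord1 !mxE.
  have cx j : continuous (fun c => x c j) by exact: coord_continuous.
  apply: continuous_sum_ord => k c.
  apply: (@continuousM _ _ (fun c => x c _) (fun c => x c _ * x c _)); first exact: cx.
  by apply: (@continuousM _ _ (fun c => x c _) (fun c => x c _)); exact: cx.
apply/seteqP; split => w /=.
  move=> [a [b /submxP[D UE]]].
  exists (\row_r match enum_val r with
    | inl (inl (i, k)) => D i k | inl (inr (k, i)) => a k 0 i | inr (k, i) => b k 0 i end).
  rewrite UE /G; congr (_ *m _).
    by apply/matrixP => i k; rewrite mxE /x mxE enum_rankK.
  apply/row_matrixP => k; rewrite !rowK; congr rank1.
    by apply/rowP => i; rewrite [LHS]mxE /x [LHS]mxE enum_rankK.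
  by apply/rowP => i; rewrite [LHS]mxE /x [LHS]mxE enum_rankK.
move=> [c <-]; exists (va c), (vb c); exact: submxMl.
Qed.

Lemma covered5_mull (Q : 'M[R]_(3 * 3)) (U : 'M[R]_(3 * 3)) : orthmx Q ->
  covered5 (Q *m U) <-> covered5 U.
Proof.
move=> hQ; apply: covered5_eqmx; apply: eqmxMfull.
by rewrite row_full_unit; have [] := mulmx1_unit hQ.
Qed.

(** Transposed so that the right multiplication of [coord_mx_orth] becomes the left multiplication
    of [gs_mxM]. *)
Definition gaussm : #|{: 'I_(3 * 3) * 'I_(3 * 3)}|.-tuple R -> 'M[R]_(3 * 3) :=
  fun z => (coord_mx (id : 'I_(3 * 3) * 'I_(3 * 3) -> _) z)^T.

(* The probability that a Haar-distributed 5-dimensional subspace of R^9 is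
   spanned by rank-one matrices. *)
Definition kappa : \bar R :=
  gaussn R _ [set z | covered5 (pid_mx 5 *m gs_mx (gaussm z) : 'M[R]_(3 * 3))].

Hypothesis gen_gaussm : gen (fun z => \det (gaussm z) != 0).

Lemma gaussn_indic n (A : set (n.-tuple rT)) : measurable A ->
  gaussn R n A = (\int[gaussn R n]_t (\1_A t)%:E)%E.
Proof. by move=> mA; rewrite integral_indic// setIT. Qed.

Lemma integral_gaussn_cst n (c : \bar R) : (\int[gaussn R n]_t c = c)%E.
Proof.
transitivity (\int[gaussn R n]_t cst c t)%E => //.
by rewrite integral_cst// [X in (_ * X)%E](@probability_setT _ _ _ (gaussn R n)) mule1.
Qed.

Lemma gaussn_orth n (Q : 'M[R]_n) (A : set (n.-tuple rT)) : orthmx Q -> measurable A ->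
  gaussn R n [set t | A (act Q t)] = gaussn R n A.
Proof.
move=> hQ mA.
have mA' : measurable [set t | A (act Q t)].
  by rewrite -[X in measurable X]setTI; exact: measurable_act.
rewrite (gaussn_indic mA') (gaussn_indic mA).
have mI : measurable_fun [set: n.-tuple rT] (fun t => (\1_A t)%:E : \bar R) by exact/measurable_EFinP.
have I0 t : (0 <= (\1_A t)%:E :> \bar R)%E by rewrite lee_fin.
rewrite -(integral_gaussn_orth hQ mI I0).
by apply: eq_integral => t _; rewrite !indicE; congr (_%:E); congr (_%:R); congr nat_of_bool; apply/idP/idP; rewrite !inE.
Qed.

(** The event [covered5 (K t *m O z)] is integrated in both orders. For fixed [z], the hypothesis on
    [K] replaces [K t *m O z] by a conjugate of [K t], with the same row space up to the change of
    variable, and leaves the left side. For fixed [t], the row space of [K t] is that of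
    [pid_mx 5 *m Q], and [Q] is absorbed by the left invariance of [O], which leaves [kappa]. *)
Lemma gaussn_covered5 N (K : N.-tuple rT -> 'M[R]_(3 * 3)) (Nul : set (N.-tuple rT)) :
  (forall i j, measurable_fun [set: N.-tuple rT] (fun t => K t i j : rT)) ->
  (forall Q, orthmx Q -> exists2 Q', orthmx Q' & forall t, K (act Q' t) = Q^T *m K t *m Q) ->
  measurable Nul -> gaussn R N Nul = 0%E -> (forall t, ~ Nul t -> \rank (K t) = 5%N) ->
  gaussn R N [set t | covered5 (K t)] = kappa.
Proof.
move=> mK KQ mNul Nul0 rK.
pose O z := gs_mx (gaussm z).
have mO i j : measurable_fun [set: #|{: 'I_(3 * 3) * 'I_(3 * 3)}|.-tuple rT] (fun z => O z i j : rT).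
  apply: measurable_gs_mx => i' j'; apply: measurable_trmx => i'' j''; exact: measurable_coord_mx.
pose S := [set p : N.-tuple rT * #|{: 'I_(3 * 3) * 'I_(3 * 3)}|.-tuple rT | covered5 (K p.1 *m O p.2)].
have mS : measurable S.
  apply: measurable_covered5; apply: measurable_mulmx => i j.
    exact: (measurableT_comp (mK i j)).
  exact: (measurableT_comp (mO i j)).
pose f p := (\1_S p)%:E : \bar R.
have mf : measurable_fun setT f by exact/measurable_EFinP.
have f0 p : (0 <= f p)%E by rewrite lee_fin.
have mK5 : measurable [set t | covered5 (K t)] by exact: measurable_covered5.
have mS1 z : measurable [set t | covered5 (K t *m O z)].
  by apply: measurable_covered5; apply: measurable_mulmx => i j; [exact: mK|exact: measurable_cst].
have mS2 t : measurable [set z | covered5 (K t *m O z)].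
  by apply: measurable_covered5; apply: measurable_mulmx => i j; [exact: measurable_cst|exact: mO].
have f1 z : (\int[gaussn R N]_t f (t, z) = gaussn R N [set t | covered5 (K t *m O z)])%E.
  by rewrite (gaussn_indic (mS1 z)).
have f2 t : (\int[gaussn R _]_z f (t, z) = gaussn R _ [set z | covered5 (K t *m O z)])%E.
  by rewrite (gaussn_indic (mS2 t)).
have := fubini_tonelli (m1 := gaussn R N) (m2 := gaussn R _) f mf f0.
have -> : (\int[gaussn R _]_z \int[gaussn R N]_t f (t, z) = gaussn R N [set t | covered5 (K t)])%E.
  rewrite -[RHS](integral_gaussn_cst #|{: 'I_(3 * 3) * 'I_(3 * 3)}|).
  pose Z0 := [set z : #|{: 'I_(3 * 3) * 'I_(3 * 3)}|.-tuple rT | \det (gaussm z) = 0].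
  have mZ0 : measurable Z0.
    apply: measurable_neq0; apply: measurable_det => i j.
    by apply: measurable_trmx => i' j'; exact: measurable_coord_mx.
  apply: ge0_ae_eq_integral => //.
  - exact: measurable_fun_fubini_tonelli_G.
  - by move=> z _; apply: integral_ge0 => t _; exact: f0.
  exists Z0; split => //.
    by apply: gaussn_gen_null => //; apply: gen_imply gen_gaussm => z /eqP.
  move=> z /= H; apply: contrapT => /eqP zd; apply: H => _.
  have uZ : gaussm z \in unitmx by rewrite unitmxE unitfE.
  have [hO _] := gs_mxP uZ.
  rewrite f1; have [Q' hQ' KE] := KQ _ hO.
  have E t : covered5 (K (act Q' t)) <-> covered5 (K t *m O z).
    by rewrite KE -mulmxA; apply: covered5_mull; exact: orthmx_tr.
  rewrite -[RHS](gaussn_orth hQ')//; congr (gaussn R N _).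
  by apply/seteqP; split => t /= /E.
move=> <-.
rewrite -[RHS](integral_gaussn_cst N).
apply: ge0_ae_eq_integral => //.
- exact: measurable_fun_fubini_tonelli_F.
- by move=> t _; apply: integral_ge0 => z _; exact: f0.
- by move=> t _; exact: measure_ge0.
exists Nul; split => //.
move=> t /= H; apply: contrapT => /rK r5; apply: H => _.
rewrite f2 /kappa; have [Q hQ] := rowspace_orth (K t); rewrite r5 => /eqmxP KE.
have idK : cancel id (id : 'I_(3 * 3) * 'I_(3 * 3) -> _) by [].
have [Q' hQ' QE] := coord_mx_orth idK idK (orthmx_tr hQ).
have mP : measurable [set z | covered5 (pid_mx 5 *m O z : 'M[R]_(3 * 3))].
  by apply: measurable_covered5; apply: measurable_mulmx => i j; [exact: measurable_cst|exact: mO].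
refine (etrans _ (gaussn_orth hQ' mP)); refine (congr1 (fun A => gaussn R _ A) _).
have E z : covered5 (K t *m O z) <-> covered5 (pid_mx 5 *m gs_mx (gaussm (act Q' z)) : 'M[R]_(3 * 3)).
  rewrite /gaussm QE trmx_mul trmxK gs_mxM// mulmxA.
  by apply: covered5_eqmx; exact: eqmxMr.
by apply/seteqP; split => z /= /E.
Qed.

End haar_average.

(** * Generic smoothness *)

Section cubic_algebra.
Variable F : fieldType.

(* [blf A A B] is the trace of [\adj A *m B], the derivative of det at A in
   the direction B; it is polarized in A, and indices are cyclic in 'I_3. *)
Definition blf (A A' B : 'M[F]_3) : F := \sum_i \sum_j
  (A (i + 1) (j + 1) * A' (i + 2%:R) (j + 2%:R) - A (i + 1) (j + 2%:R) * A' (i + 2%:R) (j + 1)) * B i j.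

Definition lc (M : 'I_4 -> 'M[F]_3) (z : 'rV[F]_4) : 'M[F]_3 := \sum_k z 0 k *: M k.

(* No nonzero point is singular on the determinantal cubic of M. *)
Definition smooth (M : 'I_4 -> 'M[F]_3) : Prop :=
  forall z, z != 0 -> exists j, blf (lc M z) (lc M z) (M j) != 0.

Lemma det3E (A : 'M[F]_3) : \det A =
  A 0 0 * (A 1 1 * A 2%:R 2%:R - A 1 2%:R * A 2%:R 1)
  - A 0 1 * (A 1 0 * A 2%:R 2%:R - A 1 2%:R * A 2%:R 0)
  + A 0 2%:R * (A 1 0 * A 2%:R 1 - A 1 1 * A 2%:R 0).
Proof.
pose a (m n : nat) := A (inord m) (inord n).
have aE i j : A i j = a i j by rewrite /a !inord_val.
rewrite (expand_det_row _ 0) !big_ord_recl big_ord0 /cofactor.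
rewrite !(expand_det_row _ 0) !big_ord_recl !big_ord0 /cofactor !det_mx11 !mxE !aE /=.
rewrite /bump /= !exprS !expr0. ring.
Qed.

Lemma sum3E (f : 'I_3 -> F) : \sum_i f i = f 0 + f 1 + f 2%:R.
Proof.
rewrite !big_ord_recl big_ord0 addr0 addrA; congr (f _ + f _ + f _); exact: val_inj.
Qed.

Lemma blfE (A A' B : 'M[F]_3) : blf A A' B =
  (A 1 1 * A' 2%:R 2%:R - A 1 2%:R * A' 2%:R 1) * B 0 0 +
  (A 1 2%:R * A' 2%:R 0 - A 1 0 * A' 2%:R 2%:R) * B 0 1 +
  (A 1 0 * A' 2%:R 1 - A 1 1 * A' 2%:R 0) * B 0 2%:R +
  (A 2%:R 1 * A' 0 2%:R - A 2%:R 2%:R * A' 0 1) * B 1 0 +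
  (A 2%:R 2%:R * A' 0 0 - A 2%:R 0 * A' 0 2%:R) * B 1 1 +
  (A 2%:R 0 * A' 0 1 - A 2%:R 1 * A' 0 0) * B 1 2%:R +
  (A 0 1 * A' 1 2%:R - A 0 2%:R * A' 1 1) * B 2%:R 0 +
  (A 0 2%:R * A' 1 0 - A 0 0 * A' 1 2%:R) * B 2%:R 1 +
  (A 0 0 * A' 1 1 - A 0 1 * A' 1 0) * B 2%:R 2%:R.
Proof.
have e1 : (1 + 1 : 'I_3) = 2%:R by exact: val_inj.
have e2 : (2%:R + 1 : 'I_3) = 0 by exact: val_inj.
have e3 : (1 + 2%:R : 'I_3) = 0 by exact: val_inj.
have e4 : (2%:R + 2%:R : 'I_3) = 1 by exact: val_inj.
rewrite /blf sum3E !sum3E !add0r e2 e3 e4 ?e1; ring.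
Qed.

(** [blf] is not symmetric in [A] and [A'], but its symmetrization is the full polarization of the
    determinant and can be computed from determinants alone. *)
Lemma blf_polar (A A' B : 'M[F]_3) : blf A A' B + blf A' A B =
  \det (A + A' + B) - \det (A + A') - \det (A + B) - \det (A' + B) + \det A + \det A' + \det B.
Proof. by rewrite !blfE !det3E !mxE; ring. Qed.

Lemma blf_suml (J : finType) (c : J -> F) (A : J -> 'M[F]_3) (A' B : 'M[F]_3) :
  blf (\sum_k c k *: A k) A' B = \sum_k c k * blf (A k) A' B.
Proof.
apply: (big_ind2 (fun x y => blf x A' B = y)).
- by rewrite blfE !mxE; ring.
- by move=> X x Y y <- <-; rewrite !blfE !mxE; ring.
- by move=> k _; rewrite !blfE !mxE; ring.
Qed.

Lemma blf_sumr (J : finType) (c : J -> F) (A : J -> 'M[F]_3) (A' B : 'M[F]_3) :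
  blf A' (\sum_k c k *: A k) B = \sum_k c k * blf A' (A k) B.
Proof.
apply: (big_ind2 (fun x y => blf A' x B = y)).
- by rewrite blfE !mxE; ring.
- by move=> X x Y y <- <-; rewrite !blfE !mxE; ring.
- by move=> k _; rewrite !blfE !mxE; ring.
Qed.

Lemma blf_lc (M : 'I_4 -> 'M[F]_3) z B : blf (lc M z) (lc M z) B =
  \sum_c \sum_d z 0 c * z 0 d * blf (M c) (M d) B.
Proof.
rewrite /lc blf_suml; apply: eq_bigr => c _; rewrite blf_sumr mulr_sumr.
by apply: eq_bigr => d _; rewrite mulrA.
Qed.

Lemma mul_row_mx_col (N : 'M[F]_3) (u v : 'rV[F]_3) : (u *m N *m v^T) 0 0 =
  u 0 0 * (N 0 0 * v 0 0 + N 0 1 * v 0 1 + N 0 2%:R * v 0 2%:R) +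
  u 0 1 * (N 1 0 * v 0 0 + N 1 1 * v 0 1 + N 1 2%:R * v 0 2%:R) +
  u 0 2%:R * (N 2%:R 0 * v 0 0 + N 2%:R 1 * v 0 1 + N 2%:R 2%:R * v 0 2%:R).
Proof. by rewrite mxE sum3E !mxE !sum3E; ring. Qed.

End cubic_algebra.

(** * Generic nonvanishing of polynomials *)

Section generic_polynomial.
Variable R : realType.
Local Notation C := R[i].

Section environments.
Variable I : finType.

Definition upd (T : Type) (e : I -> T) (k : I) (x : T) : I -> T := fun j => if j == k then x else e j.

(** The analogue of [gen] for families indexed by a finite type: the variables are chosen along a
    list, which can be cut into blocks. *)
Fixpoint genl (s : seq I) (P : (I -> R) -> Prop) (e : I -> R) : Prop :=
  if s is k :: s' then exists bad : seq R, forall x, x \notin bad -> genl s' P (upd e k x)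
  else P e.

Lemma genl_imply s (P Q : (I -> R) -> Prop) e : (forall e', P e' -> Q e') -> genl s P e -> genl s Q e.
Proof.
move=> PQ; elim: s e => [|k s IH] e /=; first exact: PQ.
by move=> [bad H]; exists bad => x /H; exact: IH.
Qed.

Lemma genl_and s (P Q : (I -> R) -> Prop) e : genl s P e -> genl s Q e -> genl s (fun e => P e /\ Q e) e.
Proof.
elim: s e => [|k s IH] e //= [bad H] [bad' H']; exists (bad ++ bad') => x.
by rewrite mem_cat negb_or => /andP[/H ? /H' ?]; exact: IH.
Qed.

Lemma genl_cat s1 s2 P e : genl (s1 ++ s2) P e = genl s1 (genl s2 P) e.
Proof.
elim: s1 e => [|k s1 IH] e //=.
by apply/propext; split => -[bad H]; exists bad => x /H; rewrite IH.
Qed.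

Lemma gen_genl_aux (s : seq I) n (P : (I -> R) -> Prop) e : size s = n -> uniq s -> genl s P e ->
  gen (fun t : n.-tuple R => P (fun k => if k \in s then nth 0 t (index k s) else e k)).
Proof.
elim: s n e => [|k s IH] n e /= <- /=; first by [].
move=> /andP[ks us] [bad H]; exists bad => x /H {}H.
apply: gen_imply (IH _ _ erefl us H) => t; congr P.
apply/funext => j; rewrite inE /upd; have [->|jk] := eqVneq j k.
  by rewrite (negbTE ks).
by [].
Qed.

Lemma gen_genl (P : (I -> R) -> Prop) e : genl (enum I) P e ->
  gen (fun t : #|I|.-tuple R => P (fun k => tnth t (enum_rank k))).
Proof.
move=> H; have := gen_genl_aux (esym (cardE I)) (enum_uniq I) H.
apply: gen_imply => t; congr P; apply/funext => k.
rewrite mem_enum (tnth_nth 0) /=; congr (nth 0 t _).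
by rewrite -{1}(nth_enum_rank k k) index_uniq ?enum_uniq -?cardE.
Qed.

(* D is a polynomial in each variable separately. *)
Definition sepoly (D : (I -> C) -> C) : Prop :=
  forall e k, exists p : {poly C}, forall x, D (upd e k x) = p.[x].

Lemma eq_sepoly D1 D2 : D1 =1 D2 -> sepoly D1 -> sepoly D2.
Proof. by move=> /funext ->. Qed.

Lemma sepoly_const c : sepoly (fun=> c).
Proof. by move=> e k; exists c%:P => x; rewrite hornerC. Qed.

Lemma sepoly_var j : sepoly (fun e => e j).
Proof.
move=> e k; rewrite /upd; case: (j == k); first by exists ('X : {poly C}) => x; rewrite hornerX.
by exists (e j)%:P => x; rewrite hornerC.
Qed.

Lemma sepolyD D1 D2 : sepoly D1 -> sepoly D2 -> sepoly (fun e => D1 e + D2 e).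
Proof.
by move=> H1 H2 e k; have [p Hp] := H1 e k; have [q Hq] := H2 e k; exists (p + q) => x; rewrite hornerD Hp Hq.
Qed.

Lemma sepolyM D1 D2 : sepoly D1 -> sepoly D2 -> sepoly (fun e => D1 e * D2 e).
Proof.
by move=> H1 H2 e k; have [p Hp] := H1 e k; have [q Hq] := H2 e k; exists (p * q) => x; rewrite hornerM Hp Hq.
Qed.

Lemma sepolyN D1 : sepoly D1 -> sepoly (fun e => - D1 e).
Proof. by move=> H1 e k; have [p Hp] := H1 e k; exists (- p) => x; rewrite hornerN Hp. Qed.

Lemma sepolyB D1 D2 : sepoly D1 -> sepoly D2 -> sepoly (fun e => D1 e - D2 e).
Proof. by move=> H1 H2; apply: sepolyD => //; exact: sepolyN. Qed.

Lemma sepoly_sum (J : Type) (r : seq J) (P : pred J) (F : J -> (I -> C) -> C) :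
  (forall j, sepoly (F j)) -> sepoly (fun e => \sum_(j <- r | P j) F j e).
Proof.
move=> HF; elim: r => [|j r IH].
  by have := sepoly_const 0; congr sepoly; apply/funext => e; rewrite big_nil.
have [Pj|Pj] := boolP (P j).
  by have := sepolyD (HF j) IH; congr sepoly; apply/funext => e; rewrite big_cons Pj.
by have := IH; congr sepoly; apply/funext => e; rewrite big_cons (negbTE Pj).
Qed.

Lemma sepoly_prod (J : Type) (r : seq J) (P : pred J) (F : J -> (I -> C) -> C) :
  (forall j, sepoly (F j)) -> sepoly (fun e => \prod_(j <- r | P j) F j e).
Proof.
move=> HF; elim: r => [|j r IH].
  by have := sepoly_const 1; congr sepoly; apply/funext => e; rewrite big_nil.
have [Pj|Pj] := boolP (P j).
  by have := sepolyM (HF j) IH; congr sepoly; apply/funext => e; rewrite big_cons Pj.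
by have := IH; congr sepoly; apply/funext => e; rewrite big_cons (negbTE Pj).
Qed.

Definition sepoly_mx m n (A : (I -> C) -> 'M[C]_(m, n)) : Prop := forall i j, sepoly (fun e => A e i j).

Lemma sepoly_det n (A : (I -> C) -> 'M[C]_n) : sepoly_mx A -> sepoly (fun e => \det (A e)).
Proof.
move=> HA; apply: sepoly_sum => s; apply: sepolyM; first exact: sepoly_const.
by apply: sepoly_prod => i; exact: HA.
Qed.

Lemma sepoly_mulmx m n p (A : (I -> C) -> 'M[C]_(m, n)) (B : (I -> C) -> 'M[C]_(n, p)) :
  sepoly_mx A -> sepoly_mx B -> sepoly_mx (fun e => A e *m B e).
Proof.
move=> HA HB i j.
have := sepoly_sum (index_enum _) xpredT (fun k => sepolyM (HA i k) (HB k j)).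
by congr sepoly; apply/funext => e; rewrite mxE.
Qed.

Lemma sepoly_constmx m n (A : 'M[C]_(m, n)) : sepoly_mx (fun=> A).
Proof. by move=> i j; exact: sepoly_const. Qed.

Definition cenv (e : I -> R) : I -> C := fun k => (e k)%:C%C.

Lemma poly_bad (p : {poly C}) : p != 0 -> exists bad : seq R, forall x, x \notin bad -> p.[x%:C%C] != 0.
Proof.
move=> p0; have [rs pE] := closed_field_poly_normal p.
exists [seq complex.Re z | z <- rs] => x xb; apply: contra xb; rewrite pE hornerZ mulf_eq0 lead_coef_eq0 (negbTE p0) /=.
rewrite -/(root _ _) root_prod_XsubC => xrs.
by apply/mapP; exists (x%:C%C).
Qed.

(** The witness may be complex although the conclusion is about real values: a one-variable
    polynomial that is nonzero at [t k] vanishes at finitely many reals only, so the coordinates of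
    [t] are replaced by real ones in turn. *)
Lemma genl_sepoly (D : (I -> C) -> C) (s : seq I) (e : I -> R) (t : I -> C) : sepoly D ->
  (forall k, k \notin s -> t k = (e k)%:C%C) -> D t != 0 -> genl s (fun e => D (cenv e) != 0) e.
Proof.
move=> HD; elim: s e t => [|k s IH] e t te Dt /=.
  by have -> : cenv e = t by apply/funext => k; rewrite te.
have [p Hp] := HD t k.
have p0 : p != 0.
  apply: contra Dt => /eqP p0; have -> : t = upd t k (t k).
    by apply/funext => j; rewrite /upd; case: eqP => // ->.
  by rewrite Hp p0 horner0.
have [bad Hbad] := poly_bad p0; exists bad => x /Hbad px.
apply: (IH _ (upd t k x%:C%C)); last by rewrite Hp.
move=> j js; rewrite /upd; case: eqP => // jk; apply: te.
by rewrite inE negb_or js andbT; apply/eqP.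
Qed.

End environments.
End generic_polynomial.

(** * Macaulay's matrix and generic smoothness *)

Section generic_smooth.
Variable R : realType.
Local Notation C := R[i].
Local Notation I := ('I_4 * 'I_3 * 'I_3)%type.

Definition Mof (F : fieldType) (e : I -> F) (k : 'I_4) : 'M[F]_3 := \matrix_(i, j) e (k, i, j).

Lemma sepoly_Mof k : sepoly_mx (fun e : I -> C => Mof e k).
Proof. by move=> a b; apply: eq_sepoly (@sepoly_var R I (k, a, b)) => e; rewrite mxE. Qed.

Lemma sepoly_blf (A A' B : (I -> C) -> 'M[C]_3) : sepoly_mx A -> sepoly_mx A' -> sepoly_mx B ->
  sepoly (fun e => blf (A e) (A' e) (B e)).
Proof.
move=> hA hA' hB; apply: sepoly_sum => i; apply: sepoly_sum => j.
by apply: sepolyM => //; apply: sepolyB; apply: sepolyM.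
Qed.

(** Degree 5 is Macaulay's bound [4 * (2 - 1) + 1] for four quadrics, and the least degree in which
    every monomial in four variables is divisible by a square. *)
Definition mono := {e : {ffun 'I_4 -> 'I_6} | (\sum_k nat_of_ord (e k) == 5)%N}.
Definition mexp (e : mono) (k : 'I_4) : nat := val e k.

Lemma mono_sum (e : mono) : (\sum_k mexp e k)%N = 5%N.
Proof. by apply/eqP; exact: (valP e). Qed.

Lemma mono_ge2 (e : mono) : exists k, (2 <= mexp e k)%N.
Proof.
apply: contrapT => H; have := mono_sum e.
have le1 k : (mexp e k <= 1)%N by rewrite leqNgt; apply/negP => h; apply: H; exists k.
have : (\sum_k mexp e k <= \sum_(k < 4) 1)%N by exact: leq_sum.
by move=> /[swap] ->; rewrite sum_nat_const card_ord.
Qed.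

Definition mvar (e : mono) : 'I_4 := xchoose (mono_ge2 e).
Lemma mvarP e : (2 <= mexp e (mvar e))%N. Proof. exact: (xchooseP (mono_ge2 e)). Qed.

Lemma mvar_le e k : (2 * (k == mvar e) <= mexp e k)%N.
Proof.
have [->|] := eqVneq k (mvar e); last by [].
by rewrite muln1 mvarP.
Qed.

(** The square of the variable [mvar e] in [e] is replaced by the product of the variables [c] and
    [d]. The equation is additive to avoid truncated subtraction. *)
Definition shifted (e e' : mono) (c d : 'I_4) : bool :=
  [forall k, (mexp e' k + 2 * (k == mvar e) == mexp e k + (k == c) + (k == d))%N].

Definition mval (z : 'rV[C]_4) (e : mono) : C := \prod_k z 0 k ^+ mexp e k.

(* The part of Macaulay's resultant matrix of the partial derivatives (degree 2,
   in 4 variables) acting on monomials of degree 5, each of which is divisible by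
   the square of some variable. *)
Definition macaulay (M : 'I_4 -> 'M[C]_3) : 'M[C]_#|{: mono}| :=
  \matrix_(a, b) \sum_c \sum_d blf (M c) (M d) (M (mvar (enum_val a))) * (shifted (enum_val a) (enum_val b) c d)%:R.

Lemma mono_mk (f : 'I_4 -> nat) : (\sum_k f k)%N = 5%N -> exists e : mono, forall k, mexp e k = f k.
Proof.
move=> Hf; have lt k : (f k < 6)%N by rewrite ltnS -Hf (bigD1 k)//= leq_addr.
have H : (\sum_k nat_of_ord ([ffun k => Ordinal (lt k)] k) == 5)%N.
  by apply/eqP; rewrite -[RHS]Hf; apply: eq_bigr => k _; rewrite ffunE.
by exists (exist (fun e : {ffun 'I_4 -> 'I_6} => (\sum_k nat_of_ord (e k) == 5)%N) _ H) => k; rewrite /mexp /= ffunE.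
Qed.

Lemma shifted_uniq e e1 e2 c d : shifted e e1 c d -> shifted e e2 c d -> e1 = e2.
Proof.
move=> /forallP H1 /forallP H2; apply: val_inj; apply/ffunP => k; apply: val_inj.
have := H1 k; rewrite -(eqP (H2 k)) => /eqP /addIn; exact.
Qed.

Lemma shifted_ex e c d : exists e', shifted e e' c d.
Proof.
have le k : (2 * (k == mvar e) <= mexp e k + (k == c) + (k == d))%N.
  by rewrite -addnA; apply: leq_trans (mvar_le e k) (leq_addr _ _).
have S1 (l : 'I_4) : (\sum_(k < 4) (k == l))%N = 1%N.
  by rewrite (bigD1 l)//= eqxx big1 ?addn0// => k /negbTE ->.
have [|e' He'] := @mono_mk (fun k => mexp e k + (k == c) + (k == d) - 2 * (k == mvar e))%N.
  apply: (@addIn 2); rewrite -[X in (_ + X)%N = _](_ : (\sum_(k < 4) 2 * (k == mvar e))%N = _).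
    rewrite -big_split /=; under eq_bigr do rewrite subnK//.
    by rewrite !big_split /= !S1 mono_sum.
  by rewrite -big_distrr /= S1.
by exists e'; apply/forallP => k; rewrite He' subnK.
Qed.

(** The row of [e] represents the partial derivative of index [mvar e] multiplied by [e] divided by
    the square of that variable, and this product vanishes at a singular point. *)
Lemma macaulay_ker (M : 'I_4 -> 'M[C]_3) (z : 'rV[C]_4) :
  (forall j, blf (lc M z) (lc M z) (M j) = 0) ->
  macaulay M *m (\col_b mval z (enum_val b)) = 0.
Proof.
move=> H; apply/colP => a; rewrite !mxE; set e := enum_val a.
transitivity (\sum_e' (\sum_c \sum_d blf (M c) (M d) (M (mvar e)) * (shifted e e' c d)%:R) * mval z e').
  rewrite (reindex _ (onW_bij _ (enum_val_bij {: mono}))).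
  by apply: eq_bigr => b _; rewrite !mxE.
pose m := \prod_k z 0 k ^+ (mexp e k - 2 * (k == mvar e)).
transitivity (m * blf (lc M z) (lc M z) (M (mvar e))); last by rewrite H mulr0.
rewrite blf_lc mulr_sumr; under eq_bigr do rewrite mulr_suml.
rewrite exchange_big /=; apply: eq_bigr => c _.
rewrite mulr_sumr; under eq_bigr do rewrite mulr_suml.
rewrite exchange_big /=; apply: eq_bigr => d _.
have [e' se'] := shifted_ex e c d.
rewrite (bigD1 e')//= se' mulr1 [X in _ + X]big1 => [|e2 ne]; last first.
  rewrite (_ : shifted e e2 c d = false) ?mulr0 ?mul0r//.
  by apply/negbTE; apply: contra ne => /shifted_uniq /(_ se') ->.
rewrite addr0.
have xv (l : 'I_4) : z 0 l = \prod_k z 0 k ^+ (k == l).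
  by rewrite (bigD1 l)//= eqxx expr1 big1 ?mulr1// => k /negbTE ->; rewrite expr0.
have -> : mval z e' = m * (z 0 c * z 0 d).
  rewrite /mval /m (xv c) (xv d) -!big_split /=; apply: eq_bigr => k _.
  rewrite -!exprD; congr (_ ^+ _); apply: (@addIn (2 * (k == mvar e))%N).
  have /forallP/(_ k)/eqP -> := se'.
  by rewrite [RHS]addnAC subnK ?mvar_le// addnA.
by ring.
Qed.

Lemma macaulay_smooth (M : 'I_4 -> 'M[C]_3) : \det (macaulay M) != 0 -> smooth M.
Proof.
move=> dM z z0; apply: contrapT => H; move: z0; apply/negP; rewrite negbK; apply/eqP/rowP => k.
have {}H j : blf (lc M z) (lc M z) (M j) = 0.
  by apply/eqP/negPn/negP => h; apply: H; exists j.
have uM : macaulay M \in unitmx by rewrite unitmxE unitfE.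
have := macaulay_ker H; move=> /(congr1 (mulmx (invmx (macaulay M)))).
rewrite mulKmx// mulmx0 => Hv.
(* The entry of the fifth power of the variable [k] gives [z 0 k = 0]. *)
have [|e He] := @mono_mk (fun l => if l == k then 5%N else 0%N).
  by rewrite (bigD1 k)//= eqxx big1 ?addn0// => l /negbTE ->.
have := congr1 (fun v : 'cV[C]_#|{: mono}| => v (enum_rank e) 0) Hv.
rewrite !mxE enum_rankK /mval (bigD1 k)//= He eqxx big1 ?mulr1 => [|l lk]; last first.
  by rewrite He (negbTE lk) expr0.
by move=> /eqP; rewrite expf_eq0 /= => /eqP.
Qed.

Lemma sepoly_macaulay : sepoly (fun e : I -> C => \det (macaulay (Mof e))).
Proof.
apply: sepoly_det => a b.
apply: (@eq_sepoly _ _ (fun e => \sum_c \sum_d blf (Mof e c) (Mof e d) (Mof e (mvar (enum_val a))) * (shifted (enum_val a) (enum_val b) c d)%:R)).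
  by move=> e; rewrite mxE.
apply: sepoly_sum => c; apply: sepoly_sum => d; apply: sepolyM; last exact: sepoly_const.
by apply: sepoly_blf; exact: sepoly_Mof.
Qed.

(* The Fermat cubic z0^3 + z1^3 + z2^3 + z3^3 as the determinant of a matrix
   with zero diagonal, w being a primitive cube root of unity. *)
Definition fermat (w : C) (k : 'I_4) : 'M[C]_3 := \matrix_(i, j)
  nth 0 (nth [::] (nth [::]
   [:: [:: [:: 0; 1; 0]; [:: 0; 0; 1]; [:: 1; 0; 0]];
       [:: [:: 0; 1; 0]; [:: 0; 0; w]; [:: - 1 - w; 0; 0]];
       [:: [:: 0; 0; 1]; [:: 1; 0; 0]; [:: 0; 1; 0]];
       [:: [:: 0; 0; w]; [:: 1; 0; 0]; [:: 0; - 1 - w; 0]]] k) i) j.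

Lemma det_fermat (w : C) z : w * (1 + w) = -1 -> \det (lc (fermat w) z) = \sum_k z 0 k ^+ 3.
Proof.
move=> hw.
have sum4 (f : 'I_4 -> C) : \sum_k f k = f 0 + f 1 + f 2%:R + f 3%:R.
  rewrite !big_ord_recl big_ord0 addr0 !addrA; congr (f _ + f _ + f _ + f _); exact: val_inj.
have E i j : lc (fermat w) z i j = z 0 0 * fermat w 0 i j + z 0 1 * fermat w 1 i j
    + z 0 2%:R * fermat w 2%:R i j + z 0 3%:R * fermat w 3%:R i j.
  by rewrite /lc summxE sum4 !mxE.
rewrite det3E !E !mxE /= sum4.
set a := z 0 0; set b := z 0 1; set c := z 0 2%:R; set d := z 0 3%:R.
(* The zero diagonal leaves two products of three linear forms, and each is the factorization of a
   sum of two cubes. *)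
have h x y : (x + y) * ((x + w * y) * (x - (1 + w) * y)) = x ^+ 3 + y ^+ 3.
  have -> : (x + w * y) * (x - (1 + w) * y) = x ^+ 2 - x * y - w * (1 + w) * y ^+ 2 by ring.
  by rewrite hw; ring.
transitivity ((a ^+ 3 + b ^+ 3) + (c ^+ 3 + d ^+ 3)); last by ring.
by rewrite -(h a b) -(h c d); ring.
Qed.

(** The derivatives of the Fermat cubic are [3 z_j^2], so that multiplying back the removed square
    returns every monomial to itself with the factor 3. *)
Lemma macaulay_fermat (w : C) : w * (1 + w) = -1 -> macaulay (fermat w) = (3%:R)%:M.
Proof.
move=> hw.
have pol c d j : blf (fermat w c) (fermat w d) (fermat w j) + blf (fermat w d) (fermat w c) (fermat w j)
    = ((c == d) && (d == j))%:R * 6%:R.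
  have lcE k : fermat w k = lc (fermat w) (delta_mx 0 k).
    rewrite /lc (bigD1 k)//= mxE !eqxx scale1r big1 ?addr0// => l lk.
    by rewrite mxE (negbTE lk) scale0r.
  have lcD x y : lc (fermat w) x + lc (fermat w) y = lc (fermat w) (x + y).
    by rewrite /lc -big_split /=; apply: eq_bigr => k _; rewrite mxE scalerDl.
  rewrite blf_polar (lcE c) (lcE d) (lcE j) !lcD !(det_fermat _ hw).
  rewrite -!sumrN -!big_split /=.
  transitivity (\sum_k 6%:R * ((k == c)%:R * ((k == d)%:R * (k == j)%:R)) : C).
    by apply: eq_bigr => k _; rewrite !mxE /= ?eqxx /=; ring.
  rewrite (bigD1 c)//= eqxx mul1r big1 ?addr0 => [|k /negbTE ->]; last by rewrite mul0r mulr0.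
  case: (eqVneq c d) => [->|_]; last by rewrite mul0r mulr0 mul0r.
  by rewrite ?eqxx /=; case: (d == j); ring.
apply/matrixP => a b; rewrite !mxE; set e := enum_val a; set e' := enum_val b.
have shC c d : shifted e e' c d = shifted e e' d c.
  by apply: eq_forallb => k; rewrite addnAC.
set S := \sum_c _.
(* The cubic determines only the symmetrized [blf], so the entry is doubled by exchanging [c] and
   [d], and 2 is divided out afterwards. *)
have SS : S + S = \sum_c \sum_d ((c == d) && (d == mvar e))%:R * 6%:R * (shifted e e' c d)%:R.
  rewrite {2}/S exchange_big /= /S -big_split /=; apply: eq_bigr => c _.
  rewrite -big_split /=; apply: eq_bigr => d _.
  by rewrite (shC d c) -mulrDl pol.
have SS' : S + S = 6%:R * (shifted e e' (mvar e) (mvar e))%:R.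
  rewrite SS (bigD1 (mvar e))//= [X in _ + X]big1 => [|c cm]; last first.
    rewrite big1// => d _; case: eqP => [<-|_]; last by rewrite !mul0r.
    by rewrite (negbTE cm) !mul0r.
  rewrite addr0 (bigD1 (mvar e))//= eqxx !mul1r big1 ?addr0// => d dm.
  by rewrite eq_sym (negbTE dm) !mul0r.
have -> : S = 3%:R * (shifted e e' (mvar e) (mvar e))%:R.
  have n2 : (2%:R : C) != 0 by rewrite pnatr_eq0.
  by apply: (mulfI n2); rewrite mulr2n mulrDl mul1r SS'; ring.
rewrite -[RHS]mulr_natr; congr (_ * _%:R); congr nat_of_bool.
apply/idP/eqP => [sh|ab].
  apply: enum_val_inj; rewrite -/e -/e'.
  apply: shifted_uniq sh; apply/forallP => k; by rewrite -addnA mul2n addnn.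
by rewrite /e /e' ab; apply/forallP => k; rewrite -addnA mul2n addnn.
Qed.

Lemma cube_root_unity : exists w : C, w * (1 + w) = -1.
Proof.
have [w] := @solve_monicpoly C 2 (fun n => if n == 0%N then -1 else -1) isT.
rewrite !big_ord_recl big_ord0 /= expr0 expr1 mulr1 addr0 => hw.
by exists w; rewrite mulrDr mulr1 -expr2 hw; ring.
Qed.

Lemma genl_smooth (e : I -> R) : genl (enum {: I}) (fun e => smooth (Mof (cenv e))) e.
Proof.
have [w hw] := cube_root_unity.
have D0 : \det (macaulay (Mof (fun k : I => fermat w k.1.1 k.1.2 k.2))) != 0.
  have -> : Mof (fun k : I => fermat w k.1.1 k.1.2 k.2) = fermat w.
    by apply/funext => k; apply/matrixP => i j; rewrite mxE.
  by rewrite macaulay_fermat// det_scalar expf_neq0// pnatr_eq0.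
apply: genl_imply (genl_sepoly sepoly_macaulay _ D0) => [e'|k]; first exact: macaulay_smooth.
by rewrite mem_enum.
Qed.

End generic_smooth.

(** * The six rank-one matrices orthogonal to four matrices *)

Section sylvester_matrix.
Variable F : fieldType.

(** [n] and [m] bound the degrees of [f] and [g] instead of being read off from them, so that the
    determinant is polynomial in the coefficients. *)
Definition syl (n m : nat) (f g : {poly F}) : 'M[F]_(m + n) := \matrix_(r, c)
  match fintype.split r with
  | inl r => ('X^r * f)`_c
  | inr r => ('X^r * g)`_c
  end.

Lemma poly_as_sum (p : {poly F}) k x : (size p <= k)%N -> p.[x] = \sum_(c < k) p`_c * x ^+ c.
Proof. exact: horner_coef_wide. Qed.

(** The powers of a common root form a kernel vector whose first entry is 1. *)
Lemma syl_root n m (f g : {poly F}) x : (size f <= n.+1)%N -> (size g <= m.+1)%N -> (0 < m + n)%N ->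
  \det (syl n m f g) != 0 -> root f x -> root g x -> False.
Proof.
move=> sf sg mn dS /rootP fx /rootP gx.
have uS : syl n m f g \in unitmx by rewrite unitmxE unitfE.
have sX (r k l : nat) (p : {poly F}) : (r < l)%N -> (size p <= k.+1)%N -> (size (('X^r : {poly F}) * p)%R <= l + k)%N.
  by move=> rl sp; apply: leq_trans (size_polyMleq _ _) _; rewrite size_polyXn; lia.
have : syl n m f g *m (\col_c x ^+ c) = 0.
  apply/colP => r; rewrite !mxE; under eq_bigr do rewrite !mxE.
  case: (fintype.split r) => r'.
    by rewrite -poly_as_sum ?sX// hornerM fx mulr0.
  by rewrite -poly_as_sum 1?addnC ?sX// hornerM gx mulr0.
move=> /(congr1 (mulmx (invmx (syl n m f g)))); rewrite mulKmx// mulmx0.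
move=> /colP /(_ (Ordinal mn)); rewrite !mxE expr0 => /eqP.
by rewrite oner_eq0.
Qed.

(** A kernel vector is a relation [u * f + w * g = 0] with [w] of degree less than that of [f];
    coprimality makes [f] divide [w], so [w = 0] and then [u = 0]. *)
Lemma syl_coprime n m (f g : {poly F}) : size f = n.+1 -> (size g <= m.+1)%N ->
  coprimep f g -> \det (syl n m f g) != 0.
Proof.
move=> sf sg cfg; rewrite -unitfE -unitmxE -row_free_unit -kermx_eq0.
apply/rowV0P => v /sub_kermxP Hv.
pose u := \poly_(r < m) (if insub r is Some r then v 0 (lshift n r) else 0).
pose w := \poly_(r < n) (if insub r is Some r then v 0 (rshift m r) else 0).
have uwE : u * f + w * g = 0.
  apply/polyP => c; rewrite coef0.
  have ufE : u * f = \sum_(r < m) v 0 (lshift n r) *: ('X^r * f).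
    rewrite /u poly_def mulr_suml; apply: eq_bigr => r _.
    by rewrite valK scalerAl.
  have wgE : w * g = \sum_(r < n) v 0 (rshift m r) *: ('X^r * g).
    rewrite /w poly_def mulr_suml; apply: eq_bigr => r _.
    by rewrite valK scalerAl.
  have [cmn|cmn] := ltnP c (m + n).
    have := congr1 (fun x : 'rV_(m + n) => x 0 (Ordinal cmn)) Hv.
    rewrite !mxE big_split_ord /= => vS.
    rewrite coefD ufE wgE !coef_sum -[RHS]vS; congr (_ + _); apply: eq_bigr => r _; rewrite !mxE coefZ.
      by rewrite (unsplitK (inl r)).
    by rewrite (unsplitK (inr r)).
  apply: nth_default; apply: leq_trans cmn; apply: leq_trans (size_polyD _ _) _.
  rewrite geq_max; apply/andP; split.
    by apply: leq_trans (size_polyMleq _ _) _; have : (size u <= m)%N := size_poly _ _; lia.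
  by apply: leq_trans (size_polyMleq _ _) _; have : (size w <= n)%N := size_poly _ _; lia.
have f0 : f != 0 by rewrite -size_poly_eq0 sf.
have fw : f %| w.
  rewrite -(Gauss_dvdpl _ cfg) (_ : w * g = - u * f) ?dvdp_mull//.
  by apply/eqP; rewrite mulNr -addr_eq0 addrC uwE.
have w0 : w = 0.
  apply/eqP; apply: contraTT fw => w0; apply/negP => /(dvdp_leq w0).
  by rewrite sf leqNgt ltnS size_poly.
have u0 : u = 0.
  by move: uwE; rewrite w0 mul0r addr0 => /eqP; rewrite mulf_eq0 (negbTE f0) orbF => /eqP.
apply/rowP => r; rewrite mxE -[r]splitK; case: (fintype.split r) => r' /=.
  by have := congr1 (fun p : {poly F} => p`_r') u0; rewrite coef0 coef_poly ltn_ord valK.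
by have := congr1 (fun p : {poly F} => p`_r') w0; rewrite coef0 coef_poly ltn_ord valK.
Qed.

End sylvester_matrix.

(** * Simultaneous diagonalization of two matrices *)

Section simultaneous_diagonalization.
Variable F : closedFieldType.
Implicit Types M : 'M[F]_3.

(** A multiple of the characteristic polynomial of [invmx M0 *m M1] whose coefficients are
    polynomial in the entries, as the genericity argument requires. *)
Definition chi M0 M1 : {poly F} := \det (\matrix_(i, j) ('X * (M0 i j)%:P - (M1 i j)%:P)).

Lemma chiE M0 M1 : M0 \in unitmx -> chi M0 M1 = (\det M0)%:P * char_poly (invmx M0 *m M1).
Proof.
move=> uM; rewrite /chi /char_poly -det_map_mx -det_mulmx; congr (\det _).
rewrite /char_poly_mx mulmxBr mul_mx_scalar -map_mxM mulKVmx//.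
by apply/matrixP => i j; rewrite !mxE.
Qed.

Lemma coprimep_of_syl n m (f g : {poly F}) : (size f <= n.+1)%N -> (size g <= m.+1)%N -> (0 < m + n)%N ->
  \det (syl n m f g) != 0 -> coprimep f g.
Proof.
move=> sf sg mn dS; apply/Pdiv.ClosedField.coprimepP => x fx; apply/negP => gx.
exact: (syl_root sf sg mn dS fx gx).
Qed.

Lemma simultaneous_diag M0 M1 : M0 \in unitmx -> separable_poly (chi M0 M1) ->
  exists P Q, exists lam : 'I_3 -> F, [/\ P \in unitmx, Q \in unitmx, injective lam,
    P *m M0 *m Q = 1%:M & P *m M1 *m Q = diag_mx (\row_i lam i)].
Proof.
move=> uM; rewrite chiE// => sep; set A := invmx M0 *m M1 in sep *.
have sepA : separable_poly (char_poly A).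
  by apply: dvdp_separable sep; rewrite dvdp_mull.
have [rs chE] := closed_field_poly_normal (char_poly A).
have {}chE : char_poly A = \prod_(x <- rs) ('X - x%:P).
  by rewrite chE (monicP (char_poly_monic A)) scale1r.
have urs : uniq rs by rewrite -separable_prod_XsubC -chE.
have [P uP dP] : exists2 P : 'M[F]_3, P \in unitmx & similar_diag P A.
  by apply/diagonalizableP; exists rs => //; rewrite -chE mxminpoly_dvd_char.
have [d dE] : exists d, P *m A *m invmx P = diag_mx d.
  move/(similar_diagLR uP): dP => [d AE]; exists d.
  by rewrite AE conjumx ?unitmx_inv// invmxK !mulmxA mulmxV// mul1mx mulmxK.
exists (P *m invmx M0), (invmx P), (fun i => d 0 i).
have PA : P *m A = diag_mx d *m P by rewrite -dE mulmxKV.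
split.
- by rewrite unitmx_mul uP unitmx_inv.
- by rewrite unitmx_inv.
- have chD : char_poly A = \prod_(x <- [seq d 0 i | i <- enum 'I_3]) ('X - x%:P).
    rewrite big_map big_enum /=.
    have dPn : \det (map_mx polyC P) != 0 by rewrite det_map_mx polyC_eq0 -unitfE -unitmxE.
    apply: (mulfI dPn); rewrite /char_poly -det_mulmx.
    have -> : map_mx polyC P *m char_poly_mx A = char_poly_mx (diag_mx d) *m map_mx polyC P.
      by rewrite /char_poly_mx mulmxBr mulmxBl mul_mx_scalar mul_scalar_mx -!map_mxM PA.
    rewrite det_mulmx mulrC; congr (_ * _).
    rewrite /char_poly_mx map_diag_mx -diag_const_mx -raddfB /= det_diag.
    by apply: eq_bigr => i _; rewrite !mxE.
  by apply/injectiveP; rewrite /injectiveb /dinjectiveb -separable_prod_XsubC -chD.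
- by rewrite -(mulmxA P) mulVmx// mulmx1 mulmxV.
- rewrite -(mulmxA P) -/A dE; congr diag_mx.
  by apply/rowP => i; rewrite mxE.
Qed.

End simultaneous_diagonalization.

(** * The sextic of the six rank-one matrices *)

Section six_roots.
Variable F : closedFieldType.
Variable lam : 'I_3 -> F.
Implicit Types N : 'M[F]_3.

(** Orthogonality of [a^T *m b] to the identity and to [diag lam] means that the products [a_i b_i]
    are proportional to the [del i]. *)
Definition del (i : 'I_3) : F := lam (i + 1) - lam (i + 2%:R).

Definition pol2 N : {poly F} := (del 2%:R * N 2%:R 1)%:P * 'X + (del 0 * N 0 1)%:P.
Definition pol1 N : {poly F} := (del 2%:R * N 2%:R 0)%:P * ('X * 'X) +
  ((del 0 * N 0 0 + del 1 * N 1 1 + del 2%:R * N 2%:R 2%:R)%:P * 'X + (del 0 * N 0 2%:R)%:P).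
Definition pol0 N : {poly F} := (del 1 * N 1 0)%:P * 'X + (del 1 * N 1 2%:R)%:P.

Definition rA N N' := pol2 N * pol0 N' - pol2 N' * pol0 N.
Definition rB N N' := pol2 N * pol1 N' - pol2 N' * pol1 N.
Definition rE N N' := pol1 N * pol0 N' - pol1 N' * pol0 N.
(** [X] times this polynomial is the resultant in [y] of the two quadratics of [avec_bvecE] for [N]
    and [N']. *)
Definition sextic N N' := 'X * (rA N N' * rA N N') - rB N N' * rE N N'.

Definition row3 (x y z : F) : 'rV[F]_3 := \row_i (if i == 0 then x else if i == 1 then y else z).
(** The solution of [a_i b_i] proportional to [del i] for [b = (x, y, 1)], with denominators cleared
    by [x * y]. *)
Definition avec (x y : F) := row3 (del 0 * y) (del 1 * x) (del 2%:R * (x * y)).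
Definition bvec (x y : F) := row3 x y 1.

Lemma avec_bvecE N x y : (avec x y *m N *m (bvec x y)^T) 0 0 =
  (pol2 N).[x] * y ^+ 2 + (pol1 N).[x] * y + x * (pol0 N).[x].
Proof. by rewrite mul_row_mx_col /pol2 /pol1 /pol0 !hornerE !mxE /=; ring. Qed.

(** Eliminating [y ^+ 2] from the quadratics gives the linear equation for [y]. Two combinations of
    the quadratics then vanish, and they recover each quadratic up to the factor [rB], which is
    nonzero. *)
Lemma sextic_root N N' x y : (rB N N').[x] != 0 -> root (sextic N N') x ->
  (rB N N').[x] * y = - (x * (rA N N').[x]) ->
  avec x y *m N *m (bvec x y)^T = 0 /\ avec x y *m N' *m (bvec x y)^T = 0.
Proof.
move=> B0 /rootP f0 yE.
have rAE : (rA N N').[x] = (pol2 N).[x] * (pol0 N').[x] - (pol2 N').[x] * (pol0 N).[x].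
  by rewrite /rA hornerD hornerN !hornerM.
have rBE : (rB N N').[x] = (pol2 N).[x] * (pol1 N').[x] - (pol2 N').[x] * (pol1 N).[x].
  by rewrite /rB hornerD hornerN !hornerM.
have rEE : (rE N N').[x] = (pol1 N).[x] * (pol0 N').[x] - (pol1 N').[x] * (pol0 N).[x].
  by rewrite /rE hornerD hornerN !hornerM.
have {f0} : x * ((rA N N').[x] ^+ 2) = (rB N N').[x] * (rE N N').[x].
  have : (sextic N N').[x] = x * ((rA N N').[x] * (rA N N').[x]) - (rB N N').[x] * (rE N N').[x].
    by rewrite /sextic hornerD hornerN !hornerM hornerX.
  by rewrite f0 => /esym/eqP; rewrite subr_eq0 => /eqP <-; ring.
rewrite rAE rBE rEE in yE B0 *.
move: yE B0; clear rAE rBE rEE.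
set p2 := (pol2 N).[x]; set p1 := (pol1 N).[x]; set p0 := (pol0 N).[x].
set q2 := (pol2 N').[x]; set q1 := (pol1 N').[x]; set q0 := (pol0 N').[x].
move=> yE B0 AE.
pose p := p2 * y ^+ 2 + p1 * y + x * p0; pose q := q2 * y ^+ 2 + q1 * y + x * q0.
set B := p2 * q1 - q2 * p1 in yE B0 AE; set A := p2 * q0 - q2 * p0 in yE AE.
set E := p1 * q0 - q1 * p0 in AE.
have e1 : p2 * q - q2 * p = 0.
  have -> : p2 * q - q2 * p = B * y + x * A by rewrite /p /q /B /A; ring.
  by rewrite yE; ring.
have e2 : q1 * p - p1 * q = 0.
  have h : B * (q1 * p - p1 * q) = (B * y) ^+ 2 - x * (B * E) by rewrite /p /q /B /E; ring.
  apply: (mulfI B0); rewrite h yE -AE; ring.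
have Bp : B * p = 0.
  have -> : B * p = p2 * (q1 * p - p1 * q) + p1 * (p2 * q - q2 * p) by rewrite /B; ring.
  by rewrite e1 e2 !mulr0 addr0.
have Bq : B * q = 0.
  have -> : B * q = q2 * (q1 * p - p1 * q) + q1 * (p2 * q - q2 * p) by rewrite /B; ring.
  by rewrite e1 e2 !mulr0 addr0.
move/eqP: Bp; rewrite mulf_eq0 (negbTE B0) /= => /eqP p0'.
move/eqP: Bq; rewrite mulf_eq0 (negbTE B0) /= => /eqP q0'.
by split; apply/matrixP => i j; rewrite !ord1 [RHS]mxE avec_bvecE.
Qed.

Lemma size_le_add (p q : {poly F}) n : (size p <= n)%N -> (size q <= n)%N -> (size (p + q)%R <= n)%N.
Proof. by move=> sp sq; apply: leq_trans (size_polyD _ _) _; rewrite geq_max sp. Qed.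

Lemma size_le_mul (p q : {poly F}) a b n : (size p <= a.+1)%N -> (size q <= b.+1)%N -> (a + b < n)%N ->
  (size (p * q)%R <= n)%N.
Proof. by move=> sp sq; apply: leq_trans; apply: leq_trans (size_polyMleq _ _) _; lia. Qed.

Lemma size_pol2 N : (size (pol2 N) <= 2)%N.
Proof.
apply: size_le_add; last by rewrite size_polyC; case: (_ != _).
by apply: (@size_le_mul _ _ 0 1); rewrite ?size_polyX// size_polyC; case: (_ != _).
Qed.

Lemma size_pol0 N : (size (pol0 N) <= 2)%N.
Proof.
apply: size_le_add; last by rewrite size_polyC; case: (_ != _).
by apply: (@size_le_mul _ _ 0 1); rewrite ?size_polyX// size_polyC; case: (_ != _).
Qed.

Lemma size_pol1 N : (size (pol1 N) <= 3)%N.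
Proof.
apply: size_le_add.
  apply: (@size_le_mul _ _ 0 2) => //; first by rewrite size_polyC; case: (_ != _).
  by apply: (@size_le_mul _ _ 1 1); rewrite ?size_polyX.
apply: size_le_add; last by rewrite size_polyC; case: (_ != _).
by apply: (@size_le_mul _ _ 0 1); rewrite ?size_polyX// size_polyC; case: (_ != _).
Qed.

Lemma size_rA N N' : (size (rA N N') <= 3)%N.
Proof. by apply: size_le_add; rewrite ?size_polyN; apply: (@size_le_mul _ _ 1 1); rewrite ?size_pol2 ?size_pol0. Qed.

Lemma size_rB N N' : (size (rB N N') <= 4)%N.
Proof. by apply: size_le_add; rewrite ?size_polyN; apply: (@size_le_mul _ _ 1 2); rewrite ?size_pol2 ?size_pol1. Qed.

Lemma size_rE N N' : (size (rE N N') <= 4)%N.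
Proof. by apply: size_le_add; rewrite ?size_polyN; apply: (@size_le_mul _ _ 2 1); rewrite ?size_pol0 ?size_pol1. Qed.

Lemma size_sextic N N' : (size (sextic N N') <= 7)%N.
Proof.
apply: size_le_add; rewrite ?size_polyN.
  apply: (@size_le_mul _ _ 1 4); rewrite ?size_polyX//.
  by apply: (@size_le_mul _ _ 2 2); rewrite ?size_rA.
by apply: (@size_le_mul _ _ 3 3); rewrite ?size_rB ?size_rE.
Qed.

(** The product of all that must not vanish at a root of the sextic: the derivative for simple
    roots, [rB] for the existence of [y], [rA] and [X] for [y] to be nonzero. One Sylvester
    determinant tests everything. *)
Definition companion N N' := (sextic N N')^`() * (rA N N' * (rB N N' * 'X)).

Lemma size_companion N N' : (size (companion N N') <= 12)%N.
Proof.
apply: (@size_le_mul _ _ 5 6) => //.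
  have [->|f0] := eqVneq (sextic N N') 0; first by rewrite deriv0 size_poly0.
  have := lt_size_deriv f0; have := size_sextic N N'; lia.
apply: (@size_le_mul _ _ 2 4) => //; first exact: size_rA.
apply: (@size_le_mul _ _ 3 1) => //; first exact: size_rB.
by rewrite size_polyX.
Qed.

Lemma six_roots N N' : (sextic N N')`_6 != 0 -> \det (syl 6 11 (sextic N N') (companion N N')) != 0 ->
  exists2 xs : 'I_6 -> F, injective xs & forall p,
    [/\ root (sextic N N') (xs p), xs p != 0, (rA N N').[xs p] != 0 & (rB N N').[xs p] != 0].
Proof.
set f := sextic N N' => f6 dS.
have cop : coprimep f (companion N N').
  exact: coprimep_of_syl (size_sextic N N') (size_companion N N') isT dS.
have sf : size f = 7%N.
  apply/eqP; rewrite eqn_leq size_sextic /= ltnNge; apply: contra f6 => s6.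
  by rewrite nth_default.
have f0 : f != 0 by rewrite -size_poly_eq0 sf.
have [rs fE] := closed_field_poly_normal f.
have l0 : lead_coef f != 0 by rewrite lead_coef_eq0.
have srs : size rs = 6%N.
  by have := sf; rewrite fE size_scale// size_prod_XsubC => -[].
have sepf : separable_poly f.
  rewrite separable_poly.unlock; move: cop; rewrite coprimepMr => /andP[cff _]; exact: cff.
have urs : uniq rs.
  rewrite -separable_prod_XsubC; apply: dvdp_separable sepf.
  by rewrite fE dvdpZr.
have rsP x : x \in rs -> [/\ root f x, x != 0, (rA N N').[x] != 0 & (rB N N').[x] != 0].
  move=> xrs; have fx : root f x by rewrite fE rootZ// root_prod_XsubC.
  have /Pdiv.ClosedField.coprimepP/(_ _ fx) := cop.
  rewrite /companion !hornerM hornerX !mulf_eq0 !negb_or => /and4P[_ ? ? ?].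
  by split.
exists (fun p => nth 0 rs p).
  move=> p q /eqP; rewrite nth_uniq ?srs ?ltn_ord// => /eqP; exact: val_inj.
by move=> p; apply: rsP; rewrite mem_nth ?srs.
Qed.

End six_roots.

(** * Existence of the six points for generic matrices *)

Section generic_six_points.
Variable R : realType.
Local Notation C := R[i].
Local Notation I := ('I_4 * 'I_3 * 'I_3)%type.

Definition npar (F : fieldType) n (u v : 'rV[F]_n) : Prop :=
  forall c d, c *: u + d *: v = 0 -> c = 0 /\ d = 0.

(* The six rank-one matrices orthogonal to M: blowing up the six points a (or
   the six points b) of the projective plane gives the cubic surface. *)
Definition sixpts (F : fieldType) (M : 'I_4 -> 'M[F]_3) : Prop :=
  exists a b : 'I_6 -> 'rV[F]_3, (forall p k, a p *m M k *m (b p)^T = 0) /\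
    forall p q, p != q -> npar (a p) (a q) /\ npar (b p) (b q).

(** In [genl_sixpts] the last two matrices vary while the first two, already diagonalized, must stay
    as they are. *)
Lemma genl_keep (J : finType) (s : seq J) (P : (J -> R) -> Prop) e :
  genl s P e -> genl s (fun e' => P e' /\ forall k, k \notin s -> e' k = e k) e.
Proof.
elim: s e => [|k s IH] e /=; first by [].
move=> [bad H]; exists bad => x /H /IH; apply: genl_imply => e' [Pe' H']; split => // j.
by rewrite inE negb_or => /andP[jk js]; rewrite H'// /upd (negbTE jk).
Qed.

Definition sepolyp (J : finType) (F : (J -> C) -> {poly C}) := forall n, sepoly (fun e => (F e)`_n).

Section closure.
Variable J : finType.
Implicit Types (F G : (J -> C) -> {poly C}).

Lemma sepolyp_const (p : {poly C}) : @sepolyp J (fun=> p).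
Proof. by move=> n; exact: sepoly_const. Qed.

Lemma sepolyp_polyC (c : (J -> C) -> C) : sepoly c -> sepolyp (fun e => (c e)%:P).
Proof.
move=> hc [|n]; first by apply: eq_sepoly hc => e; rewrite coefC.
by apply: eq_sepoly (sepoly_const 0) => e; rewrite coefC.
Qed.

Lemma sepolypD F G : sepolyp F -> sepolyp G -> sepolyp (fun e => F e + G e).
Proof. by move=> hF hG n; apply: eq_sepoly (sepolyD (hF n) (hG n)) => e; rewrite coefD. Qed.

Lemma sepolypN F : sepolyp F -> sepolyp (fun e => - F e).
Proof. by move=> hF n; apply: eq_sepoly (sepolyN (hF n)) => e; rewrite coefN. Qed.

Lemma sepolypM F G : sepolyp F -> sepolyp G -> sepolyp (fun e => F e * G e).
Proof.
move=> hF hG n.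
apply: (@eq_sepoly _ _ (fun e => \sum_(k < n.+1) (F e)`_k * (G e)`_(n - k))).
  by move=> e; rewrite coefM.
by apply: sepoly_sum => k; exact: sepolyM.
Qed.

Lemma sepolyp_sum (T : Type) (r : seq T) (P : pred T) (F : T -> (J -> C) -> {poly C}) :
  (forall k, sepolyp (F k)) -> sepolyp (fun e => \sum_(k <- r | P k) F k e).
Proof.
move=> hF n; apply: (@eq_sepoly _ _ (fun e => \sum_(k <- r | P k) (F k e)`_n)).
  by move=> e; rewrite coef_sum.
by apply: sepoly_sum => k; exact: hF.
Qed.

Lemma sepolyp_prod (T : Type) (r : seq T) (F : T -> (J -> C) -> {poly C}) :
  (forall k, sepolyp (F k)) -> sepolyp (fun e => \prod_(k <- r) F k e).
Proof.
move=> hF; elim: r => [|k r IH].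
  by move=> n; apply: eq_sepoly (sepolyp_const 1 n) => e; rewrite big_nil.
by move=> n; apply: eq_sepoly (sepolypM (hF k) IH n) => e; rewrite big_cons.
Qed.

Lemma sepolyp_deriv F : sepolyp F -> sepolyp (fun e => deriv (F e)).
Proof.
move=> hF n; apply: (@eq_sepoly _ _ (fun e => (F e)`_n.+1 * n.+1%:R)).
  by move=> e; rewrite coef_deriv mulr_natr.
by apply: sepolyM => //; exact: sepoly_const.
Qed.

Lemma sepoly_syl n m F G : sepolyp F -> sepolyp G -> sepoly (fun e => \det (syl n m (F e) (G e))).
Proof.
move=> hF hG; apply: sepoly_det => r c.
case rE: (fintype.split r) => [r'|r'].
  apply: eq_sepoly (sepolypM (sepolyp_const 'X^r') hF c) => e.
  by rewrite mxE rE.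
apply: eq_sepoly (sepolypM (sepolyp_const 'X^r') hG c) => e.
by rewrite mxE rE.
Qed.

Lemma sepolyp_chi (M0 M1 : (J -> C) -> 'M[C]_3) : sepoly_mx M0 -> sepoly_mx M1 ->
  sepolyp (fun e => chi (M0 e) (M1 e)).
Proof.
move=> h0 h1; apply: sepolyp_sum => s; apply: sepolypM; first exact: sepolyp_const.
apply: sepolyp_prod => k n.
have h : sepolyp (fun e => 'X * (M0 e k (s k))%:P - (M1 e k (s k))%:P).
  by apply: sepolypD; [apply: sepolypM; [exact: sepolyp_const|exact/sepolyp_polyC]|apply: sepolypN; exact/sepolyp_polyC].
by apply: eq_sepoly (h n) => e; rewrite mxE.
Qed.

Variable lam : 'I_3 -> C.
Variables N N' : (J -> C) -> 'M[C]_3.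
Hypotheses (hN : sepoly_mx N) (hN' : sepoly_mx N').

Lemma sepolyp_pol2 (N0 : (J -> C) -> 'M[C]_3) : sepoly_mx N0 -> sepolyp (fun e => pol2 lam (N0 e)).
Proof.
move=> h.
have cM c i j : sepoly (fun e : J -> C => c * N0 e i j) by apply: sepolyM => //; exact: sepoly_const.
apply: sepolypD; last exact: sepolyp_polyC.
by apply: sepolypM; [exact: sepolyp_polyC|exact: sepolyp_const].
Qed.

Lemma sepolyp_pol0 (N0 : (J -> C) -> 'M[C]_3) : sepoly_mx N0 -> sepolyp (fun e => pol0 lam (N0 e)).
Proof.
move=> h.
have cM c i j : sepoly (fun e : J -> C => c * N0 e i j) by apply: sepolyM => //; exact: sepoly_const.
apply: sepolypD; last exact: sepolyp_polyC.
by apply: sepolypM; [exact: sepolyp_polyC|exact: sepolyp_const].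
Qed.

Lemma sepolyp_pol1 (N0 : (J -> C) -> 'M[C]_3) : sepoly_mx N0 -> sepolyp (fun e => pol1 lam (N0 e)).
Proof.
move=> h.
have cM c i j : sepoly (fun e : J -> C => c * N0 e i j) by apply: sepolyM => //; exact: sepoly_const.
apply: sepolypD; first by apply: sepolypM; [exact: sepolyp_polyC|exact: sepolyp_const].
apply: sepolypD; last exact: sepolyp_polyC.
apply: sepolypM; last exact: sepolyp_const.
by apply: sepolyp_polyC; apply: sepolyD => //; exact: sepolyD.
Qed.

Lemma sepoly_six : sepoly (fun e => (sextic lam (N e) (N' e))`_6 *
  \det (syl 6 11 (sextic lam (N e) (N' e)) (companion lam (N e) (N' e)))).
Proof.
have p2 := sepolyp_pol2 hN; have p1 := sepolyp_pol1 hN; have p0 := sepolyp_pol0 hN.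
have q2 := sepolyp_pol2 hN'; have q1 := sepolyp_pol1 hN'; have q0 := sepolyp_pol0 hN'.
have hA : sepolyp (fun e => rA lam (N e) (N' e)).
  by apply: sepolypD; [|apply: sepolypN]; exact: sepolypM.
have hB : sepolyp (fun e => rB lam (N e) (N' e)).
  by apply: sepolypD; [|apply: sepolypN]; exact: sepolypM.
have hE : sepolyp (fun e => rE lam (N e) (N' e)).
  by apply: sepolypD; [|apply: sepolypN]; exact: sepolypM.
have hS : sepolyp (fun e => sextic lam (N e) (N' e)).
  apply: sepolypD; last by apply: sepolypN; exact: sepolypM.
  by apply: sepolypM; [exact: sepolyp_const|exact: sepolypM].
apply: sepolyM; first exact: hS.
apply: sepoly_syl => //; apply: sepolypM; first exact: sepolyp_deriv.
by apply: sepolypM => //; apply: sepolypM => //; exact: sepolyp_const.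
Qed.

End closure.

Definition block_of (r : seq 'I_4) : seq I :=
  [seq (xy, z) | xy <- [seq (x, y) | x <- r, y <- enum 'I_3], z <- enum 'I_3].

Lemma enum_prod (T1 T2 : finType) : enum {: T1 * T2} = [seq (x, y) | x <- enum T1, y <- enum T2].
Proof. by rewrite [LHS]enumT unlock. Qed.

Lemma enum_blocks : enum {: I} = block_of [:: 0; 1] ++ block_of [:: 2%:R; 3%:R].
Proof.
have e4 : enum 'I_4 = [:: 0; 1] ++ [:: 2%:R; 3%:R].
  by apply: (inj_map val_inj); rewrite val_enum_ord.
rewrite /block_of -!allpairs_cat -e4.
by rewrite !enum_prod.
Qed.

Lemma mem_block (r : seq 'I_4) (k : I) : (k \in block_of r) = (k.1.1 \in r).
Proof.
case: k => [[x y] z]; apply/allpairsP/idP => [[[xy z'] [/= Hxy _ e]]|xr].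
  have xyE : xy = (x, y) by case: e.
  by move: Hxy; rewrite xyE => /allpairsP[[x' y'] [/= ? _ [-> _]]].
exists ((x, y), z); split => //=; last by rewrite mem_enum.
by apply/allpairsP; exists (x, y); split => //=; rewrite mem_enum.
Qed.

Lemma char_poly_diag (F : fieldType) n (d : 'rV[F]_n) :
  char_poly (diag_mx d) = \prod_(x <- [seq d 0 i | i <- enum 'I_n]) ('X - x%:P).
Proof.
rewrite big_map big_enum /= /char_poly /char_poly_mx map_diag_mx -diag_const_mx -raddfB /= det_diag.
by apply: eq_bigr => i _; rewrite !mxE.
Qed.

Lemma separable_of_syl (f : {poly C}) n m : (size f <= n.+1)%N -> (size (deriv f) <= m.+1)%N -> (0 < m + n)%N ->
  \det (syl n m f (deriv f)) != 0 -> separable_poly f.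
Proof. by move=> sf sf' mn dS; rewrite separable_poly.unlock; exact: coprimep_of_syl sf sf' mn dS. Qed.

Lemma size_chi (F : closedFieldType) (M0 M1 : 'M[F]_3) : M0 \in unitmx -> size (chi M0 M1) = 4%N.
Proof.
move=> uM; rewrite chiE// mul_polyC size_scale ?size_char_poly//.
by rewrite -unitfE -unitmxE.
Qed.

Lemma genl_diag (e : I -> R) : genl (block_of [:: 0; 1])
  (fun e => Mof (cenv e) 0 \in unitmx /\ separable_poly (chi (Mof (cenv e) 0) (Mof (cenv e) 1))) e.
Proof.
pose D (t : I -> C) := \det (Mof t 0) * \det (syl 3 2 (chi (Mof t 0) (Mof t 1)) (deriv (chi (Mof t 0) (Mof t 1)))).
have hc : sepolyp (fun t : I -> C => chi (Mof t 0) (Mof t 1)).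
  by apply: sepolyp_chi; exact: sepoly_Mof.
have hD : sepoly D.
  apply: sepolyM; first by apply: sepoly_det; exact: sepoly_Mof.
  by apply: sepoly_syl => //; exact: sepolyp_deriv.
pose M1 : 'M[C]_3 := diag_mx (\row_i (i : nat)%:R).
pose t (k : I) : C := if k.1.1 == 0 then (1%:M : 'M[C]_3) k.1.2 k.2 else
  if k.1.1 == 1 then M1 k.1.2 k.2 else (e k)%:C%C.
have size_d (f : {poly C}) : (size f <= 4)%N -> (size (deriv f) <= 3)%N.
  by have [->|f0] := eqVneq f 0; [rewrite deriv0 size_poly0|have := lt_size_deriv f0; lia].
have Dt : D t != 0.
  have t0 : Mof t 0 = 1%:M by apply/matrixP => i j; rewrite mxE.
  have t1 : Mof t 1 = M1 by apply/matrixP => i j; rewrite mxE.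
  rewrite /D t0 t1 det1 mul1r.
  have u1 : (1%:M : 'M[C]_3) \in unitmx by exact: unitmx1.
  have s4 := size_chi M1 u1.
  apply: syl_coprime => //; first by apply: size_d; rewrite s4.
  have : separable_poly (chi 1%:M M1).
    rewrite chiE// det1 mul1r invmx1 mul1mx char_poly_diag separable_prod_XsubC.
    rewrite map_inj_uniq ?enum_uniq// => i j /eqP; rewrite !mxE eqr_nat => /eqP.
    exact: val_inj.
  by rewrite separable_poly.unlock.
apply: genl_imply (genl_sepoly hD _ Dt) => [e' /=|k].
  rewrite /D mulf_eq0 negb_or => /andP[d0 dS].
  have u0 : Mof (cenv e') 0 \in unitmx by rewrite unitmxE unitfE.
  have s4 := size_chi (Mof (cenv e') 1) u0.
  by split => //; apply: separable_of_syl dS => //; [rewrite s4|apply: size_d; rewrite s4].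
by rewrite mem_block !inE negb_or /t => /andP[/negbTE -> /negbTE ->].
Qed.

Lemma row3_neq (F : closedFieldType) (x y z x' y' z' : F) : x * z' != x' * z ->
  npar (row3 x y z) (row3 x' y' z').
Proof.
move=> ne c d /rowP H; have := H 0; have := H 2%:R; rewrite !mxE /= => H2 H0.
have e1 : c * (x * z' - x' * z) = 0.
  have -> : c * (x * z' - x' * z) = (c * x + d * x') * z' - (c * z + d * z') * x' by ring.
  by rewrite H0 H2 !mul0r subrr.
have e2 : d * (x * z' - x' * z) = 0.
  have -> : d * (x * z' - x' * z) = (c * z + d * z') * x - (c * x + d * x') * z by ring.
  by rewrite H0 H2 !mul0r subrr.
have ne' : x * z' - x' * z != 0 by rewrite subr_eq0.
by split; [move/eqP: e1|move/eqP: e2]; rewrite mulf_eq0 (negbTE ne') orbF => /eqP.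
Qed.

Lemma npar_mulmx (F : fieldType) n (u v : 'rV[F]_n) (P : 'M[F]_n) : P \in unitmx ->
  npar u v -> npar (u *m P) (v *m P).
Proof.
move=> uP h c d H; apply: h; apply: (can_inj (mulmxK uP)).
by rewrite mul0mx mulmxDl -!scalemxAl.
Qed.

(** The points are found where [M 0] is the identity and [M 1] diagonal, then carried back by [P]
    and [Q]. Distinct roots give distinct ratios of the first and third coordinates, in [bvec] and,
    since [ys] is nonzero, in [avec]. *)
Lemma sixpts_normal (F : closedFieldType) (M : 'I_4 -> 'M[F]_3) (P Q : 'M[F]_3) (lam : 'I_3 -> F) :
  P \in unitmx -> Q \in unitmx -> injective lam -> P *m M 0 *m Q = 1%:M ->
  P *m M 1 *m Q = diag_mx (\row_i lam i) ->
  (sextic lam (P *m M 2%:R *m Q) (P *m M 3%:R *m Q))`_6 *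
    \det (syl 6 11 (sextic lam (P *m M 2%:R *m Q) (P *m M 3%:R *m Q))
      (companion lam (P *m M 2%:R *m Q) (P *m M 3%:R *m Q))) != 0 ->
  sixpts M.
Proof.
move=> uP uQ il e0 e1; set N := P *m M 2%:R *m Q; set N' := P *m M 3%:R *m Q.
rewrite mulf_eq0 negb_or => /andP[f6 dS]; have [xs ixs xsP] := six_roots f6 dS.
pose ys p := - (xs p * (rA lam N N').[xs p]) / (rB lam N N').[xs p].
have d0 i : del lam i != 0.
  rewrite /del subr_eq0; apply/negP => /eqP /il /eqP; case: i => [[|[|[|//]]] ?] //.
have sd : del lam 0 + del lam 1 + del lam 2%:R = 0.
  have e1' : (1 + 1 : 'I_3) = 2%:R by exact: val_inj.
  have e2' : (2%:R + 1 : 'I_3) = 0 by exact: val_inj.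
  have e3' : (1 + 2%:R : 'I_3) = 0 by exact: val_inj.
  have e4' : (2%:R + 2%:R : 'I_3) = 1 by exact: val_inj.
  by rewrite /del !add0r e2' e3' e4' ?e1'; ring.
have sld : lam 0 * del lam 0 + lam 1 * del lam 1 + lam 2%:R * del lam 2%:R = 0.
  have e1' : (1 + 1 : 'I_3) = 2%:R by exact: val_inj.
  have e2' : (2%:R + 1 : 'I_3) = 0 by exact: val_inj.
  have e3' : (1 + 2%:R : 'I_3) = 0 by exact: val_inj.
  have e4' : (2%:R + 2%:R : 'I_3) = 1 by exact: val_inj.
  by rewrite /del !add0r e2' e3' e4' ?e1'; ring.
exists (fun p => avec lam (xs p) (ys p) *m P), (fun p => bvec (xs p) (ys p) *m Q^T).
split=> [p k|p q pq].
  set x := xs p; set y := ys p; have [fx x0 A0 B0] := xsP p.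
  have yE : (rB lam N N').[x] * y = - (x * (rA lam N N').[x]) by rewrite /y /ys mulrC divfK.
  have [h2 h3] := sextic_root B0 fx yE.
  have -> : avec lam x y *m P *m M k *m (bvec x y *m Q^T)^T = avec lam x y *m (P *m M k *m Q) *m (bvec x y)^T.
    by rewrite trmx_mul trmxK !mulmxA.
  have [->|->|->|->] : [\/ k = 0, k = 1, k = 2%:R | k = 3%:R].
  - case: k => [[|[|[|[|//]]]] ?]; [constructor 1|constructor 2|constructor 3|constructor 4]; exact: val_inj.
  - rewrite e0; apply/matrixP => i j; rewrite !ord1 [RHS]mxE mul_row_mx_col !mxE /=.
    rewrite -[RHS](mulr0 (x * y)) -sd; ring.
  - rewrite e1; apply/matrixP => i j; rewrite !ord1 [RHS]mxE mul_row_mx_col !mxE /=.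
    rewrite -[RHS](mulr0 (x * y)) -sld; ring.
  - exact: h2.
  - exact: h3.
have xpq : xs p != xs q by apply: contra pq => /eqP /ixs ->.
have [_ xp0 Ap0 Bp0] := xsP p; have [_ xq0 Aq0 Bq0] := xsP q.
have yp0 : ys p != 0 by rewrite /ys mulf_neq0 ?invr_eq0// oppr_eq0 mulf_neq0.
have yq0 : ys q != 0 by rewrite /ys mulf_neq0 ?invr_eq0// oppr_eq0 mulf_neq0.
split; apply: npar_mulmx; rewrite ?unitmx_tr//; apply: row3_neq; last by rewrite !mulr1.
apply/negP => /eqP h; move: xpq; apply/negP; rewrite negbK eq_sym; apply/eqP.
have z : del lam 0 * del lam 2%:R * ys p * ys q != 0.
  by apply: mulf_neq0 => //; apply: mulf_neq0 => //; apply: mulf_neq0; exact: d0.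
apply: (mulfI z); transitivity (del lam 0 * ys p * (del lam 2%:R * (xs q * ys q))); first by ring.
by rewrite h; ring.
Qed.

Lemma genl_sixpts (e : I -> R) : genl (enum {: I}) (fun e => sixpts (Mof (cenv e))) e.
Proof.
rewrite enum_blocks genl_cat; apply: genl_imply (genl_diag e) => {}e [u0 sep].
have [P [Q [lam [uP uQ il e0 e1]]]] := simultaneous_diag u0 sep.
(* Chosen so that the coefficient polynomials become [1, X^2, 1] and [X, 1, 3X] and the sextic
   [3 X^6 + 1]. Its roots are nonzero and simple, and [x^3 = 1] at a root would give [4 = 0]. *)
pose N0 : 'M[C]_3 := \matrix_(i, j) if (i == 0) && (j == 1) then (del lam 0)^-1 else
  if (i == 2%:R) && (j == 0) then (del lam 2%:R)^-1 else
  if (i == 1) && (j == 2%:R) then (del lam 1)^-1 else 0.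
pose N0' : 'M[C]_3 := \matrix_(i, j) if (i == 2%:R) && (j == 1) then (del lam 2%:R)^-1 else
  if (i == 0) && (j == 2%:R) then (del lam 0)^-1 else
  if (i == 1) && (j == 0) then 3%:R / del lam 1 else 0.
have d0 i : del lam i != 0.
  rewrite /del subr_eq0; apply/negP => /eqP /il /eqP; case: i => [[|[|[|//]]] ?] //.
pose t (k : I) : C := if k.1.1 == 2%:R then (invmx P *m N0 *m invmx Q) k.1.2 k.2 else
  if k.1.1 == 3%:R then (invmx P *m N0' *m invmx Q) k.1.2 k.2 else (e k)%:C%C.
pose N t := P *m Mof t 2%:R *m Q; pose N' t := P *m Mof t 3%:R *m Q.
have hN : sepoly_mx N.
  by apply: sepoly_mulmx; [apply: sepoly_mulmx; [exact: sepoly_constmx|exact: sepoly_Mof]|exact: sepoly_constmx].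
have hN' : sepoly_mx N'.
  by apply: sepoly_mulmx; [apply: sepoly_mulmx; [exact: sepoly_constmx|exact: sepoly_Mof]|exact: sepoly_constmx].
have hD := sepoly_six lam hN hN'.
have Nt : N t = N0.
  have -> : N t = P *m (invmx P *m N0 *m invmx Q) *m Q by congr (_ *m _ *m _); apply/matrixP => i j; rewrite mxE.
  by rewrite -!mulmxA mulVmx// mulmx1 mulKVmx.
have Nt' : N' t = N0'.
  have -> : N' t = P *m (invmx P *m N0' *m invmx Q) *m Q by congr (_ *m _ *m _); apply/matrixP => i j; rewrite mxE.
  by rewrite -!mulmxA mulVmx// mulmx1 mulKVmx.
have Dt : (sextic lam (N t) (N' t))`_6 * \det (syl 6 11 (sextic lam (N t) (N' t)) (companion lam (N t) (N' t))) != 0.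
  rewrite Nt Nt'.
  have p2 : pol2 lam N0 = 1 by rewrite /pol2 !mxE /= mulr0 polyC0 mul0r add0r divff.
  have p1 : pol1 lam N0 = 'X * 'X.
    by rewrite /pol1 !mxE /= divff// !mulr0 !addr0 !polyC0 !mul0r !addr0 polyC1 mul1r.
  have p0 : pol0 lam N0 = 1 by rewrite /pol0 !mxE /= mulr0 polyC0 mul0r add0r divff.
  have q2 : pol2 lam N0' = 'X by rewrite /pol2 !mxE /= mulr0 polyC0 addr0 divff// mul1r.
  have q1 : pol1 lam N0' = 1.
    by rewrite /pol1 !mxE /= !mulr0 !addr0 !polyC0 !mul0r !add0r divff.
  have q0 : pol0 lam N0' = 3%:R%:P * 'X by rewrite /pol0 !mxE /= mulr0 polyC0 addr0 mulrCA divff// mulr1.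
  have AE : rA lam N0 N0' = 2%:R * 'X by rewrite /rA p2 q0 q2 p0 polyC_natr; ring.
  have BE : rB lam N0 N0' = 1 - 'X * 'X * 'X by rewrite /rB p2 q1 q2 p1; ring.
  have EE : rE lam N0 N0' = 3%:R * ('X * 'X * 'X) - 1 by rewrite /rE p1 q0 q1 p0 polyC_natr; ring.
  have SE : sextic lam N0 N0' = 3%:R%:P * 'X^6 + 1.
    by rewrite /sextic AE BE EE polyC_natr; ring.
  have n3 : (3%:R : C) != 0 by rewrite pnatr_eq0.
  have sS : size (sextic lam N0 N0') = 7%N.
    by rewrite SE size_polyDl ?size_poly1// mul_polyC size_scale// size_polyXn.
  apply: mulf_neq0.
    by rewrite SE coefD coefCM coefXn coef1 /= mulr1 addr0.
  apply: syl_coprime => //; first exact: size_companion.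
  apply/Pdiv.ClosedField.coprimepP => x /rootP.
  rewrite SE hornerD hornerCM hornerXn -polyC1 hornerC => hx.
  have x0 : x != 0 by apply/eqP => x0; move/eqP: hx; rewrite x0 expr0n /= mulr0 add0r oner_eq0.
  have dE : deriv (3%:R%:P * 'X^6 + 1 : {poly C}) = 18%:R%:P * 'X^5.
    rewrite derivD derivM derivC mul0r add0r derivXn -polyC1 derivC addr0 /= -mulrnAr.
    by rewrite polyC_natr; ring.
  have v1 : (18%:R%:P * 'X^5 : {poly C}).[x] = 18%:R * x ^+ 5 by rewrite hornerCM hornerXn.
  have v2 : (2%:R * 'X : {poly C}).[x] = 2%:R * x by rewrite -polyC_natr hornerCM hornerX.
  have v3 : (1 - 'X * 'X * 'X : {poly C}).[x] = 1 - x * x * x.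
    by rewrite hornerD hornerN -polyC1 hornerC !hornerMX hornerX.
  rewrite /companion SE dE AE BE hornerM v1 hornerM v2 hornerM v3 hornerX.
  have n18 : (18%:R : C) != 0 by rewrite pnatr_eq0.
  have n2 : (2%:R : C) != 0 by rewrite pnatr_eq0.
  apply: mulf_neq0; first by rewrite mulf_neq0// expf_neq0.
  apply: mulf_neq0; first by rewrite mulf_neq0.
  apply: mulf_neq0 => //; apply/eqP => x3.
  have : 4%:R = 0 :> C.
    have xxx : x * x * x = 1 by apply/eqP; rewrite eq_sym -subr_eq0 x3.
    rewrite -hx (_ : x ^+ 6 = (x * x * x) * (x * x * x)); last by ring.
    by rewrite xxx; ring.
  by move/eqP; rewrite pnatr_eq0.
apply: genl_imply (genl_keep (genl_sepoly hD _ Dt)) => [e' [De' keep]|k]; last first.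
  by rewrite mem_block !inE negb_or /t => /andP[/negbTE -> /negbTE ->].
have M01 k : k \in [:: 0; 1] -> Mof (cenv e') k = Mof (cenv e) k.
  move=> k01; apply/matrixP => i j; rewrite !mxE /cenv keep// mem_block /=.
  by move: k01; rewrite !inE => /orP[] /eqP ->.
apply: (sixpts_normal uP uQ il) De'; rewrite M01//.
Qed.

End generic_six_points.

(** * Real lines give real rank-one matrices *)

Section configurations.
Variable F : fieldType.
Implicit Types (M : 'I_4 -> 'M[F]_3) (N : 'M[F]_3) (u v w : 'rV[F]_3).

Definition dot3 u v : F := (u *m v^T) 0 0.

Lemma dot3E u v : dot3 u v = u 0 0 * v 0 0 + u 0 1 * v 0 1 + u 0 2%:R * v 0 2%:R.
Proof. by rewrite /dot3 mxE sum3E !mxE. Qed.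

Lemma dot3C u v : dot3 u v = dot3 v u.
Proof. by rewrite !dot3E; ring. Qed.

Lemma blf_rank1 (x : 'cV[F]_3) (y : 'rV[F]_3) N : blf (x *m y) (x *m y) N = 0.
Proof. by rewrite blfE !mxE !big_ord1; ring. Qed.

Lemma mxvec_dot N N' : (mxvec N *m (mxvec N')^T) 0 0 = \sum_i \sum_j N i j * N' i j.
Proof.
rewrite mxE pair_bigA /= (reindex _ (curry_mxvec_bij 3 3)).
by apply: eq_bigr => -[i j] _ /=; rewrite mxE !mxvecE.
Qed.

Lemma rank1_dot a b N : (rank1 a b *m (mxvec N)^T) 0 0 = (a *m N *m b^T) 0 0.
Proof. by rewrite mxvec_dot mul_row_mx_col sum3E !sum3E !mxE !big_ord1 !mxE; ring. Qed.

Lemma rank1_rank1 a b w c : (rank1 a b *m (rank1 w c)^T) 0 0 = dot3 a w * dot3 b c.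
Proof. by rewrite mxvec_dot !dot3E sum3E !sum3E !mxE !big_ord1 !mxE; ring. Qed.

Lemma orth2 u v : exists2 w, w != 0 & dot3 u w = 0 /\ dot3 v w = 0.
Proof.
pose A : 'M[F]_(3, 1 + 1) := row_mx u^T v^T.
have : kermx A != 0.
  rewrite -mxrank_eq0 mxrank_ker; have := rank_leq_col A; lia.
case/rowV0Pn => w /sub_kermxP; rewrite mul_mx_row => /eqP; rewrite -row_mx0 => /eqP /eq_row_mx[h1 h2] w0.
by exists w => //; rewrite ![dot3 _ w]dot3C /dot3 h1 h2 mxE.
Qed.

Definition Wmx M : 'M[F]_(4, 3 * 3) := \matrix_k mxvec (M k).

Lemma mul_Wmx M z : z *m Wmx M = mxvec (lc M z).
Proof.
rewrite mulmx_sum_row /lc linear_sum; apply: eq_bigr => k _.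
by rewrite rowK linearZ.
Qed.

Lemma smooth_free M : smooth M -> row_free (Wmx M).
Proof.
move=> sm; rewrite -kermx_eq0; apply/rowV0P => z /sub_kermxP; rewrite mul_Wmx => h.
apply/eqP/negPn/negP => /sm[j]; have -> : lc M z = 0 by apply: (can_inj mxvecK); rewrite h linear0.
by rewrite blfE !mxE !mul0r !subrr !mul0r !addr0 eqxx.
Qed.

(** The adjugate of a matrix of rank at most one is zero, so all partial derivatives of the
    determinant vanish there. *)
Lemma smooth_rank1 M z (x : 'cV[F]_3) (y : 'rV[F]_3) : smooth M -> z != 0 -> lc M z = x *m y -> False.
Proof. by move=> sm /sm[j] + zE; rewrite zE blf_rank1 eqxx. Qed.

Definition perp M : 'M[F]_(3 * 3) := kermx (Wmx M)^T.

Lemma rank_perp M : row_free (Wmx M) -> \rank (perp M) = 5%N.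
Proof. by move=> rf; rewrite mxrank_ker mxrank_tr (eqP rf). Qed.

Lemma perp_perp M m (V : 'M[F]_(m, 3 * 3)) N : row_free (Wmx M) -> (perp M <= V)%MS ->
  V *m (mxvec N)^T = 0 -> exists z, N = lc M z.
Proof.
move=> rf pV VN.
have WV : (Wmx M :=: kermx (perp M)^T)%MS.
  apply/eqmxP.
  have sub : (Wmx M <= kermx (perp M)^T)%MS.
    by apply/sub_kermxP; rewrite -[Wmx M]trmxK -trmx_mul mulmx_ker trmx0.
  by rewrite -(mxrank_leqif_eq sub).2 (eqP rf) mxrank_ker mxrank_tr (rank_perp rf).
have : (mxvec N <= Wmx M)%MS.
  rewrite WV; apply/sub_kermxP; have /submxP[D ->] := pV.
  by rewrite trmx_mul mulmxA -[mxvec N]trmxK -(trmx_mul V) VN trmx0 mul0mx.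
case/submxP => z zE; exists z; apply: (can_inj mxvecK).
by rewrite zE mul_Wmx.
Qed.

Lemma mulmx_rank1_Wmx M a b k : (rank1 a b *m (Wmx M)^T) 0 k = (a *m M k *m b^T) 0 0.
Proof.
rewrite -rank1_dot !mxE; apply: eq_bigr => c _; congr (_ * _).
by rewrite !mxE.
Qed.

Lemma rank1_perp M a b : (forall k, a *m M k *m b^T = 0) -> (rank1 a b <= perp M)%MS.
Proof.
by move=> h; apply/sub_kermxP; apply/rowP => k; rewrite mulmx_rank1_Wmx h !mxE.
Qed.

Definition Vmx (a b : 'I_5 -> 'rV[F]_3) : 'M[F]_(5, 3 * 3) := \matrix_k rank1 (a k) (b k).

Lemma dot3_neq0 u v : npar u v -> exists2 w, dot3 u w = 0 & dot3 v w != 0.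
Proof.
move=> uv; apply: contrapT => H.
have {}H w : dot3 u w = 0 -> dot3 v w = 0.
  by move=> h; apply/eqP/negPn/negP => h'; apply: H; exists w.
pose u0 := u 0 0; pose u1 := u 0 1; pose u2 := u 0 2%:R.
pose v0 := v 0 0; pose v1 := v 0 1; pose v2 := v 0 2%:R.
pose vec (x y z : F) : 'rV[F]_3 := \row_i (if i == 0 then x else if i == 1 then y else z).
(* These test vectors are orthogonal to [u]; together they say that the cross product of [u] and [v]
   is zero. *)
have e1 := H (vec u1 (- u0) 0); have e2 := H (vec u2 0 (- u0)); have e3 := H (vec 0 u2 (- u1)).
rewrite !dot3E !mxE /= -/u0 -/u1 -/u2 -/v0 -/v1 -/v2 in e1 e2 e3.
have {}e1 : v0 * u1 = v1 * u0.
  apply/eqP; rewrite -subr_eq0 -mulrN; apply/eqP; rewrite -[RHS]e1; ring.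
have {}e2 : v0 * u2 = v2 * u0.
  apply/eqP; rewrite -subr_eq0 -mulrN; apply/eqP; rewrite -[RHS]e2; ring.
have {}e3 : v1 * u2 = v2 * u1.
  apply/eqP; rewrite -subr_eq0 -mulrN; apply/eqP; rewrite -[RHS]e3; ring.
have par c d : c * u0 + d * v0 = 0 -> c * u1 + d * v1 = 0 -> c * u2 + d * v2 = 0 -> c = 0 /\ d = 0.
  move=> h0 h1 h2; apply: uv; apply/rowP => k; rewrite !mxE.
  by have [->|->|->] : [\/ k = 0, k = 1 | k = 2%:R] by
    case: k => [[|[|[|//]]] ?]; [constructor 1|constructor 2|constructor 3]; exact: val_inj.
have [z0 _] : v0 = 0 /\ - u0 = 0 by apply: par; rewrite ?e1 ?e2; ring.
have [z1 _] : v1 = 0 /\ - u1 = 0 by apply: par; rewrite -?e1 ?e3; ring.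
have [z2 _] : v2 = 0 /\ - u2 = 0 by apply: par; rewrite -?e2 -?e3; ring.
have [_ /eqP] : 0 = 0 :> F /\ (1 : F) = 0 by apply: par; rewrite ?z0 ?z1 ?z2 mul0r mulr0 addr0.
by rewrite oner_eq0.
Qed.

Lemma comb_rank1 n (c : 'rV[F]_n) (a b : 'I_n -> 'rV[F]_3) u w :
  (c *m (\matrix_p rank1 (a p) (b p)) *m (rank1 u w)^T) 0 0 = \sum_p c 0 p * (dot3 (a p) u * dot3 (b p) w).
Proof.
rewrite [c *m _]mulmx_sum_row mulmx_suml summxE; apply: eq_bigr => p _.
by rewrite rowK -scalemxAl [LHS]mxE rank1_rank1.
Qed.

Lemma rank1_neq0 w (c : 'rV[F]_3) : w != 0 -> c != 0 -> w^T *m c != 0.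
Proof.
case/rV0Pn => p wp /rV0Pn[q cq]; apply/eqP => /matrixP /(_ p q).
by rewrite !mxE big_ord1 !mxE => /eqP; rewrite mulf_eq0 (negbTE wp) (negbTE cq).
Qed.

(* Three points of the configuration are never collinear: otherwise a line
   through them would give a matrix of rank one in the span of the M k. *)
Lemma noncollinear M (a b : 'I_3 -> 'rV[F]_3) w : smooth M ->
  (forall p k, a p *m M k *m (b p)^T = 0) ->
  (forall p q, p != q -> npar (a p) (a q) /\ npar (b p) (b q)) ->
  w != 0 -> exists p, dot3 (a p) w != 0.
Proof.
move=> sm H np w0; apply: contrapT => aw.
have {}aw p : dot3 (a p) w = 0 by apply/eqP/negPn/negP => h; apply: aw; exists p.
have rf := smooth_free sm.
pose B := row_base (perp M); pose V : 'M[F]_(3, 3 * 3) := \matrix_p rank1 (a p) (b p).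
have VB : (V <= B)%MS.
  apply/row_subP => p; rewrite rowK eq_row_base; apply: rank1_perp => k; exact: H.
have [D DE] := submxP VB.
have rV : row_free V.
  rewrite -kermx_eq0; apply/rowV0P => c /sub_kermxP cV.
  (* The coefficient of [p] is isolated by pairing with [rank1 u v], where [u] kills [a q] and [v]
     kills [b r]. *)
  have key (p q r : 'I_3) : q != p -> r != p -> (forall s, s != p -> s != q -> s = r) -> c 0 p = 0.
    move=> qp rp other.
    have [u u1 u2] := dot3_neq0 (np _ _ qp).1; have [v v1 v2] := dot3_neq0 (np _ _ rp).2.
    have := comb_rank1 c a b u v; rewrite cV mul0mx mxE (bigD1 p)//= big1 ?addr0.
      by move=> /esym/eqP; rewrite !mulf_eq0 (negbTE u2) (negbTE v2) !orbF => /eqP.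
    move=> s sp; have [->|sq] := eqVneq s q; first by rewrite u1 mul0r mulr0.
    by rewrite (other s sp sq) v1 !mulr0.
  apply/rowP => p; rewrite [RHS]mxE.
  have [->|->|->] : [\/ p = 0, p = 1 | p = 2%:R].
    by case: p => [[|[|[|//]]] ?]; [constructor 1|constructor 2|constructor 3]; exact: val_inj.
  - by apply: (key 0 1 2%:R) => // -[[|[|[|//]]] ?] // _ _; exact: val_inj.
  - by apply: (key 1 0 2%:R) => // -[[|[|[|//]]] ?] // _ _; exact: val_inj.
  - by apply: (key 2%:R 0 1) => // -[[|[|[|//]]] ?] // _ _; exact: val_inj.
(* [L] records the pairings of [rank1 w c] with a basis of the five-dimensional [perp M]. Its image
   is orthogonal to the three free rows of [D], so its rank is at most 2 and it kills some nonzero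
   [c]. *)
pose L := lin1_mx (mulmxr B^T \o (mxvec \o mulmx w^T)) : 'M[F]_(3, _).
have LE c : c *m L = rank1 w c *m B^T by rewrite mul_rV_lin1.
have LD : L *m D^T = 0.
  apply/row_matrixP => k; rewrite row0 rowE mulmxA LE -mulmxA -trmx_mul -DE.
  apply/rowP => p; rewrite [RHS]mxE.
  transitivity ((rank1 w (delta_mx 0 k) *m (rank1 (a p) (b p))^T) 0 0).
    by rewrite !mxE; apply: eq_bigr => c _; congr (_ * _); rewrite !mxE.
  by rewrite rank1_rank1 dot3C aw mul0r.
have rD : (3 <= \rank D)%N by have := mxrankM_maxl D B; rewrite -DE (eqP rV).
have rLD : (\rank L + \rank D <= 5)%N.
  by rewrite -(mxrank_tr D); apply: leq_trans (mulmx0_rank_max LD) _; rewrite leq_eqVlt; apply/orP; left; apply/eqP/rank_perp.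
have : kermx L != 0 by rewrite -mxrank_eq0 mxrank_ker; lia.
case/rowV0Pn => c /sub_kermxP; rewrite LE => wcB c0.
have [] := @perp_perp M _ B (w^T *m c) rf.
- by rewrite eq_row_base.
- by apply: trmx_inj; rewrite trmx_mul trmxK trmx0.
move=> z zE; apply: (smooth_rank1 sm _ (esym zE)).
apply: contraNneq (rank1_neq0 w0 c0) => z0; rewrite zE z0 /lc big1// => k _.
by rewrite mxE scale0r.
Qed.

Lemma lc_tr M z : lc (fun k => (M k)^T) z = (lc M z)^T.
Proof. by rewrite /lc linear_sum; apply: eq_bigr => k _; rewrite linearZ. Qed.

Lemma smooth_tr M : smooth M -> smooth (fun k => (M k)^T).
Proof.
move=> sm z z0; have [j Hj] := sm z z0; exists j; rewrite lc_tr.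
by move: Hj; rewrite !blfE !mxE => h; apply: contra h => /eqP h; apply/eqP; rewrite -[RHS]h; ring.
Qed.

Lemma noncollinear_tr M (a b : 'I_3 -> 'rV[F]_3) w : smooth M ->
  (forall p k, a p *m M k *m (b p)^T = 0) ->
  (forall p q, p != q -> npar (a p) (a q) /\ npar (b p) (b q)) ->
  w != 0 -> exists p, dot3 (b p) w != 0.
Proof.
move=> sm H np w0; apply: (@noncollinear (fun k => (M k)^T) b a) => //.
- exact: smooth_tr.
- by move=> p k; apply: trmx_inj; rewrite trmx0 !trmx_mul !trmxK mulmxA H.
- by move=> p q pq; have [] := np _ _ pq.
Qed.

(** The coefficient of [m] is isolated by a [u] orthogonal to two of the other [a] and a [v]
    orthogonal to the remaining two [b]; noncollinearity keeps the pairing with the matrix of index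
    [m] nonzero. *)
Lemma five_free (a b : 'I_5 -> 'rV[F]_3) :
  (forall (f : 'I_3 -> 'I_5) w, injective f -> w != 0 ->
    (exists p, dot3 (a (f p)) w != 0) /\ (exists p, dot3 (b (f p)) w != 0)) ->
  row_free (Vmx a b).
Proof.
move=> gp; rewrite -kermx_eq0; apply/rowV0P => c /sub_kermxP cV; apply/rowP => m; rewrite [RHS]mxE.
have [u u0 [u1 u2]] := orth2 (a (m + 1)) (a (m + 2%:R)).
have [v v0 [v1 v2]] := orth2 (b (m + 3%:R)) (b (m + 4%:R)).
pose f3 (x y z : 'I_5) (p : 'I_3) := if p == 0 then x else if p == 1 then y else z.
have f3P (G : 'I_5 -> bool) x y z : (exists p, G (f3 x y z p)) -> ~~ G y -> ~~ G z -> G x.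
  by move=> [p]; rewrite /f3; case: ifP => // _; case: ifP => _ ->.
have f3inj x y z : x != y -> x != z -> y != z -> injective (f3 x y z).
  by move=> xy xz yz [[|[|[|//]]] ?] [[|[|[|//]]] ?]; rewrite /f3 /= => /eqP;
    rewrite ?(negbTE xy) ?(negbTE xz) ?(negbTE yz) 1?eq_sym ?(negbTE xy) ?(negbTE xz) ?(negbTE yz) // => _; exact: val_inj.
have ne (x y : 'I_5) : x != y -> m + x != m + y by apply: contra => /eqP /addrI ->.
have au : dot3 (a m) u != 0.
  have inj : injective (f3 (m + 0) (m + 1) (m + 2%:R)) by apply: f3inj; apply: ne.
  have := f3P (fun k => dot3 (a k) u != 0) _ _ _ (gp _ _ inj u0).1.
  by rewrite addr0 u1 u2 eqxx; apply.
have bv : dot3 (b m) v != 0.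
  have inj : injective (f3 (m + 0) (m + 3%:R) (m + 4%:R)) by apply: f3inj; apply: ne.
  have := f3P (fun k => dot3 (b k) v != 0) _ _ _ (gp _ _ inj v0).2.
  by rewrite addr0 v1 v2 eqxx; apply.
have := comb_rank1 c a b u v; rewrite cV mul0mx mxE (bigD1 m)//= big1 ?addr0.
  by move=> /esym/eqP; rewrite !mulf_eq0 (negbTE au) (negbTE bv) !orbF => /eqP.
move=> s sm; have [d dE] : exists d, s = m + d by exists (s - m); rewrite addrC subrK.
have d0 : d != 0 by apply: contra sm => /eqP d0; rewrite dE d0 addr0.
have [dd|dd|dd|dd] : [\/ d = 1, d = 2%:R, d = 3%:R | d = 4%:R].
- by case: d d0 {dE} => [[|[|[|[|[|//]]]]] ?] // _; [constructor 1|constructor 2|constructor 3|constructor 4]; exact: val_inj.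
- by rewrite dE dd u1 mul0r mulr0.
- by rewrite dE dd u2 mul0r mulr0.
- by rewrite dE dd v1 !mulr0.
- by rewrite dE dd v2 !mulr0.
Qed.

End configurations.

Lemma npar_row_free (F : fieldType) n (u v : 'rV[F]_n) : npar u v -> row_free (col_mx u v).
Proof.
move=> uv; rewrite -kermx_eq0; apply/rowV0P => c /sub_kermxP.
rewrite -[c]hsubmxK mul_row_col => h.
have sc (x : 'M[F]_1) : x = (x 0 0)%:M by exact: mx11_scalar.
move: h; rewrite (sc (lsubmx c)) (sc (rsubmx c)) !mul_scalar_mx => /uv[-> ->].
by rewrite !raddf0 row_mx0.
Qed.

Lemma npar_neq0 (F : fieldType) n (u v : 'rV[F]_n) : npar u v -> u != 0 /\ v != 0.
Proof.
move=> uv; split; apply/eqP => e.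
  have [/eqP] : (1 : F) = 0 /\ (0 : F) = 0 by apply: uv; rewrite e scaler0 scale0r addr0.
  by rewrite oner_eq0.
have [_ /eqP] : (0 : F) = 0 /\ (1 : F) = 0 by apply: uv; rewrite e scaler0 scale0r addr0.
by rewrite oner_eq0.
Qed.

Lemma rank_le1 (F : fieldType) m n (A : 'M[F]_(m, n)) : (\rank A <= 1)%N ->
  exists (x : 'cV[F]_m) (y : 'rV[F]_n), A = x *m y.
Proof.
move=> rA.
exists (col_ebase A *m (pid_mx (\rank A) : 'M[F]_(m, 1))), ((pid_mx (\rank A) : 'M[F]_(1, n)) *m row_ebase A).
rewrite mulmxA -(mulmxA (col_ebase A)) mul_pid_mx minnn (minn_idPr rA).
by rewrite mulmx_ebase.
Qed.

(** * Real points from real lines *)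

Section real_points.
Variable R : realType.
Local Notation C := R[i].
Implicit Types (M : 'I_4 -> 'M[R]_3).

Definition cM M : 'I_4 -> 'M[C]_3 := fun k => cplx_mx (M k).

Lemma lc_cM M (r : 'rV[R]_4) : lc (cM M) (cplx_mx r) = cplx_mx (lc M r).
Proof.
rewrite /lc /cplx_mx raddf_sum; apply: eq_bigr => k _.
by rewrite /= map_mxZ mxE.
Qed.

Lemma blf_cplx (A A' B : 'M[R]_3) : blf (cplx_mx A) (cplx_mx A') (cplx_mx B) = (blf A A' B)%:C%C.
Proof.
rewrite /blf rmorph_sum; apply: eq_bigr => p _; rewrite rmorph_sum; apply: eq_bigr => q _.
by rewrite !mxE !(rmorphM, rmorphB).
Qed.

Lemma cplx_mx_eq0 m n (A : 'M[R]_(m, n)) : (cplx_mx A == 0) = (A == 0).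
Proof. by rewrite /cplx_mx map_mx_eq0. Qed.

Lemma smooth_real M : smooth (cM M) -> smooth M.
Proof.
move=> sm r r0; have [|j] := sm (cplx_mx r); first by rewrite cplx_mx_eq0.
rewrite lc_cM blf_cplx => h; exists j; apply: contraNneq h => ->; by rewrite rmorph0.
Qed.

Lemma all_lines_real_tr M : all_lines_real M -> all_lines_real (fun k => (M k)^T).
Proof.
move=> al p q [rpq H]; apply: al; split => // s t; rewrite -[RHS](H s t).
rewrite /cubic_form -[in RHS]det_tr linear_sum; congr (\det _).
by apply: eq_bigr => k _; rewrite linearZ /= /cplx_mx map_trmx trmxK.
Qed.

Lemma complex_split n (b : 'rV[C]_n) : exists b1 b2 : 'rV[R]_n, b = cplx_mx b1 + 'i%C *: cplx_mx b2.
Proof.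
exists (\row_k complex.Re (b 0 k)), (\row_k complex.Im (b 0 k)); apply/rowP => k.
by rewrite !mxE; exact: complexE.
Qed.

Lemma complex_dir n (b1 b2 : 'rV[R]_n) : ~ npar b1 b2 ->
  exists (beta : C) (b0 : 'rV[R]_n), cplx_mx b1 + 'i%C *: cplx_mx b2 = beta *: cplx_mx b0.
Proof.
move=> np; have [c [d [e cd]]] : exists c d, c *: b1 + d *: b2 = 0 /\ ((c != 0) || (d != 0)).
  apply: contrapT => H; apply: np => c d e.
  have [h|] := boolP ((c != 0) || (d != 0)); first by case: H; exists c, d.
  by rewrite negb_or !negbK => /andP[/eqP ? /eqP ?].
have [c0|c0] := eqVneq c 0.
  move: e cd; rewrite c0 scale0r add0r eqxx /= => /eqP e d0; exists 1, b1.
  by move: e; rewrite scaler_eq0 (negbTE d0) /= => /eqP ->; rewrite /cplx_mx map_mx0 scaler0 addr0 scale1r.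
exists ('i%C - (d / c)%:C%C), b2.
have -> : b1 = - (d / c) *: b2.
  apply: (scalerI c0); rewrite scalerA mulrN mulrCA divff// mulr1 scaleNr.
  by apply/eqP; rewrite -addr_eq0 e.
by rewrite /cplx_mx map_mxZ -scalerDl addrC rmorphN.
Qed.

(** Two independent vectors of the kernel of [G] span a line on the surface, which is real by
    hypothesis; one of the two real vectors that span it is nonzero. *)
Lemma real_kernel_line M (G : 'M[C]_(4, 3)) : all_lines_real M -> (\rank G <= 2)%N ->
  (forall z, z *m G = 0 -> \det (lc (cM M) z) = 0) -> exists2 r : 'rV[R]_4, r != 0 & cplx_mx r *m G = 0.
Proof.
move=> al rG H.
have rK : (2 <= \rank (kermx G))%N by rewrite mxrank_ker; lia.
pose P : 'M[C]_(1 + 1, 4) := (pid_mx 2 : 'M[C]_(1 + 1, \rank (kermx G))) *m row_base (kermx G).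
have PG : P *m G = 0.
  by apply/sub_kermxP; apply: submx_trans (submxMl _ _) _; rewrite eq_row_base.
have rP : \rank P = 2%N.
  by rewrite mxrankMfree ?row_base_free// rank_pid_mx.
have [] := al (usubmx P) (dsubmx P).
  split; first by rewrite vsubmxK.
  move=> s t; apply: (H (s *: usubmx P + t *: dsubmx P)); have := PG; rewrite -{1}[P]vsubmxK mul_col_mx -col_mx0 => /eqP.
  rewrite mulmxDl -!scalemxAl => /eqP/eq_col_mx[-> ->].
  by rewrite !scaler0 addr0.
move=> u [v]; rewrite vsubmxK => uv.
have kill (r : 'rV[R]_4) : (cplx_mx r <= col_mx (cplx_mx u) (cplx_mx v))%MS -> cplx_mx r *m G = 0.
  by rewrite -(eqmxP uv) => /submxP[D ->]; rewrite -mulmxA PG mulmx0.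
have [u0|u0] := eqVneq u 0; last first.
  by exists u => //; apply: kill; rewrite -addsmxE addsmxSl.
exists v; last by apply: kill; rewrite -addsmxE addsmxSr.
apply/eqP => v0; have := (eqmxP uv).1.
rewrite rP u0 v0 /cplx_mx !map_mx0 col_mx0 mxrank0 => h; discriminate h.
Qed.

(* The points z with lc M z *m b^T = 0 form a line on the surface; a real point
   of it maps both Re b and Im b to zero. *)
Lemma real_point M (a b : 'rV[C]_3) : smooth M -> all_lines_real M -> a != 0 -> b != 0 ->
  (forall k, a *m cM M k *m b^T = 0) -> exists (beta : C) (b0 : 'rV[R]_3), b = beta *: cplx_mx b0.
Proof.
move=> sm al a0 b0 H.
pose G : 'M[C]_(4, 3) := \matrix_k (cM M k *m b^T)^T.
have GE z : z *m G = (lc (cM M) z *m b^T)^T.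
  rewrite mulmx_sum_row /lc mulmx_suml linear_sum; apply: eq_bigr => k _.
  by rewrite rowK -scalemxAl linearZ.
have Ga : G *m a^T = 0.
  by apply/row_matrixP => k; rewrite row_mul rowK -trmx_mul mulmxA H trmx0 row0.
have rG : (\rank G <= 2)%N.
  have := mulmx0_rank_max Ga; rewrite mxrank_tr.
  have : (0 < \rank a)%N by rewrite lt0n mxrank_eq0.
  lia.
have [|r r0] := @real_kernel_line M G al rG.
  move=> z; rewrite GE => /(congr1 trmx); rewrite trmxK trmx0 => e.
  apply/eqP; rewrite -det_tr; apply/det0P; exists b => //.
  by apply: trmx_inj; rewrite trmx_mul trmxK trmx0.
rewrite GE => /(congr1 trmx); rewrite trmxK trmx0 lc_cM.
have [b1 [b2 bE]] := complex_split b => e.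
have [np|np] := pselect (npar b1 b2); last by have := complex_dir np; rewrite -bE.
(* A real matrix that kills two independent vectors has rank at most one, which smoothness
   excludes. *)
exfalso.
have sp1 : lc M r *m b1^T = 0 /\ lc M r *m b2^T = 0.
  move: e; rewrite bE linearD linearZ /= mulmxDr -scalemxAr /cplx_mx !map_trmx -!map_mxM => e.
  have ri (x y : R) : x%:C%C + 'i%C * y%:C%C = 0 -> x = 0 /\ y = 0.
    by simpc => /eqP; rewrite eq_complex => /andP[/eqP/= -> /eqP/= ->].
  have ez p : (lc M r *m b1^T) p 0 = 0 /\ (lc M r *m b2^T) p 0 = 0.
    by apply: ri; have /colP/(_ p) := e; set x := lc M r *m b1^T; set y := lc M r *m b2^T; rewrite mxE; rewrite [X in X + _]mxE [X in _ + X]mxE [X in _ * X]mxE [RHS]mxE.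
  by split; apply/colP => p; rewrite [RHS]mxE; have [] := ez p.
have [x [y xy]] : exists (x : 'cV[R]_3) (y : 'rV[R]_3), lc M r = x *m y.
  apply: rank_le1; have := npar_row_free np; rewrite /row_free => /eqP rb.
  have : lc M r *m (col_mx b1 b2)^T = 0 by rewrite tr_col_mx mul_mx_row sp1.1 sp1.2 row_mx0.
  by move/mulmx0_rank_max; rewrite mxrank_tr rb => h; rewrite -(leq_add2r 2).
exact: smooth_rank1 sm r0 xy.
Qed.

Lemma npar_real n (u v : 'rV[R]_n) (x y : C) : npar (x *: cplx_mx u) (y *: cplx_mx v) -> npar u v.
Proof.
move=> np c d e; have [] := npar_neq0 np; rewrite !scaler_eq0 !negb_or => /andP[x0 _] /andP[y0 _].
have [] : c%:C%C / x = 0 /\ d%:C%C / y = 0.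
  apply: np; rewrite !scalerA !divfK// /cplx_mx -!map_mxZ -map_mxD e map_mx0 //.
move=> /eqP + /eqP; rewrite !mulf_eq0 !invr_eq0 (negbTE x0) (negbTE y0) !orbF.
by move=> /eqP h1 /eqP h2; split; apply: complexI; rewrite ?h1 ?h2 rmorph0.
Qed.

Lemma lines_real_covered5 M : smooth M -> sixpts (cM M) -> all_lines_real M -> covered5 (perp M).
Proof.
move=> sm [a [b [H np]]] al.
have n0 p : a p != 0 /\ b p != 0.
  have [q qp] : exists q : 'I_6, p != q.
    by have [->|h] := eqVneq p 0; [exists 1|exists 0].
  by have [/npar_neq0[? _] /npar_neq0[? _]] := np p q qp.
have rb p : exists u : C * 'rV[R]_3, b p = u.1 *: cplx_mx u.2.
  have [u [v ->]] := real_point sm al (n0 p).1 (n0 p).2 (H p); by exists (u, v).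
have ra p : exists u : C * 'rV[R]_3, a p = u.1 *: cplx_mx u.2.
  have [|u [v ->]] := real_point (smooth_tr sm) (all_lines_real_tr al) (n0 p).2 (n0 p).1.
    move=> k; apply: trmx_inj; rewrite trmx0 !trmx_mul !trmxK mulmxA.
    rewrite -[RHS](H p k) /cM /cplx_mx map_trmx trmxK //.
  by exists (u, v).
have [fa faE] := choice ra; have [fb fbE] := choice rb.
pose w (k : 'I_5) : 'I_6 := widen_ord (leqnSn 5) k.
pose a0 k := (fa (w k)).2; pose b0 k := (fb (w k)).2.
have np0 k l : k != l -> npar (a0 k) (a0 l) /\ npar (b0 k) (b0 l).
  move=> kl; have [|h1 h2] := np (w k) (w l); first by apply: contra kl => /eqP/(congr1 val) h; apply/eqP/val_inj.
  by move: h1 h2; rewrite !faE !fbE => /npar_real ? /npar_real.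
have H0 k l : a0 k *m M l *m (b0 k)^T = 0.
  have [h1 h2] := n0 (w k); move: (H (w k) l) h1 h2; rewrite faE fbE !scaler_eq0 !negb_or.
  rewrite linearZ /= -!scalemxAl -scalemxAr => /eqP + /andP[x0 _] /andP[y0 _].
  rewrite !scaler_eq0 (negbTE x0) (negbTE y0) /= /cM /cplx_mx map_trmx -!map_mxM.
  by rewrite map_mx_eq0 => /eqP.
have rf : row_free (Vmx a0 b0).
  apply: five_free => f v finj v0.
  have np' p q : p != q -> npar (a0 (f p)) (a0 (f q)) /\ npar (b0 (f p)) (b0 (f q)).
    by move=> pq; apply: np0; rewrite inj_eq.
  by split; [apply: (noncollinear sm _ np' v0)|apply: (noncollinear_tr sm _ np' v0)] => p k; apply: H0.
have sub : (Vmx a0 b0 <= perp M)%MS.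
  by apply/row_subP => k; rewrite rowK; apply: rank1_perp => l; exact: H0.
exists a0, b0.
have := mxrank_leqif_sup sub => -[_]; rewrite (eqP rf) (rank_perp (smooth_free sm)) eqxx.
by move/esym.
Qed.

End real_points.

(** * Real rank-one matrices give real lines *)

Lemma prod3E (F : fieldType) (f : 'I_3 -> F) j : \prod_i f i = f j * f (j + 1) * f (j + 2%:R).
Proof.
rewrite !big_ord_recl big_ord0 mulr1 mulrA.
case: j => [[|[|[|//]]] ?].
- by congr (f _ * f _ * f _); exact: val_inj.
- rewrite [RHS]mulrC mulrA; congr (f _ * f _ * f _); exact: val_inj.
- rewrite -[RHS]mulrA [RHS]mulrC; congr (f _ * f _ * f _); exact: val_inj.
Qed.

(** * Equality of products of binary linear forms *)

Section binary_forms.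
Variable F : numFieldType.
Implicit Types (u v : F * F) (s t : F) (x y : 'I_3 -> F * F).

Definition lf u s t := s * u.1 + t * u.2.

Lemma lf_prop u v : v != (0, 0) -> u.2 * v.1 = u.1 * v.2 -> exists c, u = (c * v.1, c * v.2).
Proof.
case: u v => [u1 u2] [v1 v2] /=; rewrite xpair_eqE negb_and => h e.
have [v10|v10] := eqVneq v1 0.
  move: h e; rewrite v10 eqxx mulr0 /= => v20 /esym/eqP; rewrite mulf_eq0 (negbTE v20) orbF => /eqP ->.
  by exists (u2 / v2); rewrite mulr0 divfK.
by exists (u1 / v1); rewrite divfK// mulrAC -e mulfK.
Qed.

Lemma lf_mul_eq0 u v : (forall s t, lf u s t * lf v s t = 0) -> u = (0, 0) \/ v = (0, 0).
Proof.
case: u v => [u1 u2] [v1 v2] H.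
have := H 1 0; have := H 0 1; have := H 1 1; rewrite /lf /= !mul1r !mul0r !addr0 !add0r.
move=> h3 /eqP; rewrite mulf_eq0 => /orP[]/eqP h2 /eqP; rewrite mulf_eq0 => /orP[]/eqP h1;
  rewrite h1 h2 ?addr0 ?add0r in h3 *.
- by left.
- by move/eqP: h3; rewrite mulf_eq0 => /orP[]/eqP ->; [left|right].
- by move/eqP: h3; rewrite mulf_eq0 => /orP[]/eqP ->; [left|right].
- by right.
Qed.

(** Cancellation of a linear factor, with the quadratic given by its coefficients. A binary cubic is
    determined by its values at [(1, 0)], [(0, 1)], [(1, 1)] and [(1, -1)] once 2 is invertible. *)
Lemma lf_mul_quad u a b c : u != (0, 0) ->
  (forall s t, lf u s t * (s ^+ 2 * a + s * t * b + t ^+ 2 * c) = 0) -> [/\ a = 0, b = 0 & c = 0].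
Proof.
case: u => [u1 u2]; rewrite xpair_eqE negb_and => u0 H.
have e1 : u1 * a = 0 by rewrite -[RHS](H 1 0) /lf /=; ring.
have e2 : u2 * c = 0 by rewrite -[RHS](H 0 1) /lf /=; ring.
have h1 : (u1 + u2) * (a + b + c) = 0 by rewrite -[RHS](H 1 1) /lf /=; ring.
have h2 : (u1 - u2) * (a - b + c) = 0 by rewrite -[RHS](H 1 (-1)) /lf /=; ring.
have half (z : F) : 2%:R * z = 0 -> z = 0 by move=> /eqP; rewrite mulf_eq0 pnatr_eq0 => /eqP.
have e3 : u1 * b + u2 * a = 0.
  apply: half; rewrite (_ : _ * _ = (u1 + u2) * (a + b + c) - (u1 - u2) * (a - b + c) - 2%:R * (u2 * c)); last by ring.
  by rewrite h1 h2 e2 mulr0 !subr0.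
have e4 : u1 * c + u2 * b = 0.
  apply: half; rewrite (_ : _ * _ = (u1 + u2) * (a + b + c) + (u1 - u2) * (a - b + c) - 2%:R * (u1 * a)); last by ring.
  by rewrite h1 h2 e1 mulr0 !subr0 addr0.
case/orP: u0 => u0.
  have a0 : a = 0 by apply: (mulfI u0); rewrite mulr0.
  have b0 : b = 0 by apply: (mulfI u0); rewrite mulr0 -[RHS]e3 a0; ring.
  by split => //; apply: (mulfI u0); rewrite mulr0 -[RHS]e4 b0; ring.
have c0 : c = 0 by apply: (mulfI u0); rewrite mulr0.
have b0 : b = 0 by apply: (mulfI u0); rewrite mulr0 -[RHS]e4 c0; ring.
by split => //; apply: (mulfI u0); rewrite mulr0 -[RHS]e3 b0; ring.
Qed.

Lemma prod_lf_eq0 x : (forall s t, \prod_i lf (x i) s t = 0) -> exists i, x i = (0, 0).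
Proof.
move=> H; have [x0|x0] := eqVneq (x 0) (0, 0); first by exists 0.
have [|h1 h2 h3] := @lf_mul_quad (x 0) ((x 1).1 * (x 2%:R).1)
  ((x 1).1 * (x 2%:R).2 + (x 1).2 * (x 2%:R).1) ((x 1).2 * (x 2%:R).2) x0.
  by move=> s t; rewrite -[RHS](H s t) (prod3E _ 0) !add0r /lf; ring.
have [|h|h] := @lf_mul_eq0 (x 1) (x 2%:R); [|by exists 1|by exists 2%:R].
move=> s t; rewrite /lf.
transitivity (s ^+ 2 * ((x 1).1 * (x 2%:R).1) + s * t * ((x 1).1 * (x 2%:R).2 + (x 1).2 * (x 2%:R).1)
  + t ^+ 2 * ((x 1).2 * (x 2%:R).2)); first by ring.
by rewrite h1 h2 h3; ring.
Qed.

Lemma lfZ c u s t : lf (c * u.1, c * u.2) s t = c * lf u s t.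
Proof. by rewrite /lf /=; ring. Qed.

Lemma lf_root u : lf u u.2 (- u.1) = 0.
Proof. by rewrite /lf; ring. Qed.

Lemma lf_rootP u v : v != (0, 0) -> lf v u.2 (- u.1) = 0 -> exists c, u = (c * v.1, c * v.2).
Proof.
by move=> v0 h; apply: lf_prop => //; apply/eqP; rewrite -subr_eq0; apply/eqP; rewrite -[RHS]h /lf; ring.
Qed.

(** Unique factorization by hand: at the root of [x 0] some [y j] vanishes, hence is proportional to
    it; cancelling it leaves an identity between products of two forms, treated in the same way. *)
Lemma binary_cubic_matching x y :
  (forall s t, \prod_i lf (x i) s t + \prod_i lf (y i) s t = 0) ->
  (exists i j, x i = (0, 0) /\ y j = (0, 0)) \/
  exists (f : 'I_3 -> 'I_3) (c : 'I_3 -> F), injective f /\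
    (forall i, x i = (c i * (y (f i)).1, c i * (y (f i)).2)) /\ \prod_i c i = -1.
Proof.
move=> H.
have [[i xi]|nx] := pselect (exists i, x i = (0, 0)).
  left; have [|j yj] := @prod_lf_eq0 y; last by exists i, j.
  by move=> s t; rewrite -[RHS](H s t) [X in _ = X + _](bigD1 i)//= xi /lf /= !mulr0 addr0 mul0r add0r.
have [[j yj]|ny] := pselect (exists i, y i = (0, 0)).
  left; have [|i xi] := @prod_lf_eq0 x; last by exists i, j.
  by move=> s t; rewrite -[RHS](H s t) [X in _ = _ + X](bigD1 j)//= yj /lf /= !mulr0 addr0 mul0r addr0.
have {}nx i : x i != (0, 0) by apply/eqP => h; apply: nx; exists i.
have {}ny i : y i != (0, 0) by apply/eqP => h; apply: ny; exists i.
right.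
have [j [c0 h0]] : exists j c, x 0 = (c * (y j).1, c * (y j).2).
  have := H (x 0).2 (- (x 0).1); rewrite (prod3E _ 0) (lf_root (x 0)) !mul0r add0r => /eqP.
  by case/prodf_eq0 => j _ /eqP /(lf_rootP (ny j)); exists j.
pose A := x 1; pose B := x 2%:R; pose D := y (j + 1); pose E := y (j + 2%:R).
have H1 s t : c0 * (lf A s t * lf B s t) + lf D s t * lf E s t = 0.
  have [|h1 h2 h3] := @lf_mul_quad (y j) (c0 * (A.1 * B.1) + D.1 * E.1)
    (c0 * (A.1 * B.2 + A.2 * B.1) + (D.1 * E.2 + D.2 * E.1)) (c0 * (A.2 * B.2) + D.2 * E.2) (ny j).
    move=> s' t'; rewrite -[RHS](H s' t') (prod3E (fun i => lf (x i) s' t') 0) (prod3E (fun i => lf (y i) s' t') j) !add0r h0 lfZ.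
    by rewrite /A /B /D /E /lf; ring.
  transitivity (s ^+ 2 * (c0 * (A.1 * B.1) + D.1 * E.1) +
    s * t * (c0 * (A.1 * B.2 + A.2 * B.1) + (D.1 * E.2 + D.2 * E.1)) + t ^+ 2 * (c0 * (A.2 * B.2) + D.2 * E.2)).
    by rewrite /lf; ring.
  by rewrite h1 h2 h3; ring.
have c00 : c0 != 0.
  by apply: contraNneq (nx 0) => c00; rewrite h0 c00 !mul0r.
have step2 D' E' : D' != (0, 0) -> (forall s t, c0 * (lf A s t * lf B s t) + lf D' s t * lf E' s t = 0) ->
    lf D' A.2 (- A.1) = 0 -> exists c1 c2, A = (c1 * D'.1, c1 * D'.2) /\ B = (c2 * E'.1, c2 * E'.2).
  move=> D0 HDE /(lf_rootP D0)[c1 Ac]; exists c1.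
  have c10 : c1 != 0 by apply: contraNneq (nx 1) => c10; rewrite -/A Ac c10 !mul0r.
  have [|e|e] := @lf_mul_eq0 D' (c0 * c1 * B.1 + E'.1, c0 * c1 * B.2 + E'.2).
  - move=> s t; rewrite -[RHS](HDE s t) Ac lfZ /lf /=; ring.
  - by rewrite e eqxx in D0.
  exists (- (c0 * c1)^-1); split => //; have c01 : c0 * c1 != 0 by rewrite mulf_neq0.
  move: e => [/eqP + /eqP]; rewrite !addr_eq0 => /eqP e1 /eqP e2.
  rewrite [B]surjective_pairing; congr pair; apply: (mulfI c01); rewrite ?e1 ?e2 mulrA mulrN divff//; ring.
have fin k l c1 c2 : (forall i : 'I_3, [\/ i = j, i = k | i = l]) -> A = (c1 * (y k).1, c1 * (y k).2) ->
    B = (c2 * (y l).1, c2 * (y l).2) -> exists (f : 'I_3 -> 'I_3) (c : 'I_3 -> F), injective f /\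
    (forall i, x i = (c i * (y (f i)).1, c i * (y (f i)).2)) /\ \prod_i c i = -1.
  move=> jkl hA hB.
  pose f (i : 'I_3) := if i == 0 then j else if i == 1 then k else l.
  pose c (i : 'I_3) := if i == 0 then c0 else if i == 1 then c1 else c2.
  have finj : injective f.
    suff h : {in predT &, injective f} by move=> a b; exact: h.
    apply/image_injP/eqP/eq_card => i; transitivity true => //; apply/fintype.imageP.
    by case: (jkl i) => ->; [exists 0|exists 1|exists 2%:R].
  have xc i : x i = (c i * (y (f i)).1, c i * (y (f i)).2).
    rewrite /c /f; case: i => [[|[|[|//]]] ?] /=.
    - rewrite -h0; congr x; exact: val_inj.
    - rewrite -hA; congr x; exact: val_inj.
    - rewrite -hB; congr x; exact: val_inj.
  exists f, c; split => //; split => //.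
  (* A point where the product of the [y i] is nonzero, at which the two sides yield the product of
     the [c i]. *)
  have [s [t st]] : exists s t, \prod_i lf (y i) s t != 0.
    apply: contrapT => N; have [|i /eqP] := @prod_lf_eq0 y; last by rewrite (negbTE (ny i)).
    by move=> s t; apply/eqP/negPn/negP => h; apply: N; exists s, t.
  have := H s t; under eq_bigr do rewrite xc lfZ.
  rewrite big_split /= [X in _ * X + _](_ : _ = \prod_i lf (y i) s t); last first.
    by rewrite [RHS](reindex_inj finj).
  rewrite -[X in _ + X]mul1r -mulrDl => /eqP; rewrite mulf_eq0 (negbTE st) orbF.
  by rewrite addr_eq0 => /eqP.
have hj (i : 'I_3) : [\/ i = j, i = j + 1 | i = j + 2%:R].
  have -> : i = j + (i - j) by rewrite addrC subrK.
  case: (i - j) => [[|[|[|//]]] ?].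
  - by constructor 1; rewrite -[RHS]addr0; congr (_ + _); exact: val_inj.
  - by constructor 2; congr (_ + _); exact: val_inj.
  - by constructor 3; congr (_ + _); exact: val_inj.
have := H1 A.2 (- A.1); rewrite lf_root// mul0r mulr0 add0r => /eqP.
rewrite mulf_eq0 => /orP[]/eqP.
  by move=> /(step2 D E (ny _) H1)[c1 [c2 [hA hB]]]; exact: (fin (j + 1) (j + 2%:R) c1 c2).
have H2 s t : c0 * (lf A s t * lf B s t) + lf E s t * lf D s t = 0 by rewrite [X in _ + X]mulrC.
move=> /(step2 E D (ny _) H2)[c1 [c2 [hA hB]]]; apply: (fin (j + 2%:R) (j + 1) c1 c2) => //.
by move=> i; case: (hj i); [constructor 1|constructor 3|constructor 2].
Qed.

End binary_forms.

(** * Matrices with zero diagonal *)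

Section zero_diagonal.
Variable F : fieldType.
Implicit Types (x y : 'I_3 -> F) (N : 'M[F]_3) (u v : 'rV[F]_3).

Lemma ord3_add : ((0 + 1 : 'I_3) = 1) * ((1 + 1 : 'I_3) = 2%:R) * ((2%:R + 1 : 'I_3) = 0).
Proof. by split; [split|]; exact: val_inj. Qed.

Lemma ord3P (P : 'I_3 -> Prop) : P 0 -> P 1 -> P 2%:R -> forall i, P i.
Proof.
by move=> P0 P1 P2 [[|[|[|//]]] ?]; [apply: eq_ind P0 _ _|apply: eq_ind P1 _ _|apply: eq_ind P2 _ _]; exact: val_inj.
Qed.

Lemma det_zero_diag N : (forall i, N i i = 0) ->
  \det N = \prod_i N i (i + 1) + \prod_i N (i + 1) i.
Proof.
move=> d; rewrite det3E !(prod3E _ 0) !d.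
rewrite !add0r !ord3_add.
ring.
Qed.

Lemma form_zero_diag N u v : (forall i, N i i = 0) ->
  (u *m N *m v^T) 0 0 =
  \sum_i (u 0 i * v 0 (i + 1) * N i (i + 1) + u 0 (i + 1) * v 0 i * N (i + 1) i).
Proof.
move=> d; rewrite [LHS]mxE !sum3E ![(u *m N) _ _]mxE !sum3E !mxE !d !ord3_add; ring.
Qed.

Definition zdmx x y : 'M[F]_3 :=
  \matrix_(i, j) if j == i + 1 then x i else if i == j + 1 then y j else 0.

Lemma zdmx_diag x y i : zdmx x y i i = 0.
Proof. by rewrite mxE; elim/ord3P: i. Qed.

Lemma zdmx_x x y i : zdmx x y i (i + 1) = x i.
Proof. by rewrite mxE eqxx. Qed.

Lemma zdmx_y x y i : zdmx x y (i + 1) i = y i.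
Proof. by rewrite mxE eqxx ifN//; elim/ord3P: i. Qed.

End zero_diagonal.

(** The real kernel of [Phi] has dimension at most 2 and its complexification contains the line, so
    the two coincide. *)
Lemma real_line_of_forms (R : realType) n (Phi : 'M[R]_(4, n)) (p q : 'rV[R[i]]_4) :
  (2 <= \rank Phi)%N -> \rank (col_mx p q) = 2%N ->
  p *m cplx_mx Phi = 0 -> q *m cplx_mx Phi = 0 -> real_line p q.
Proof.
move=> rPhi rpq pP qP.
have sub : (col_mx p q <= cplx_mx (kermx Phi))%MS.
  by rewrite /cplx_mx map_kermx; apply/sub_kermxP; rewrite mul_col_mx pP qP col_mx0.
have rK : \rank (kermx Phi) = 2%N.
  have := mxrankS sub; rewrite /cplx_mx mxrank_map rpq; rewrite mxrank_ker; lia.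
pose P : 'M[R]_(1 + 1, 4) := (pid_mx 2 : 'M[R]_(1 + 1, \rank (kermx Phi))) *m row_base (kermx Phi).
have PK : (P <= kermx Phi)%MS.
  by apply: submx_trans (submxMl _ _) _; rewrite eq_row_base.
have rP : \rank P = 2%N.
  by rewrite mxrankMfree ?row_base_free// rank_pid_mx// rK.
exists (usubmx P), (dsubmx P).
rewrite /cplx_mx -map_col_mx vsubmxK.
have e1 : (map_mx (real_complex R) P == map_mx (real_complex R) (kermx Phi))%MS.
  have s1 : (map_mx (real_complex R) P <= map_mx (real_complex R) (kermx Phi))%MS by rewrite map_submx.
  by rewrite -(mxrank_leqif_eq s1).2 !mxrank_map rP rK.
have e2 : (col_mx p q == map_mx (real_complex R) (kermx Phi))%MS.
  by rewrite -(mxrank_leqif_eq sub).2 rpq mxrank_map rK.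
apply/eqmxP; apply: eqmx_trans (eqmxP e2) _; apply: eqmx_sym; exact: eqmxP e1.
Qed.

Section configuration.
Variables (R : realType) (M : 'I_4 -> 'M[R]_3).
Implicit Types (a b : 'I_5 -> 'rV[R]_3).
Local Notation C := R[i].

(* The five matrices a k ^T * b k span the orthogonal complement of M. *)
Definition config a b := [/\ smooth M, forall k l, a k *m M l *m (b k)^T = 0 &
  forall N, (forall k, a k *m N *m (b k)^T = 0) -> exists z, N = lc M z].

(* Otherwise w^T *m c would be a matrix of rank one in the span of M. *)
Lemma config_star a b (w c : 'rV[R]_3) : config a b -> w != 0 -> c != 0 ->
  ~ (forall k, dot3 (a k) w = 0 \/ dot3 (b k) c = 0).
Proof.
move=> [sm _ H] w0 c0 K; have [|z zE] := H (w^T *m c).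
  move=> k; rewrite mulmxA -[_ *m c *m _]mulmxA.
  apply/matrixP => i j; rewrite !ord1 mxE big_ord1 [RHS]mxE.
  change (dot3 (a k) w * dot3 c (b k) = 0); rewrite (dot3C c).
  by case: (K k) => ->; rewrite ?mul0r ?mulr0.
apply: (smooth_rank1 sm _ (esym zE)).
apply: contraNneq (rank1_neq0 w0 c0) => z0; rewrite zE z0 /lc big1// => k _.
by rewrite mxE scale0r.
Qed.

(** A vector [c] orthogonal to the two remaining [b] would contradict [config_star]. *)
Lemma config_noncollinear a b (p q r s t : 'I_5) (w : 'rV[R]_3) : config a b ->
  (forall k, k \in [:: p; q; r; s; t]) -> w != 0 ->
  dot3 (a p) w = 0 -> dot3 (a q) w = 0 -> dot3 (a r) w = 0 -> False.
Proof.
move=> cf al w0 h1 h2 h3; have [c c0 [cs ct]] := orth2 (b s) (b t).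
apply: (config_star cf w0 c0) => k; have := al k; rewrite !inE.
by move=> /or4P[/eqP->|/eqP->|/eqP->|/orP[]/eqP->]; auto.
Qed.

Lemma config_noncollinear_tr a b (p q r s t : 'I_5) (w : 'rV[R]_3) : config a b ->
  (forall k, k \in [:: p; q; r; s; t]) -> w != 0 ->
  dot3 (b p) w = 0 -> dot3 (b q) w = 0 -> dot3 (b r) w = 0 -> False.
Proof.
move=> cf al w0 h1 h2 h3; have [c c0 [cs ct]] := orth2 (a s) (a t).
apply: (config_star cf c0 w0) => k; have := al k; rewrite !inE.
by move=> /or4P[/eqP->|/eqP->|/eqP->|/orP[]/eqP->]; auto.
Qed.

End configuration.

(** * Lines of a surface in normal form *)

Section normalized.
Variables (R : realType) (M : 'I_4 -> 'M[R]_3) (a b : 'I_5 -> 'rV[R]_3).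
Local Notation C := R[i].
Definition widen5 (i : 'I_3) : 'I_5 := widen_ord (isT : 3 <= 5)%N i.
Hypothesis cf : config M a b.
Hypothesis aE : forall i, a (widen5 i) = delta_mx 0 i.
Hypothesis bE : forall i, b (widen5 i) = delta_mx 0 i.

(* The matrices of the span of M have zero diagonal, and their off-diagonal
   entries X = (m12, m23, m31), Y = (m21, m32, m13) obey the two linear relations
   px.X + py.Y = 0 and qx.X + qy.Y = 0 given by the fourth and fifth points. *)
Let al i := a 3%:R 0 i.
Let be i := b 3%:R 0 i.
Let al' i := a 4%:R 0 i.
Let be' i := b 4%:R 0 i.
Let px i := al i * be (i + 1).
Let py i := al (i + 1) * be i.
Let qx i := al' i * be' (i + 1).
Let qy i := al' (i + 1) * be' i.

Lemma ord5P (P : 'I_5 -> Prop) : (forall i, P (widen5 i)) -> P 3%:R -> P 4%:R -> forall k, P k.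
Proof.
move=> Pw P3 P4 [[|[|[|[|[|//]]]]] ?].
- by apply: eq_ind (Pw 0) _ _; exact: val_inj.
- by apply: eq_ind (Pw 1) _ _; exact: val_inj.
- by apply: eq_ind (Pw 2%:R) _ _; exact: val_inj.
- by apply: eq_ind P3 _ _; exact: val_inj.
- by apply: eq_ind P4 _ _; exact: val_inj.
Qed.

Lemma dot3_delta (F : fieldType) i (w : 'rV[F]_3) : dot3 (delta_mx 0 i) w = w 0 i.
Proof. by rewrite /dot3 -rowE !mxE. Qed.

Lemma dot3_lin (F : fieldType) (u v w : 'rV[F]_3) x y :
  dot3 u (x *: v - y *: w) = x * dot3 u v - y * dot3 u w.
Proof. by rewrite !dot3E !mxE; ring. Qed.

Lemma widen5_all i k : k \in [:: widen5 i; widen5 (i + 1); widen5 (i + 2%:R); 3%:R; 4%:R].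
Proof.
elim/ord5P: k; rewrite ?inE ?eqxx ?orbT//; elim/ord3P; elim/ord3P: i; by [].
Qed.

Lemma diag0 l i : M l i i = 0.
Proof.
case: cf => _ /(_ (widen5 i) l) + _; rewrite aE bE -rowE => /matrixP /(_ 0 0).
by rewrite trmx_delta -colE !mxE.
Qed.

Lemma lc_diag0 z i : lc M z i i = 0.
Proof. by rewrite /lc summxE big1// => k _; rewrite mxE diag0 mulr0. Qed.

Lemma lc_zdmx x y : \sum_i (px i * x i + py i * y i) = 0 -> \sum_i (qx i * x i + qy i * y i) = 0 ->
  exists z, zdmx x y = lc M z.
Proof.
move=> hp hq; case: cf => _ _; apply; elim/ord5P.
- move=> i; rewrite aE bE -rowE; apply/matrixP => i' j'; rewrite !ord1 trmx_delta -colE.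
  by rewrite [LHS]mxE [LHS]mxE zdmx_diag mxE.
- apply/matrixP => i' j'; rewrite !ord1 form_zero_diag ?mxE; last exact: zdmx_diag.
  by rewrite -[RHS]hp; apply: eq_bigr => i _; rewrite zdmx_x zdmx_y.
- apply/matrixP => i' j'; rewrite !ord1 form_zero_diag ?mxE; last exact: zdmx_diag.
  by rewrite -[RHS]hq; apply: eq_bigr => i _; rewrite zdmx_x zdmx_y.
Qed.

(** A vanishing coordinate [i] would put the fourth or fifth point on the line through the two
    coordinate points other than [i]. *)
Lemma nonzero_coords i : [/\ al i != 0, be i != 0, al' i != 0 & be' i != 0].
Proof.
have d0 : delta_mx 0 i != 0 :> 'rV[R]_3.
  by apply/eqP => /rowP /(_ i); rewrite !mxE !eqxx => /eqP; rewrite oner_eq0.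
have dk k : k != i -> dot3 (delta_mx 0 k) (delta_mx 0 i) = 0 :> R.
  by move=> ki; rewrite dot3_delta mxE (negbTE ki) andbF.
have i1 : i + 1 != i by elim/ord3P: (i).
have i2 : i + 2%:R != i by elim/ord3P: (i).
have all3 k : k \in [:: widen5 (i + 1); widen5 (i + 2%:R); 3%:R; widen5 i; 4%:R].
  by have := widen5_all i k; rewrite !inE => /or4P[->|->|->|/orP[]->]; rewrite ?orbT.
have all4 k : k \in [:: widen5 (i + 1); widen5 (i + 2%:R); 4%:R; widen5 i; 3%:R].
  by have := widen5_all i k; rewrite !inE => /or4P[->|->|->|/orP[]->]; rewrite ?orbT.
split; apply/eqP => h.
- apply: (config_noncollinear cf all3 d0); rewrite ?aE ?dk//.
  by rewrite dot3C dot3_delta.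
- apply: (config_noncollinear_tr cf all3 d0); rewrite ?bE ?dk//.
  by rewrite dot3C dot3_delta.
- apply: (config_noncollinear cf all4 d0); rewrite ?aE ?dk//.
  by rewrite dot3C dot3_delta.
- apply: (config_noncollinear_tr cf all4 d0); rewrite ?bE ?dk//.
  by rewrite dot3C dot3_delta.
Qed.

(** The vector [w] is the line through [u] and the coordinate point [i]; a vanishing minor would put
    [v] on it. *)
Lemma minor_neq0 (u v : 'rV[R]_3) i : u 0 (i + 2%:R) != 0 ->
  (forall w, w != 0 -> dot3 (delta_mx 0 i) w = 0 -> dot3 u w = 0 -> dot3 v w = 0 -> False) ->
  u 0 (i + 1) * v 0 (i + 2%:R) != u 0 (i + 2%:R) * v 0 (i + 1).
Proof.
move=> u0 H; apply/eqP => h.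
pose w : 'rV[R]_3 := u 0 (i + 2%:R) *: delta_mx 0 (i + 1) - u 0 (i + 1) *: delta_mx 0 (i + 2%:R).
have dw t : dot3 t w = u 0 (i + 2%:R) * t 0 (i + 1) - u 0 (i + 1) * t 0 (i + 2%:R).
  by rewrite /w dot3_lin !(dot3C t) !dot3_delta.
apply: (H w).
- apply: contraNneq u0 => w0; have := dw (delta_mx 0 (i + 1)).
  rewrite w0 /dot3 trmx0 mulmx0 !mxE !eqxx /=.
  have -> : (i + 2%:R == i + 1) = false by elim/ord3P: (i).
  by rewrite mulr1 mulr0 subr0 => <-.
- by rewrite dot3_delta !mxE; elim/ord3P: (i); rewrite /= !mulr0 subr0.
- by rewrite dw mulrC subrr.
- by rewrite dw; apply/eqP; rewrite subr_eq0 h.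
Qed.

Lemma minors_neq0 i : al (i + 1) * al' (i + 2%:R) != al (i + 2%:R) * al' (i + 1) /\
  be (i + 1) * be' (i + 2%:R) != be (i + 2%:R) * be' (i + 1).
Proof.
have all3 k : k \in [:: widen5 i; 3%:R; 4%:R; widen5 (i + 1); widen5 (i + 2%:R)].
  by have := widen5_all i k; rewrite !inE => /or4P[->|->|->|/orP[]->]; rewrite ?orbT.
have [a0 b0 _ _] := nonzero_coords (i + 2%:R).
split; apply: minor_neq0 => // w w0.
  by rewrite -aE; exact: (config_noncollinear cf all3 w0).
by rewrite -bE; exact: (config_noncollinear_tr cf all3 w0).
Qed.

(* For j = i, a vanishing minor would give a matrix in the span of M with only
   two nonzero entries, a singular point. *)
Lemma cross i j : px i * qy j - py j * qx i != 0.
Proof.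
rewrite subr_eq0; have [n1 n2 n3 n4] := nonzero_coords i.
have [m1 m2 m3 m4] := nonzero_coords (i + 1).
have [->|->|->] : [\/ j = i, j = i + 1 | j = i + 2%:R].
  by elim/ord3P: (i); elim/ord3P: (j); first [by constructor 1; exact: val_inj|by constructor 2; exact: val_inj|by constructor 3; exact: val_inj].
- apply/eqP => h.
  pose x k := if k == i then py i else 0; pose y k := if k == i then - px i else 0.
  have [||z zE] := @lc_zdmx x y.
  + by rewrite (bigD1 i)//= /x /y eqxx big1 ?addr0; [ring|move=> k /negbTE ->; rewrite !mulr0 addr0].
  + rewrite (bigD1 i)//= /x /y eqxx big1 ?addr0; last by move=> k /negbTE ->; rewrite !mulr0 addr0.
    by rewrite mulrN [X in _ - X]mulrC h mulrC subrr.
  case: cf => sm _ _; have [|l] := sm z.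
    apply: contraNneq (_ : x i != 0) => [z0|]; last by rewrite /x eqxx mulf_neq0.
    by rewrite -(zdmx_x x y) zE z0 /lc big1 ?mxE// => k _; rewrite mxE scale0r.
  rewrite -zE blfE !diag0 !mxE /x /y /=; by elim/ord3P: (i) => /= /eqP; apply; ring.
(* In the two remaining cases a nonzero common factor comes out and leaves a minor of the [a]
   coordinates, respectively of the [b] coordinates. *)
- rewrite /px /py /qx /qy.
  have -> : al i * be (i + 1) * (al' (i + 1 + 1) * be' (i + 1)) = (be (i + 1) * be' (i + 1)) * (al i * al' (i + 1 + 1)) by ring.
  have -> : al (i + 1 + 1) * be (i + 1) * (al' i * be' (i + 1)) = (be (i + 1) * be' (i + 1)) * (al (i + 1 + 1) * al' i) by ring.
  rewrite (inj_eq (mulfI _)) ?mulf_neq0// eq_sym.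
  by have [+ _] := minors_neq0 (i + 1); have -> : i + 1 + 2%:R = i by elim/ord3P: (i); exact: val_inj.
- rewrite /px /py /qx /qy.
  have -> : i + 2%:R + 1 = i by elim/ord3P: (i); exact: val_inj.
  have -> : al i * be (i + 1) * (al' i * be' (i + 2%:R)) = (al i * al' i) * (be (i + 1) * be' (i + 2%:R)) by ring.
  have -> : al i * be (i + 2%:R) * (al' i * be' (i + 1)) = (al i * al' i) * (be (i + 2%:R) * be' (i + 1)) by ring.
  by rewrite (inj_eq (mulfI _)) ?mulf_neq0//; have [] := minors_neq0 i.
Qed.

Lemma prod_px : \prod_i px i = \prod_i py i.
Proof. rewrite !(prod3E _ 0) /px /py !add0r !ord3_add; ring. Qed.

Lemma prod_qx : \prod_i qx i = \prod_i qy i.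
Proof. rewrite !(prod3E _ 0) /qx /qy !add0r !ord3_add; ring. Qed.

Let m z := lc (cM M) z.
Let X z i := m z i (i + 1).
Let Y z i := m z (i + 1) i.

Lemma lc_lin (F : fieldType) (M0 : 'I_4 -> 'M[F]_3) s t z z' :
  lc M0 (s *: z + t *: z') = s *: lc M0 z + t *: lc M0 z'.
Proof.
rewrite /lc !scaler_sumr -big_split /=; apply: eq_bigr => k _.
by rewrite !mxE scalerDl !scalerA.
Qed.

Lemma m_diag0 z i : m z i i = 0.
Proof. by rewrite /m /lc summxE big1// => k _; rewrite 2!mxE diag0 rmorph0 mulr0. Qed.

Lemma form_cM (u v : 'rV[R]_3) z : (forall l, u *m M l *m v^T = 0) ->
  cplx_mx u *m m z *m (cplx_mx v)^T = 0.
Proof.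
move=> h; rewrite /m /lc mulmx_sumr mulmx_suml big1// => k _.
by rewrite -scalemxAr -scalemxAl /cM /cplx_mx map_trmx -!map_mxM h map_mx0 scaler0.
Qed.

Lemma rel_p z : \sum_i ((px i)%:C%C * X z i + (py i)%:C%C * Y z i) = 0.
Proof.
case: cf => _ H _; have := form_cM z (H 3%:R) => /matrixP /(_ 0 0).
rewrite form_zero_diag ?mxE; last exact: m_diag0.
by move=> h; rewrite -[RHS]h; apply: eq_bigr => i _; rewrite !mxE -!rmorphM.
Qed.

Lemma rel_q z : \sum_i ((qx i)%:C%C * X z i + (qy i)%:C%C * Y z i) = 0.
Proof.
case: cf => _ H _; have := form_cM z (H 4%:R) => /matrixP /(_ 0 0).
rewrite form_zero_diag ?mxE; last exact: m_diag0.
by move=> h; rewrite -[RHS]h; apply: eq_bigr => i _; rewrite !mxE -!rmorphM.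
Qed.

Lemma zdm_ext (F : fieldType) (N : 'M[F]_3) : (forall i, N i i = 0) -> (forall i, N i (i + 1) = 0) ->
  (forall i, N (i + 1) i = 0) -> N = 0.
Proof.
move=> h1 h2 h3; apply/matrixP => i j; rewrite [RHS]mxE.
have [->|->|->] : [\/ j = i, j = i + 1 | i = j + 1].
  by elim/ord3P: (i); elim/ord3P: (j); first [by constructor 1; exact: val_inj|by constructor 2; exact: val_inj|by constructor 3; exact: val_inj].
- exact: h1.
- exact: h2.
- exact: h3.
Qed.

Lemma lc_inj z : lc M z = 0 -> z = 0.
Proof.
case: cf => sm _ _ h; apply/eqP; move: (smooth_free sm); rewrite -kermx_eq0 => /eqP K.
by rewrite -submx0 -K; apply/sub_kermxP; rewrite mul_Wmx h linear0.
Qed.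

Lemma m_inj z : m z = 0 -> z = 0.
Proof.
case: cf => sm _ _ h; apply/eqP; move: (smooth_free sm); rewrite -(row_free_map (real_complex R)) -kermx_eq0 => /eqP K.
rewrite -submx0 -K; apply/sub_kermxP.
have -> : map_mx (real_complex R) (Wmx M) = Wmx (cM M).
  by apply/row_matrixP => k; rewrite -map_row !rowK map_mxvec.
by rewrite mul_Wmx -/(m z) h linear0.
Qed.

(** The line is cut out by two real forms, provided these are independent. If [c X_i + d Y_j]
    vanished on the span of [M], [cross] would give a matrix of the span with [X_i = c] and
    [Y_j = d], so that [c^2 + d^2 = 0]. *)
Lemma coordinate_line_real (p q : 'rV[C]_4) i j : \rank (col_mx p q) = 2%N ->
  X p i = 0 -> X q i = 0 -> Y p j = 0 -> Y q j = 0 -> real_line p q.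
Proof.
move=> rpq Xp Xq Yp Yq.
pose Phi : 'M[R]_(4, 2) := \matrix_(k, e) if e == 0 then M k i (i + 1) else M k (j + 1) j.
have PhiE z : X z i = 0 -> Y z j = 0 -> z *m cplx_mx Phi = 0.
  move=> hx hy; apply/rowP => e; rewrite [RHS]mxE mxE.
  have [e0|e0] := eqVneq e 0.
    by rewrite -[RHS]hx /X /m /lc summxE; apply: eq_bigr => k _; rewrite !mxE e0.
  by rewrite -[RHS]hy /Y /m /lc summxE; apply: eq_bigr => k _; rewrite !mxE (negbTE e0).
apply: (@real_line_of_forms _ _ Phi) => //; try exact: PhiE.
rewrite leqNgt; apply/negP => rPhi.
have : kermx Phi^T != 0 by rewrite -mxrank_eq0 mxrank_ker mxrank_tr; lia.
case/rowV0Pn => v /sub_kermxP vPhi v0.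
pose c := v 0 0; pose d := v 0 1.
have cd z : c * lc M z i (i + 1) + d * lc M z (j + 1) j = 0.
  rewrite /lc !summxE !mulr_sumr -big_split big1//= => k _.
  have /rowP/(_ k) := vPhi; rewrite !mxE !big_ord_recl big_ord0 !mxE /= addr0 => h.
  rewrite -[RHS](mulr0 (z 0 k)) -h.
  rewrite (_ : lift ord0 ord0 = 1); last exact: val_inj.
  rewrite -/c -/d; ring.
pose k := i + 1; pose l := j + 1.
have ki : (k == i) = false by rewrite /k; elim/ord3P: (i).
have lj : (l == j) = false by rewrite /l; elim/ord3P: (j).
pose D := px k * qy l - py l * qx k; have D0 : D != 0 := cross k l.
pose A1 := c * px i + d * py j; pose A2 := c * qx i + d * qy j.
(* Cramer's rule: [X_i = c] and [Y_j = d] are prescribed, [X_k] and [Y_l] are solved from the two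
   relations, and the other entries are zero. *)
pose x e := if e == i then c else if e == k then (A2 * py l - A1 * qy l) / D else 0.
pose y e := if e == j then d else if e == l then (A1 * qx k - A2 * px k) / D else 0.
have sumx (g : 'I_3 -> R) : \sum_e g e * x e = g i * c + g k * ((A2 * py l - A1 * qy l) / D).
  rewrite (bigD1 i)//= (bigD1 k) ?ki//= /x eqxx ki eqxx big1 ?addr0// => e /andP[/negbTE -> /negbTE ->].
  by rewrite mulr0.
have sumy (g : 'I_3 -> R) : \sum_e g e * y e = g j * d + g l * ((A1 * qx k - A2 * px k) / D).
  rewrite (bigD1 j)//= (bigD1 l) ?lj//= /y eqxx lj eqxx big1 ?addr0// => e /andP[/negbTE -> /negbTE ->].
  by rewrite mulr0.
have [||z zE] := @lc_zdmx x y.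
- rewrite big_split /= sumx sumy /A1 /A2; by move: D0; rewrite /D => D0; field; apply: contra D0 => /eqP D0; apply/eqP; rewrite -[RHS]D0; ring.
- rewrite big_split /= sumx sumy /A1 /A2; by move: D0; rewrite /D => D0; field; apply: contra D0 => /eqP D0; apply/eqP; rewrite -[RHS]D0; ring.
have := cd z; rewrite -zE zdmx_x zdmx_y /x /y !eqxx -!expr2 => /eqP.
rewrite paddr_eq0 ?sqr_ge0// !sqrf_eq0 => /andP[/eqP c0 /eqP d0].
case/eqP: v0; apply/rowP => e; rewrite [RHS]mxE.
by case: e => [[|[|//]] ?]; [rewrite -[RHS]c0|rewrite -[RHS]d0]; congr (v _ _); exact: val_inj.
Qed.

(** With [prod_px] and [prod_qx] the terms in [l ^+ 3] and [n ^+ 3] disappear, and what is left is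
    [l * n] times a linear form in [l] and [n]. *)
Lemma prod_pencil (F : fieldType) (Px Py Qx Qy : 'I_3 -> F) l n :
  \prod_i (l * Px i + n * Qx i) - \prod_i (l * Py i + n * Qy i) =
  l ^+ 3 * (\prod_i Px i - \prod_i Py i) + n ^+ 3 * (\prod_i Qx i - \prod_i Qy i) +
  l * n * (l * \sum_i (Qx i * Px (i + 1) * Px (i + 1 + 1) - Qy i * Py (i + 1) * Py (i + 1 + 1)) +
           n * \sum_i (Px i * Qx (i + 1) * Qx (i + 1 + 1) - Py i * Qy (i + 1) * Qy (i + 1 + 1))).
Proof. by rewrite !(prod3E _ 0) !sum3E !add0r !ord3_add; ring. Qed.

Lemma combE (F : fieldType) k l (A B : 'M[F]_(k, l)) s t i j :
  (s *: A + t *: B) i j = s * A i j + t * B i j.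
Proof. by rewrite !mxE. Qed.

(* Eliminating c from the two relations leaves an equation of degree one in the
   ratio of their multipliers, as px, py (and qx, qy) have equal products: this
   ratio is real, hence so are the c i. *)
Lemma proportional_line_real (p q : 'rV[C]_4) (f : 'I_3 -> 'I_3) (c : 'I_3 -> C) :
  \rank (col_mx p q) = 2%N -> injective f -> \prod_i c i = -1 ->
  (forall i, X p i = c i * Y p (f i)) -> (forall i, X q i = c i * Y q (f i)) -> real_line p q.
Proof.
move=> rpq finj c1 Xp Xq.
pose rho : 'rV[C]_3 := \row_i ((px i)%:C%C * c i + (py (f i))%:C%C).
pose rho' : 'rV[C]_3 := \row_i ((qx i)%:C%C * c i + (qy (f i))%:C%C).
have relf (gx gy : 'I_3 -> R) z : (forall i, X z i = c i * Y z (f i)) ->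
    \sum_i ((gx i)%:C%C * X z i + (gy i)%:C%C * Y z i) =
    \sum_i ((gx i)%:C%C * c i + (gy (f i))%:C%C) * Y z (f i).
  move=> h; rewrite big_split /= [X in _ + X](reindex_inj finj) -big_split /=.
  by apply: eq_bigr => i _; rewrite h; ring.
pose eta z : 'cV[C]_3 := \col_i Y z (f i).
have relE (u : 'rV[C]_3) z : (u *m eta z) = (\sum_i u 0 i * Y z (f i))%:M.
  by apply/matrixP => i j; rewrite !ord1 mxE [RHS]mxE eqxx; apply: eq_bigr => k _; rewrite mxE.
have rhoK z : (forall i, X z i = c i * Y z (f i)) -> rho *m eta z = 0.
  move=> h; rewrite relE.
  have := rel_p z; rewrite (relf _ _ _ h) => e.
  by rewrite (_ : \sum_i _ = 0) ?raddf0// -[RHS]e; apply: eq_bigr => i _; rewrite mxE.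
have rhoK' z : (forall i, X z i = c i * Y z (f i)) -> rho' *m eta z = 0.
  move=> h; rewrite relE.
  have := rel_q z; rewrite (relf _ _ _ h) => e.
  by rewrite (_ : \sum_i _ = 0) ?raddf0// -[RHS]e; apply: eq_bigr => i _; rewrite mxE.
(* If the two relations were independent, [eta p] and [eta q] would be dependent, and some nonzero
   combination of [p] and [q] would have all entries of its matrix zero. *)
have [l [n [e0 ln]]] : exists l n, l *: rho + n *: rho' = 0 /\ ((l != 0) || (n != 0)).
  apply: contrapT => H; have np : npar rho rho'.
    move=> l n e; have [h|] := boolP ((l != 0) || (n != 0)); first by case: H; exists l, n.
    by rewrite negb_or !negbK => /andP[/eqP ? /eqP ?].
  have r2 : \rank (col_mx rho rho') = 2%N by apply/eqP; exact: npar_row_free np.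
  pose E := row_mx (eta p) (eta q).
  have : col_mx rho rho' *m E = 0 by rewrite mul_col_row !rhoK ?rhoK'// block_mx0.
  move/mulmx0_rank_max; rewrite r2 => rE.
  have : kermx E^T != 0 by rewrite -mxrank_eq0 mxrank_ker mxrank_tr; move: rE; lia.
  case/rowV0Pn => v /sub_kermxP vE v0.
  have vY : v *m col_mx p q = 0.
    rewrite -[v]hsubmxK mul_row_col; set s := lsubmx v; set t := rsubmx v.
    rewrite (mx11_scalar s) (mx11_scalar t) !mul_scalar_mx.
    have Y0 i : Y (s 0 0 *: p + t 0 0 *: q) (f i) = 0.
      rewrite /Y /m lc_lin combE; have /rowP/(_ i) := vE.
      rewrite -[v]hsubmxK tr_row_mx mul_row_col -/s -/t (mx11_scalar s) (mx11_scalar t) !mul_scalar_mx.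
      by rewrite combE ![(eta _)^T _ _]mxE ![eta _ _ _]mxE !mxE !mulr1n.
    have X0 i : X (s 0 0 *: p + t 0 0 *: q) i = 0.
      have := Y0 i; rewrite /X /Y /m lc_lin !combE -/(m p) -/(m q) -/(X p i) -/(X q i) Xp Xq => h.
      by rewrite mulrCA (mulrCA (t 0 0)) -mulrDr h mulr0.
    apply: m_inj; apply: zdm_ext; [exact: m_diag0|exact: X0|] => i.
    by have [g fg gf] := injF_bij finj; rewrite -(gf i); exact: Y0.
  move: v0; have : row_free (col_mx p q) by rewrite /row_free rpq.
  rewrite -kermx_eq0 => /eqP K; rewrite -submx0 -K; case/negP; exact/sub_kermxP.
have e i : (l * (px i)%:C%C + n * (qx i)%:C%C) * c i = - (l * (py (f i))%:C%C + n * (qy (f i))%:C%C).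
  have /rowP/(_ i) := e0; rewrite !mxE => h; apply/eqP; rewrite -addr_eq0; apply/eqP; rewrite -[RHS]h; ring.
pose A l n i : R := l * px i + n * qx i; pose B l n i : R := l * py i + n * qy i.
have AB0 (l0 n0 : R) i j : A l0 n0 i = 0 -> B l0 n0 j = 0 -> l0 = 0 /\ n0 = 0.
  move=> hA hB; have cr := cross i j; split; apply: (mulIf cr); rewrite mul0r.
    transitivity (A l0 n0 i * qy j - B l0 n0 j * qx i); first by rewrite /A /B; ring.
    by rewrite hA hB; ring.
  transitivity (px i * B l0 n0 j - py j * A l0 n0 i); first by rewrite /A /B; ring.
  by rewrite hA hB; ring.
have [k [l0 [n0 [lk nk]]]] : exists (k : C) (l0 n0 : R), l = k * l0%:C%C /\ n = k * n0%:C%C.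
  pose e1 : R := \sum_i (qx i * px (i + 1) * px (i + 1 + 1) - qy i * py (i + 1) * py (i + 1 + 1)).
  pose e2 : R := \sum_i (px i * qx (i + 1) * qx (i + 1 + 1) - py i * qy (i + 1) * qy (i + 1 + 1)).
  (* If both coefficients vanished, the two products would agree for all multipliers. At
     [(qx 0, - px 0)] the first one is zero, and a zero factor of the second contradicts [cross]. *)
  have e12 : (e2%:C%C, - e1%:C%C) != (0, 0) :> C * C.
    apply/eqP => h; have /= e20 : _ = 0 := congr1 (fun u => complex.Re u.1) h.
    have /= /eqP : _ = 0 := congr1 (fun u => complex.Re u.2) h; rewrite oppr_eq0 => /eqP e10 {h}.
    have := prod_pencil px py qx qy (qx 0) (- px 0).
    rewrite prod_px prod_qx !subrr -/e1 -/e2 e10 e20 !mulr0 !addr0 mulr0 => /eqP.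
    rewrite [X in X - _](bigD1 0)//= mulNr [px 0 * _]mulrC subrr mul0r sub0r addr0 oppr_eq0.
    case/prodf_eq0 => j _ /eqP h; have /eqP[] := cross 0 j.
    by rewrite -[RHS]oppr0 -h; ring.
  (* The value -1 of the product of the [c i] cancels the three signs in [e]. *)
  have pr : \prod_i (l * (px i)%:C%C + n * (qx i)%:C%C) = \prod_i (l * (py i)%:C%C + n * (qy i)%:C%C).
    have : \prod_i ((l * (px i)%:C%C + n * (qx i)%:C%C) * c i) = \prod_i - (l * (py (f i))%:C%C + n * (qy (f i))%:C%C).
      by apply: eq_bigr => i _; exact: e.
    rewrite big_split /= c1 mulrN1 [in RHS](prod3E _ 0) !mulrNN mulrN => /oppr_inj ->.
    by rewrite [RHS](reindex_inj finj) [RHS](prod3E _ 0).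
  have := prod_pencil (fun i => (px i)%:C%C) (fun i => (py i)%:C%C) (fun i => (qx i)%:C%C) (fun i => (qy i)%:C%C) l n.
  rewrite pr -!rmorph_prod prod_px prod_qx !subrr !mulr0 !add0r.
  have -> : \sum_i ((qx i)%:C%C * (px (i + 1))%:C%C * (px (i + 1 + 1))%:C%C - (qy i)%:C%C * (py (i + 1))%:C%C * (py (i + 1 + 1))%:C%C) = e1%:C%C.
    by rewrite rmorph_sum; apply: eq_bigr => i _; rewrite rmorphB !rmorphM.
  have -> : \sum_i ((px i)%:C%C * (qx (i + 1))%:C%C * (qx (i + 1 + 1))%:C%C - (py i)%:C%C * (qy (i + 1))%:C%C * (qy (i + 1 + 1))%:C%C) = e2%:C%C.
    by rewrite rmorph_sum; apply: eq_bigr => i _; rewrite rmorphB !rmorphM.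
  move/esym/eqP; rewrite !mulf_eq0 => /orP[/orP[]|] /eqP h.
  - by exists n, 0, 1; rewrite h rmorph0 rmorph1 mulr0 mulr1.
  - by exists l, 1, 0; rewrite h rmorph0 rmorph1 mulr0 mulr1.
  have [|k [h1 h2]] := @lf_prop _ (l, n) _ e12.
    by rewrite /= mulrN; apply/eqP; rewrite -subr_eq0 opprK addrC; apply/eqP.
  by exists k, e2, (- e1); rewrite rmorphN.
have k0 : k != 0 by apply: contraTneq ln => k0; rewrite lk nk k0 !mul0r eqxx.
have ln0 : ~ (l0 = 0 /\ n0 = 0).
  by move=> [h1 h2]; move: ln; rewrite lk nk h1 h2 rmorph0 mulr0 eqxx.
have eAB i : (A l0 n0 i)%:C%C * c i = - (B l0 n0 (f i))%:C%C.
  apply: (mulfI k0).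
  transitivity ((l * (px i)%:C%C + n * (qx i)%:C%C) * c i).
    by rewrite lk nk /A rmorphD !(rmorphM _ _ (px i)) !(rmorphM _ _ (qx i)); ring.
  by rewrite e lk nk /B rmorphD !(rmorphM _ _ (py (f i))) !(rmorphM _ _ (qy (f i))); ring.
have A0 i : A l0 n0 i != 0.
  apply/eqP => h; apply: ln0; apply: (AB0 l0 n0 i (f i) h).
  have := eAB i; rewrite h rmorph0 mul0r => /esym/eqP; rewrite oppr_eq0 eq_complex /= eqxx andbT.
  by move/eqP.
pose r i := - (B l0 n0 (f i)) / A l0 n0 i.
have cr i : c i = (r i)%:C%C.
  have A0C : (A l0 n0 i)%:C%C != 0 by rewrite eq_complex /= eqxx andbT.
  apply: (mulfI A0C); rewrite eAB -rmorphM mulrC divfK// rmorphN.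
  by [].
pose Phi : 'M[R]_(4, 3) := \matrix_(k, i) (M k i (i + 1) - r i * M k (f i + 1) (f i)).
have PhiC z : (forall i, X z i = c i * Y z (f i)) -> z *m cplx_mx Phi = 0.
  move=> h; apply/rowP => i; rewrite [RHS]mxE mxE.
  transitivity (X z i - c i * Y z (f i)); last by rewrite h subrr.
  rewrite /X /Y /m /lc !summxE mulr_sumr -sumrB; apply: eq_bigr => k1 _.
  by rewrite !mxE cr rmorphB rmorphM; ring.
have PhiR z : z *m Phi = 0 -> forall i, lc M z i (i + 1) = r i * lc M z (f i + 1) (f i).
  move=> /rowP h i; have := h i; rewrite [RHS]mxE mxE => {}h; apply/eqP; rewrite -subr_eq0; apply/eqP.
  rewrite -[RHS]h /lc !summxE mulr_sumr -sumrB; apply: eq_bigr => k1 _.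
  by rewrite !mxE; ring.
apply: (@real_line_of_forms _ _ Phi) => //; try exact: PhiC.
(* If the real forms had rank at most 1, their kernel [K] would have dimension at least 3. As the
   [Y] coordinates determine its elements, they would be arbitrary on [K], so both relations would
   have zero coefficients in them, against [cross]. *)
rewrite leqNgt; apply/negP => rPhi.
pose Ym : 'M[R]_(4, 3) := \matrix_(k, i) M k (f i + 1) (f i).
have YE z : z *m Ym = \row_i lc M z (f i + 1) (f i).
  by apply/rowP => i; rewrite mxE [RHS]mxE /lc summxE; apply: eq_bigr => k1 _; rewrite !mxE.
pose K := kermx Phi.
have KY : (3 <= \rank (K *m Ym))%N.
  have := mxrank_mul_ker K Ym; rewrite (_ : \rank (K :&: kermx Ym) = 0%N).
    by rewrite mxrank_ker; move: rPhi; lia.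
  apply/eqP; rewrite mxrank_eq0; apply/rowV0P => z; rewrite sub_capmx => /andP[].
  move=> /sub_kermxP /PhiR hx /sub_kermxP; rewrite YE => /rowP hy.
  have Y0 i : lc M z (f i + 1) (f i) = 0 by have := hy i; rewrite !mxE.
  apply: lc_inj; apply: zdm_ext; [exact: lc_diag0|by move=> i; rewrite hx Y0 mulr0|] => i.
  by have [g fg gf] := injF_bij finj; rewrite -(gf i); exact: Y0.
have kill (gx gy : 'I_3 -> R) : (forall z, \sum_i (gx i * lc M z i (i + 1) + gy i * lc M z (i + 1) i) = 0) ->
    forall i, gx i * r i + gy (f i) = 0.
  move=> hz; pose g : 'rV[R]_3 := \row_i (gx i * r i + gy (f i)).
  have : K *m Ym *m g^T = 0.
    apply/row_matrixP => k1; rewrite row0 (row_mul _ (K *m Ym)) (row_mul _ K) YE.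
    have kz : row k1 K *m Phi = 0 by apply/sub_kermxP; exact: row_sub.
    apply/matrixP => i j; rewrite mxE [RHS]mxE !ord1 -[RHS](hz (row k1 K)).
    rewrite [RHS]big_split /= [X in _ = _ + X](reindex_inj finj) -big_split /=.
    by apply: eq_bigr => i1 _; rewrite [(\row__ _) _ _]mxE [g^T _ _]mxE [g _ _]mxE (PhiR _ kz); ring.
  move/mulmx0_rank_max; rewrite mxrank_tr => h.
  have /eqP : \rank g = 0%N by move: h KY; lia.
  by rewrite mxrank_eq0 => /eqP/rowP g0 i; have := g0 i; rewrite !mxE.
have rp z : \sum_i (px i * lc M z i (i + 1) + py i * lc M z (i + 1) i) = 0.
  case: cf => _ H _; rewrite -(form_zero_diag (a 3%:R) (b 3%:R) (lc_diag0 z)).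
  by rewrite /lc mulmx_sumr mulmx_suml big1 ?mxE// => k1 _; rewrite -scalemxAr -scalemxAl H scaler0.
have rq z : \sum_i (qx i * lc M z i (i + 1) + qy i * lc M z (i + 1) i) = 0.
  case: cf => _ H _; rewrite -(form_zero_diag (a 4%:R) (b 4%:R) (lc_diag0 z)).
  by rewrite /lc mulmx_sumr mulmx_suml big1 ?mxE// => k1 _; rewrite -scalemxAr -scalemxAl H scaler0.
have hp := kill _ _ rp 0; have hq := kill _ _ rq 0.
have /eqP[] := cross 0 (f 0).
transitivity (px 0 * (qx 0 * r 0 + qy (f 0)) - qx 0 * (px 0 * r 0 + py (f 0))); first by ring.
by rewrite hp hq !mulr0 subrr.
Qed.

Lemma normalized_lines_real : all_lines_real M.
Proof.
move=> p q [rpq H].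
have [|[i [j [[h1 h2] [h3 h4]]]]|[f [c [finj [h c1]]]]] :=
    @binary_cubic_matching C (fun i => (X p i, X q i)) (fun i => (Y p i, Y q i)).
- move=> s t; rewrite -[RHS](H s t) /cubic_form -[\sum_(k < 4) _]/(m (s *: p + t *: q)).
  rewrite det_zero_diag; last exact: m_diag0.
  by congr (_ + _); apply: eq_bigr => i _; rewrite /m lc_lin /lf /= combE.
- exact: (coordinate_line_real rpq h1 h2 h3 h4).
- by apply: (proportional_line_real rpq finj c1) => i; have [] := h i.
Qed.

End normalized.

(** * Reduction to the normal form *)

Section normalization.
Variable R : realType.
Implicit Types (M : 'I_4 -> 'M[R]_3) (a b : 'I_5 -> 'rV[R]_3).

Lemma covered5_config M : smooth M -> covered5 (perp M) -> exists a b, config M a b.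
Proof.
move=> sm [a [b pV]]; have rf := smooth_free sm; exists a, b.
have {}pV : (perp M <= Vmx a b)%MS by [].
have Vp : (Vmx a b <= perp M)%MS.
  have rV := rank_leq_row (Vmx a b).
  by rewrite -(mxrank_leqif_sup pV).2 eqn_leq (mxrankS pV) rank_perp.
split => //.
- move=> k l; have : (rank1 (a k) (b k) <= perp M)%MS.
    by apply: submx_trans Vp; rewrite -(rowK (fun k => rank1 (a k) (b k))) row_sub.
  move=> /sub_kermxP /rowP /(_ l); rewrite mulmx_rank1_Wmx [RHS]mxE => h.
  by apply/matrixP => i j; rewrite !ord1 h [RHS]mxE.
- move=> N HN; apply: (perp_perp rf pV); apply/row_matrixP => k.
  rewrite row_mul rowK row0; apply/matrixP => i j; rewrite !ord1 rank1_dot HN !mxE //.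
Qed.

(** Polarization reduces twice the identity to the multiplicativity of the determinant. *)
Lemma blf_equiv (A B N N' : 'M[R]_3) :
  blf (A *m N *m B) (A *m N *m B) (A *m N' *m B) = \det A * \det B * blf N N N'.
Proof.
have two : 2%:R != 0 :> R by rewrite pnatr_eq0.
have dE X Y : A *m X *m B + A *m Y *m B = A *m (X + Y) *m B by rewrite mulmxDr mulmxDl.
apply: (mulfI two); rewrite mulr_natl mulr2n blf_polar !dE.
rewrite mulrCA [2%:R * _]mulr_natl mulr2n (blf_polar N N N') !det_mulmx; ring.
Qed.

Lemma lc_equiv M (A B : 'M[R]_3) z : lc (fun k => A *m M k *m B) z = A *m lc M z *m B.
Proof.
by rewrite /lc mulmx_sumr mulmx_suml; apply: eq_bigr => k _; rewrite -scalemxAr -scalemxAl.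
Qed.

Lemma smooth_equiv M (A B : 'M[R]_3) : A \in unitmx -> B \in unitmx ->
  smooth M -> smooth (fun k => A *m M k *m B).
Proof.
rewrite !unitmxE !unitfE => uA uB sm z /sm[j h]; exists j.
by rewrite lc_equiv blf_equiv !mulf_neq0.
Qed.

Lemma config_unitmx M a b : config M a b ->
  (\matrix_i a (widen5 i) \in unitmx) /\ (\matrix_i b (widen5 i) \in unitmx).
Proof.
move=> cf.
have al k : k \in [:: widen5 0; widen5 1; widen5 2%:R; 3%:R; 4%:R].
  by have := widen5_all 0 k; rewrite !add0r.
split; rewrite -unitmx_tr -row_free_unit -kermx_eq0; apply/rowV0P => w /sub_kermxP h;
  apply/eqP/negPn/negP => w0.
- have d i : dot3 (a (widen5 i)) w = 0.
    have /rowP/(_ i) := h; rewrite [RHS]mxE dot3C => <-; rewrite /dot3 !mxE.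
    by apply: eq_bigr => k _; rewrite !mxE.
  exact: (config_noncollinear cf al w0 (d _) (d _) (d _)).
- have d i : dot3 (b (widen5 i)) w = 0.
    have /rowP/(_ i) := h; rewrite [RHS]mxE dot3C => <-; rewrite /dot3 !mxE.
    by apply: eq_bigr => k _; rewrite !mxE.
  exact: (config_noncollinear_tr cf al w0 (d _) (d _) (d _)).
Qed.

Lemma config_equiv M a b (A B : 'M[R]_3) : A \in unitmx -> B \in unitmx -> config M a b ->
  config (fun k => A *m M k *m B^T) (fun k => a k *m invmx A) (fun k => b k *m invmx B).
Proof.
move=> uA uB [sm V K]; have uBT : B^T \in unitmx by rewrite unitmx_tr.
split; first exact: smooth_equiv.
- move=> k l; rewrite trmx_mul trmx_inv !mulmxA mulmxKV//.
  by rewrite -!mulmxA (mulmxA B^T) mulmxV// mul1mx !mulmxA V.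
- move=> N HN; have [|z zE] := K (invmx A *m N *m invmx B^T).
    by move=> k; rewrite -[RHS](HN k) trmx_mul trmx_inv !mulmxA.
  exists z; rewrite lc_equiv -zE !mulmxA mulmxV// mul1mx -mulmxA mulVmx// mulmx1.
  by [].
Qed.

Lemma all_lines_real_equiv M (A B : 'M[R]_3) :
  all_lines_real (fun k => A *m M k *m B) -> all_lines_real M.
Proof.
move=> al p q [rpq H]; apply: al; split => // s t.
rewrite /cubic_form (_ : \sum_(k < 4) _ = cplx_mx A *m (\sum_(k < 4) (s *: p + t *: q) 0 k *: cplx_mx (M k)) *m cplx_mx B).
  by rewrite !det_mulmx -/(cubic_form M (s *: p + t *: q)) H mulr0 mul0r.
rewrite mulmx_sumr mulmx_suml; apply: eq_bigr => k _.
by rewrite -scalemxAr -scalemxAl /cplx_mx !map_mxM.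
Qed.

Lemma covered5_lines_real M : smooth M -> covered5 (perp M) -> all_lines_real M.
Proof.
move=> sm /(covered5_config sm)[a [b cf]]; have [uA uB] := config_unitmx cf.
apply: (@all_lines_real_equiv _ (\matrix_i a (widen5 i)) (\matrix_i b (widen5 i))^T).
apply: (normalized_lines_real (config_equiv uA uB cf)) => i.
  by rewrite -(rowK (fun i => a (widen5 i))) -row_mul mulmxV// row1.
by rewrite -(rowK (fun i => b (widen5 i))) -row_mul mulmxV// row1.
Qed.

Lemma covered5_perp_iff M : smooth (cM M) -> sixpts (cM M) -> covered5 (perp M) <-> all_lines_real M.
Proof.
move=> /smooth_real sm six; split; first exact: covered5_lines_real.
exact: lines_real_covered5.
Qed.

End normalization.

(** * The two probabilities *)

Section gram.
Variables (F : fieldType) (p n : nat) (W : 'M[F]_(p, n)).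
Hypothesis d0 : \det (W *m W^T) != 0.

Let uG : W *m W^T \in unitmx. Proof. by rewrite unitmxE unitfE. Qed.

Lemma gram_rank : \rank W = p.
Proof.
apply/eqP; rewrite eqn_leq rank_leq_row /=.
by rewrite -{1}(mxrank_unit uG) mxrankM_maxl.
Qed.

Lemma gram_rowspace : (W^T *m W :=: W)%MS.
Proof.
apply/eqmxP; rewrite submxMl /=.
by rewrite -{1}[W]mul1mx -(mulVmx uG) -!mulmxA mulmxA submxMl.
Qed.

Lemma gram_kernel : (\det (W *m W^T) *: 1%:M - W^T *m \adj (W *m W^T) *m W :=: kermx W^T)%MS.
Proof.
apply/eqmxP/andP; split.
  apply/sub_kermxP; rewrite mulmxBl -scalemxAl mul1mx -!mulmxA mul_adj_mx.
  by rewrite mul_mx_scalar subrr.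
apply/row_subP => k; set v := row k _.
have vW : v *m W^T = 0 by apply/sub_kermxP; exact: row_sub.
have : v *m (\det (W *m W^T) *: 1%:M - W^T *m \adj (W *m W^T) *m W) = \det (W *m W^T) *: v.
  by rewrite mulmxBr -scalemxAr mulmx1 !mulmxA vW !mul0mx subr0.
move=> h; rewrite -[v](scalerK d0) -h; apply: scalemx_sub; exact: submxMl.
Qed.

End gram.

Section probabilities.
Variable R : realType.
Local Notation rT := (measurableTypeR R).
Local Notation C := R[i].

Lemma gen_gram (I : finType) p n (g : I -> 'I_p * 'I_n) (h : 'I_p * 'I_n -> I) : cancel h g -> (p <= n)%N ->
  gen (fun t : #|I|.-tuple R => \det (coord_mx h t *m (coord_mx h t)^T) != 0).
Proof.
move=> hK pn.
pose X (e : I -> C) : 'M[C]_(p, n) := \matrix_(l, c) e (h (l, c)).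
have sX : sepoly_mx X.
  by move=> l c; apply: eq_sepoly (sepoly_var (h (l, c))) => e; rewrite mxE.
have sXT : sepoly_mx (fun e => (X e)^T).
  by move=> c l; apply: eq_sepoly (sX l c) => e; rewrite [RHS]mxE.
pose D e := \det (X e *m (X e)^T).
have : genl (enum I) (fun e => D (cenv e) != 0) (fun=> 0 : R).
  apply: (@genl_sepoly _ _ D _ _ (fun k => (pid_mx p : 'M[C]_(p, n)) (g k).1 (g k).2)).
  - apply: sepoly_det; exact: sepoly_mulmx.
  - by move=> k; rewrite mem_enum.
  - rewrite /D; set Y := X _; have -> : Y = pid_mx p by apply/matrixP => l c; rewrite mxE hK.
    by rewrite tr_pid_mx mul_pid_mx minnn (minn_idPr pn) pid_mx_1 det1 oner_eq0.
move/gen_genl; apply: gen_imply => t; apply: contraNneq => d0.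
rewrite /D (_ : X _ = map_mx (real_complex R) (coord_mx h t)).
  by rewrite map_trmx -map_mxM det_map_mx d0 rmorph0.
by apply/matrixP => l c; rewrite !mxE.
Qed.

Lemma gen_gaussm : gen (fun z => \det (gaussm z : 'M[R]_(3 * 3)) != 0).
Proof.
have idK : cancel id (id : 'I_(3 * 3) * 'I_(3 * 3) -> _) by [].
apply: gen_imply (gen_gram idK (leqnn _)) => t.
by rewrite det_mulmx mulf_eq0 negb_or => /andP[_].
Qed.

Section coordinates.
Variables (I : finType) (p : nat) (g : I -> 'I_p * 'I_(3 * 3)) (h : 'I_p * 'I_(3 * 3) -> I).
Hypotheses (gK : cancel g h) (hK : cancel h g) (p9 : (p <= 3 * 3)%N).
Let W (t : #|I|.-tuple rT) : 'M[R]_(p, 3 * 3) := coord_mx h t.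
Let Nul := [set t : #|I|.-tuple rT | \det (W t *m (W t)^T) = 0].

Let mW l c : measurable_fun [set: #|I|.-tuple rT] (fun t => W t l c : rT).
Proof. exact: measurable_coord_mx. Qed.

Let mG l c : measurable_fun [set: #|I|.-tuple rT] (fun t => (W t *m (W t)^T) l c : rT).
Proof. by apply: measurable_mulmx => // i j; exact: measurable_trmx. Qed.

Let mNul : measurable Nul.
Proof. by apply: measurable_neq0; exact: measurable_det. Qed.

Let Nul0 : gaussn R _ Nul = 0%E.
Proof. by apply: gaussn_gen_null => //; apply: gen_imply (gen_gram hK p9) => t /eqP. Qed.

(** [(W t)^T *m W t] has the row space of [W t], and is conjugated by [Q] when [W t] is multiplied
    by [Q], which is the form required by [gaussn_covered5]. *)
Lemma gaussn_covered5_rows : p = 5%N -> gaussn R _ [set t | covered5 (W t)] = kappa R.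
Proof.
move=> p5; rewrite -(@gaussn_covered5 R gen_gaussm _ (fun t => (W t)^T *m W t) Nul) //.
- have mC : measurable [set t | covered5 (W t)] by exact: measurable_covered5.
  have mC' : measurable [set t | covered5 ((W t)^T *m W t)].
    by apply: measurable_covered5; apply: measurable_mulmx => // i j; exact: measurable_trmx.
  rewrite -!gauss_tuple_probE//; apply: gauss_tuple_prob_gen => //.
  apply: gen_imply (gen_gram hK p9) => t d0; apply: covered5_eqmx; apply: eqmx_sym; exact: gram_rowspace.
- by apply: measurable_mulmx => // i j; exact: measurable_trmx.
- move=> Q hQ; have [Q' hQ' QE] := coord_mx_orth gK hK hQ; exists Q' => // t.
  by rewrite /W QE trmx_mul !mulmxA.
- by move=> t /eqP d0; rewrite gram_rowspace// gram_rank.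
Qed.

Lemma measurable_adj d (T : measurableType d) n (A : T -> 'M[R]_n) :
  (forall i j, measurable_fun [set: T] (fun w => A w i j : rT)) ->
  forall i j, measurable_fun [set: T] (fun w => (\adj (A w)) i j : rT).
Proof.
move=> mA i j; under eq_fun do rewrite mxE /cofactor.
apply: measurable_funM; first exact: measurable_cst.
by apply: measurable_det => i' j'; under eq_fun do rewrite !mxE; exact: mA.
Qed.

Let K t := \det (W t *m (W t)^T) *: 1%:M - (W t)^T *m \adj (W t *m (W t)^T) *m W t.

(* K t is a polynomial multiple of the projection on the kernel of W t. *)
Lemma gauss_covered5_kernel (B : set (#|I|.-tuple rT)) : p = 4%N ->
  gen (fun t => covered5 (kermx (W t)^T) <-> B t) -> gauss_tuple_prob B = kappa R.
Proof.
move=> p4 HB.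
have mK i j : measurable_fun [set: #|I|.-tuple rT] (fun t => K t i j : rT).
  rewrite (_ : (fun t => _) = (fun t => \det (W t *m (W t)^T) * (i == j)%:R -
      ((W t)^T *m \adj (W t *m (W t)^T) *m W t) i j)); last first.
    by apply/funext => t; rewrite /K [LHS]mxE [X in X + _]mxE [X in _ * X]mxE [X in _ + X]mxE.
  apply: measurable_funB.
    by apply: measurable_funM; [exact: measurable_det|exact: measurable_cst].
  apply: measurable_mulmx => // i1 j1; apply: measurable_mulmx => // i2 j2.
    exact: measurable_trmx.
  exact: measurable_adj.
have mC : measurable [set t | covered5 (K t)] by exact: measurable_covered5.
rewrite -(@gaussn_covered5 R gen_gaussm _ K Nul mK) //.
- rewrite -gauss_tuple_probE//; symmetry; apply: gauss_tuple_prob_gen => //.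
  apply: gen_imply (gen_and HB (gen_gram hK p9)) => t [<- d0].
  exact: covered5_eqmx (gram_kernel d0).
- move=> Q hQ; have [Q' hQ' QE] := coord_mx_orth gK hK hQ; exists Q' => // t.
  have GE : W (act Q' t) *m (W (act Q' t))^T = W t *m (W t)^T.
    by rewrite /W QE trmx_mul mulmxA -(mulmxA _ Q) hQ mulmx1.
  rewrite /K GE mulmxBr mulmxBl -scalemxAr -scalemxAl mulmx1 (mulmx1C hQ).
  by rewrite /W QE trmx_mul !mulmxA.
- move=> t /eqP d0; rewrite (gram_kernel d0) mxrank_ker mxrank_tr (gram_rank d0) p4.
  by [].
Qed.

End coordinates.

Section tensor_side.
Variable T : 'I_3 -> 'I_3 -> 'I_5 -> R.
Definition slices : 'M[R]_(5, 3 * 3) := \matrix_l mxvec (\matrix_(i, j) T i j l).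

Lemma tensor_rank_leP r : tensor_rank_le T r <->
  exists a b : 'I_r -> 'rV[R]_3, (slices <= \matrix_k rank1 (a k) (b k))%MS.
Proof.
have E a b (D : 'M[R]_(5, r)) : slices = D *m \matrix_k rank1 (a k) (b k) <->
    forall i j l, T i j l = \sum_k a k 0 i * b k 0 j * D l k.
  split=> [sE i j l|H].
    transitivity (slices l (mxvec_index i j)); first by rewrite !mxE mxvecE mxE.
    rewrite sE mxE; apply: eq_bigr => k _.
    by rewrite mxE mxvecE mxE big_ord1 !mxE mulrC.
  apply/matrixP => l c; case/mxvec_indexP: c => i j.
  rewrite [LHS]mxE mxvecE mxE H [RHS]mxE; apply: eq_bigr => k _.
  by rewrite [X in _ = _ * X]mxE mxvecE mxE big_ord1 !mxE mulrC.
split=> [[a [b [c H]]]|[a [b /submxP[D /E H]]]].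
  exists (fun k => \row_i a k i), (fun k => \row_j b k j).
  apply/submxP; exists (\matrix_(l, k) c k l); apply/E => i j l.
  by rewrite H; apply: eq_bigr => k _; rewrite !mxE.
by exists (fun k i => a k 0 i), (fun k j => b k 0 j), (fun k l => D l k).
Qed.

(** Five independent slices force the rank to be at least 5, so rank 5 amounts to the existence of a
    decomposition of length 5. *)
Lemma tensor_rank5P : \rank slices = 5%N -> tensor_rank T = 5%N <-> covered5 slices.
Proof.
move=> r5.
have ge5 r : tensor_rank_le T r -> (5 <= r)%N.
  move=> /tensor_rank_leP[a [b /mxrankS]]; rewrite r5 => h; apply: leq_trans h (rank_leq_row _).
have -> : covered5 slices <-> tensor_rank_le T 5 by rewrite tensor_rank_leP.
rewrite /tensor_rank; case: pselect => [h|nh].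
  case: ex_minnP => m /asboolP mP mmin; split=> [m5|/asboolP/mmin m5]; first by rewrite m5 in mP.
  by apply/eqP; rewrite eqn_leq m5 ge5.
by split => // h; case: nh; exists 5%N; apply/asboolP.
Qed.

End tensor_side.

Definition unindex (c : 'I_(3 * 3)) : 'I_3 * 'I_3 := enum_val (cast_ord (esym (mxvec_cast 3 3)) c).

Lemma unindexK c : mxvec_index (unindex c).1 (unindex c).2 = c.
Proof. by rewrite /mxvec_index -surjective_pairing enum_valK cast_ordKV. Qed.

Lemma mxvec_indexK i j : unindex (mxvec_index i j) = (i, j).
Proof. by rewrite /unindex cast_ordK enum_rankK. Qed.

Lemma gauss_prob_rank5 :
  gauss_prob [set T : {ffun 'I_3 * 'I_3 * 'I_5 -> R} |
                tensor_rank (fun i j l => T (i, j, l)) = 5%N] = kappa R.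
Proof.
pose g (k : 'I_3 * 'I_3 * 'I_5) := (k.2, mxvec_index k.1.1 k.1.2).
pose h (q : 'I_5 * 'I_(3 * 3)) := (unindex q.2, q.1).
have gK : cancel g h by move=> [[i j] l]; rewrite /h /g /= mxvec_indexK.
have hK : cancel h g by move=> [l c]; rewrite /g /h /= unindexK.
rewrite /gauss_prob -(gaussn_covered5_rows gK hK)//.
have mC : measurable [set t : #|{: 'I_3 * 'I_3 * 'I_5}|.-tuple rT | covered5 (coord_mx h t)].
  by apply: measurable_covered5 => l c; exact: measurable_coord_mx.
rewrite -gauss_tuple_probE//; symmetry; apply: gauss_tuple_prob_gen => //.
apply: gen_imply (gen_gram hK isT) => t d0 /=.
set T := fun i j l => _.
have E : coord_mx h t = slices T.
  apply/matrixP => l c; rewrite -{2}(unindexK c) !mxE mxvecE mxE /T ffunE.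
  by rewrite /h /= -surjective_pairing.
have r5 : \rank (slices T) = 5%N by have := gram_rank d0; rewrite E.
by rewrite E tensor_rank5P.
Qed.

Lemma gauss_prob_all_lines_real :
  gauss_prob [set M : {ffun 'I_4 * 'I_3 * 'I_3 -> R} |
                all_lines_real (fun k => \matrix_(i < 3, j < 3) M (k, i, j))] = kappa R.
Proof.
pose g (k : 'I_4 * 'I_3 * 'I_3) := (k.1.1, mxvec_index k.1.2 k.2).
pose h (q : 'I_4 * 'I_(3 * 3)) := (q.1, (unindex q.2).1, (unindex q.2).2).
have gK : cancel g h by move=> [[l i] j]; rewrite /h /g /= mxvec_indexK.
have hK : cancel h g by move=> [l c]; rewrite /g /h /= unindexK.
apply: (gauss_covered5_kernel gK hK) => //.
have := genl_and (genl_smooth (fun=> 0 : R)) (genl_sixpts (fun=> 0 : R)).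
move=> /gen_genl; apply: gen_imply => t [sm six] /=.
set M := fun k => _.
have ME : Mof (cenv (fun k => tnth t (enum_rank k))) = cM M.
  by apply/funext => k; apply/matrixP => i j; rewrite !mxE /M ?mxE ffunE.
rewrite ME in sm six.
rewrite -(covered5_perp_iff sm six) /perp.
rewrite (_ : coord_mx h t = Wmx M)//.
by apply/matrixP => l c; rewrite -{2}(unindexK c) [LHS]mxE [RHS]mxE mxvecE /M mxE ffunE.
Qed.

End probabilities.

Theorem theorem1p3 (R : realType) :
  gauss_prob [set T : {ffun 'I_3 * 'I_3 * 'I_5 -> R} |
                tensor_rank (fun i j l => T (i, j, l)) = 5%N]
  = gauss_prob [set M : {ffun 'I_4 * 'I_3 * 'I_3 -> R} |
                  all_lines_real (fun k => \matrix_(i < 3, j < 3) M (k, i, j))].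
Proof. by rewrite gauss_prob_rank5 gauss_prob_all_lines_real. Qed.
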